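(* There is a constant $K>0$, depending only on $p$, such that for each $n\in\mathbb N$ and $(h,c)\in\mathbb N^2$, $$\mathbb P\left(\mathcal E_n^{h,c}\right)\le K\,\psi_0\left((h\wedge c)^2\right)(h\wedge c)^{-2-2\mu}.$$
   Context: $\mathbb N=\{1,2,\dots\}$. Fix $p\in(0,1/2)$. Let $\Theta=\{\mathsf B_H,\mathsf B_C,\mathsf O_H,\mathsf O_C,\mathsf O_F\}$ (hamburger, cheeseburger, hamburger order, cheeseburger order, flexible order). Finite words in $\Theta$ are considered modulo the relations $\mathsf B_C\mathsf O_C=\mathsf B_H\mathsf O_H=\mathsf B_C\mathsf O_F=\mathsf B_H\mathsf O_F=\emptyset$, $\mathsf B_C\mathsf O_H=\mathsf O_H\mathsf B_C$, $\mathsf B_H\mathsf O_C=\mathsf O_C\mathsf B_H$. $\mathcal R(x)$ is the word $x$ reduced modulo these relations, with all burgers to the right of all orders. Let $X=(X_i)_{i\in\mathbb Z}$ be i.i.d. with $\mathbb P(\mathsf B_H)=\mathbb P(\mathsf B_C)=\frac14$, $\mathbb P(\mathsf O_H)=\mathbb P(\mathsf O_C)=\frac{1-p}4$, $\mathbb P(\mathsf O_F)=\frac p2$. For integers $a\le b$, $X(a,b)=\mathcal R(X_a\dots X_b)$. $\mathcal E_n^{h,c}$ is the event that $X(1,n)$ contains no orders, exactly $h$ hamburgers and exactly $c$ cheeseburgers. $I=\inf\{i\in\mathbb N: X(1,i)\text{ contains an order}\}$. $\mu=\frac{\pi}{2(\pi-\arctan(\sqrt{1-2p}/p))}\in(1/2,1)$.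 A function $\psi$ is slowly varying if $\psi(\lambda t)/\psi(t)\to1$ as $t\to\infty$ for each $\lambda>0$. It is known that there is a slowly varying function $\psi_0:[0,\infty)\to(0,\infty)$ with $\mathbb P(I>n)=\psi_0(n)n^{-\mu}$ for all $n\in\mathbb N$; $\psi_0$ is fixed. *)

(* Defs.v *)
From HB Require Import structures.
From mathcomp Require Import all_boot all_order all_algebra.
From mathcomp Require Import all_classical all_reals all_analysis.
Set Implicit Arguments.
Unset Strict Implicit.
Unset Printing Implicit Defensive.
Import Order.TTheory GRing.Theory Num.Theory.
Import numFieldNormedType.Exports.
Local Open Scope classical_set_scope.
Local Open Scope ring_scope.

Inductive Theta : Type := B_H | B_C | O_H | O_C | O_F.

Definition nat_of_Theta (t : Theta) : nat :=
  match t with B_H => 0 | B_C => 1 | O_H => 2 | O_C => 3 | O_F => 4 end%N.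

Definition Theta_of_nat (k : nat) : Theta :=
  match k with 0 => B_H | 1 => B_C | 2 => O_H | 3 => O_C | _ => O_F end%N.

Lemma nat_of_ThetaK : cancel nat_of_Theta Theta_of_nat.
Proof. by case. Qed.

HB.instance Definition _ := Countable.copy Theta (can_type nat_of_ThetaK).

Definition Theta_enum : seq Theta := [:: B_H; B_C; O_H; O_C; O_F].

Lemma Theta_enumP : Finite.axiom Theta_enum.
Proof. by case. Qed.

HB.instance Definition _ := fintype.isFinite.Build Theta Theta_enumP.
HB.instance Definition _ := isPointed.Build Theta B_H.
HB.instance Definition _ := @isMeasurable.Build default_measure_display
  Theta discrete_measurable discrete_measurable0
  discrete_measurableC discrete_measurableU.

Definition is_order (t : Theta) : bool :=
  match t with O_H | O_C | O_F => true | B_H | B_C => false end.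

Definition is_burger (t : Theta) : bool := ~~ is_order t.

Inductive Theta_rel : seq Theta -> seq Theta -> Prop :=
| rel_BC_OC : Theta_rel [:: B_C; O_C] [::]
| rel_BH_OH : Theta_rel [:: B_H; O_H] [::]
| rel_BC_OF : Theta_rel [:: B_C; O_F] [::]
| rel_BH_OF : Theta_rel [:: B_H; O_F] [::]
| rel_BC_OH : Theta_rel [:: B_C; O_H] [:: O_H; B_C]
| rel_BH_OC : Theta_rel [:: B_H; O_C] [:: O_C; B_H].

Inductive Theta_congr : seq Theta -> seq Theta -> Prop :=
| congr_rel u l r v : Theta_rel l r -> Theta_congr (u ++ l ++ v) (u ++ r ++ v)
| congr_refl x : Theta_congr x x
| congr_sym x y : Theta_congr x y -> Theta_congr y x
| congr_trans x y z : Theta_congr x y -> Theta_congr y z -> Theta_congr x z.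

Definition reduced (x : seq Theta) : Prop :=
  exists o b : seq Theta, [/\ x = o ++ b, all is_order o & all is_burger b].

Fixpoint burger_cons (b : Theta) (x : seq Theta) : seq Theta :=
  match b, x with
  | B_C, O_C :: x' | B_H, O_H :: x' | B_C, O_F :: x' | B_H, O_F :: x' => x'
  | B_C, O_H :: x' => O_H :: burger_cons b x'
  | B_H, O_C :: x' => O_C :: burger_cons b x'
  | _, _ => b :: x
  end.

Definition reduce_cons (t : Theta) (x : seq Theta) : seq Theta :=
  if is_order t then t :: x else burger_cons t x.

(* The map $\mathcal R$, computed from the right end of the word; [reduceP]
   shows that it picks the only reduced word in each congruence class. *)
Definition reduce (x : seq Theta) : seq Theta := foldr reduce_cons [::] x.

Lemma congr_cons t x y : Theta_congr x y -> Theta_congr (t :: x) (t :: y).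
Proof.
elim=> [u l r v lr|{}x|{}x {}y _|{}x {}y z _ xy _ yz].
- exact: (congr_rel (t :: u) v lr).
- exact: congr_refl.
- exact: congr_sym.
- exact: congr_trans xy yz.
Qed.

Lemma burger_cons_congr b x : is_burger b ->
  Theta_congr (b :: x) (burger_cons b x).
Proof.
elim: x => [|t x IH] bb; first by case: b bb => // _; exact: congr_refl.
have one l r : Theta_rel l r -> Theta_congr (l ++ x) (r ++ x).
  exact: (congr_rel [::]).
case: b bb IH => // _ IH; case: t => /=; try exact: congr_refl.
- exact: (one _ _ rel_BH_OH).
- apply: congr_trans (one _ _ rel_BH_OC) _.
  by apply: congr_cons; exact: IH.
- exact: (one _ _ rel_BH_OF).
- apply: congr_trans (one _ _ rel_BC_OH) _.
  by apply: congr_cons; exact: IH.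
- exact: (one _ _ rel_BC_OC).
- exact: (one _ _ rel_BC_OF).
Qed.

Lemma reduce_congr x : Theta_congr x (reduce x).
Proof.
elim: x => [|t x IH]; first exact: congr_refl.
apply: congr_trans (congr_cons t IH) _; rewrite /= /reduce_cons.
case: ifPn => tO; first exact: congr_refl.
exact: burger_cons_congr.
Qed.

Lemma reduced_cons_order t x : is_order t -> reduced x -> reduced (t :: x).
Proof.
by move=> tO [ o [b [-> oO bB]]]; exists (t :: o), b; split=> //=; rewrite tO.
Qed.

Lemma reduced_burger_cons b x : is_burger b -> reduced x ->
  reduced (burger_cons b x).
Proof.
move=> bb [ o [s [-> oO sB]]] {x}.
elim: o oO => [_|t o IH /= /andP[tO oO]].
  have -> : burger_cons b ([::] ++ s) = b :: s.
    by case: b bb => // _; case: s sB => [|[] s] //=.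
  by exists [::], (b :: s); split => //=; rewrite bb.
have os : reduced (o ++ s) by exists o, s.
case: b bb IH => // _ IH; case: t tO => //= _.
- by apply: reduced_cons_order => //; exact: IH.
- by apply: reduced_cons_order => //; exact: IH.
Qed.

Lemma reduce_reduced x : reduced (reduce x).
Proof.
elim: x => [|t x IH]; first by exists [::], [::].
rewrite /= /reduce_cons; case: ifPn => tO.
- exact: reduced_cons_order.
- exact: reduced_burger_cons.
Qed.

Lemma reduce_id x : reduced x -> reduce x = x.
Proof.
move=> [ o [b [-> oO bB]]]; elim: o oO => [_|t o IH /= /andP[tO oO]].
  elim: b bB => [//|t b IH /= /andP[tB bB]].
  rewrite IH //= /reduce_cons (negbTE tB).
  by case: t tB => // _; case: b bB {IH} => [|[] b].
by rewrite IH // /reduce_cons tO.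
Qed.

Lemma reduce_eq x y : Theta_congr x y -> reduce x = reduce y.
Proof.
elim=> // [u l r v lr|{}x {}y z _ -> _ -> //].
by rewrite /reduce !foldr_cat; congr (foldr _ _ _); case: lr.
Qed.

Lemma reduceP x y : Theta_congr x y /\ reduced y <-> y = reduce x.
Proof.
split=> [[xy yr]|->]; first by rewrite (reduce_eq xy) reduce_id.
by split; [exact: reduce_congr | exact: reduce_reduced].
Qed.

Section Model.
Context {R : realType}.

Definition Theta_weight (p : R) (t : Theta) : R :=
  match t with
  | B_H | B_C => 1 / 4
  | O_H | O_C => (1 - p) / 4
  | O_F => p / 2
  end.

Definition mu_exp (p : R) : R :=
  pi / (2 * (pi - atan (Num.sqrt (1 - 2 * p) / p))).

Definition slowly_varying (psi : R -> R) : Prop :=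
  forall lambda : R, 0 < lambda ->
    psi (lambda * t) / psi t @[t --> +oo] --> (1 : R).

Context {d : measure_display} {T : measurableType d}.
Variable P : probability T R.
Variable X : int -> {RV P >-> Theta}.

Definition mutually_independent : Prop :=
  forall (s : seq int) (A : int -> set Theta), uniq s ->
    P [set w | forall i, i \in s -> A i (X i w)] =
    (\prod_(i <- s) P (X i @^-1` A i))%E.

Definition iid_letters (p : R) : Prop :=
  mutually_independent /\
  forall i t, P (X i @^-1` [set t]) = (Theta_weight p t)%:E.

Definition letters (a b : int) (w : T) : seq Theta :=
  [seq X (a + k%:Z) w | k <- iota 0 (if a <= b then `|b - a|%N.+1 else 0%N)].

Definition Xred (a b : int) (w : T) : seq Theta := reduce (letters a b w).

Definition event_E (n h c : nat) : set T :=
  [set w | [/\ ~~ has is_order (Xred 1 n%:Z w),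
               count_mem B_H (Xred 1 n%:Z w) = h &
               count_mem B_C (Xred 1 n%:Z w) = c]].

(* Equal to [+oo] if no [X(1,i)] contains an order. *)
Definition order_time (w : T) : \bar R :=
  ereal_inf [set (i%:R)%:E | i in
    [set i : nat | (0 < i)%N /\ has is_order (Xred 1 i%:Z w)]].

End Model.

(* Main.v *)
(* Read a word as two interleaved one-dimensional walks, one for each burger
   type, a subword consumed by a flexible order counting as one step. The
   weight of the words reducing to h hamburgers and c cheeseburgers is a
   pairing of G y^h and G y^c for the kernel 'C(a + b, a) / 2^(a + b). This kernel
   is the mean of z^a conj(z)^b over the points z = (1 + w) / 2 for w a root of
   unity, whence, with k = min(h, c) and the length as exponent of x,
     P(E_n^{h,c}) <= 4 mean_{w, x} |y(z, x) y(conj z, x)|^k.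
   A doubling inequality bounds |y(z, x) y(conj z, x)| by a product of a function
   of z and a function of x. At z = 1, 2 y = x (1 + y^2) gives
   1 - |y| >= c sqrt |Im x|, so that the mean over x is O(k^-2). At x = 1, the
   kernel method yields a quadratic relation putting y in a Stolz angle at 1:
   the mean over z is O(mean_z (1 + k |1 - y|)^-2). As the words
   without orders outweigh the pairing of sum_h y^h with itself, the latter is
   O(k^-2 sum_n r^n P(I > n)) with r = k^2 / (k^2 + 1). By regular variation, as
   mu < 1, this sum is O(k^2 P(I > k^2)). *)

Require Import Defs.
From HB Require Import structures.
From mathcomp Require Import all_boot all_order all_algebra.
From mathcomp Require Import complex.
From mathcomp Require Import all_classical all_reals all_analysis.
From mathcomp Require Import ring lra zify.
Set Implicit Arguments.
Unset Strict Implicit.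
Import Order.TTheory GRing.Theory Num.Theory.
Import numFieldNormedType.Exports.
Local Open Scope classical_set_scope.
Local Open Scope ring_scope.

(** The flexible orders make the law of the steps unknown: the weights of the words that they
    consume are values of the very pairing that these words drive. The circle closes on the curve z
    + z' = 2 z z', where the points z = (1 + w) / 2 lie with z' = conj z. There the unknown terms at
    z and at z' describe the two outcomes of one coin-tossing race, and their sum is a plain product
    of y(z) and y(z').

    The equation so obtained is one real relation between y and its conjugate. It confines y to an
    angle, but does not give the behaviour of y near z = 1, from which mu and psi_0 would be read
    off. So the mean over z is not computed: it is compared with a damped sum of P(I > n), and the
    asymptotics enter only through the hypothesis on I and mu < 1. The damping r is chosen so that 1
    - y(1, r) has order 1 / k. Series are cut at a length N, and every truncation error is a
    multiple of the tail [1 - smass N] of one probability law. *)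

(** * Formal power series *)

(** A named alias keeps the convolution ring apart from the pointwise structures on [nat -> A]. *)
Definition fps (A : Type) := nat -> A.

HB.instance Definition _ (A : Type) := gen_eqMixin (fps A).
HB.instance Definition _ (A : Type) := gen_choiceMixin (fps A).

Section FpsZmod.
Variable A : zmodType.
Implicit Types f g h : fps A.

Definition fps_add f g : fps A := fun n => f n + g n.
Definition fps_opp f : fps A := fun n => - f n.
Definition fps_zero : fps A := fun=> 0.

Lemma fps_addA : associative fps_add.
Proof. by move=> f g h; apply: funext => n; rewrite /fps_add addrA. Qed.
Lemma fps_addC : commutative fps_add.
Proof. by move=> f g; apply: funext => n; rewrite /fps_add addrC. Qed.
Lemma fps_add0 : left_id fps_zero fps_add.
Proof. by move=> f; apply: funext => n; rewrite /fps_add add0r. Qed.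
Lemma fps_addN : left_inverse fps_zero fps_opp fps_add.
Proof. by move=> f; apply: funext => n; rewrite /fps_add addNr. Qed.

HB.instance Definition _ :=
  GRing.isZmodule.Build (fps A) fps_addA fps_addC fps_add0 fps_addN.

Lemma fpsDE f g n : (f + g) n = f n + g n. Proof. by []. Qed.
Lemma fpsNE f n : (- f) n = - f n. Proof. by []. Qed.
Lemma fpsBE f g n : (f - g) n = f n - g n. Proof. by []. Qed.
Lemma fps0E n : (0 : fps A) n = 0. Proof. by []. Qed.
Lemma fps_sumE I (r : seq I) (P : pred I) (F : I -> fps A) n :
  (\sum_(i <- r | P i) F i) n = \sum_(i <- r | P i) F i n.
Proof. by elim/big_rec2: _ => // i y x _ <-. Qed.

End FpsZmod.

Section FpsRing.
Variable A : comNzRingType.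
Implicit Types f g h : fps A.

Definition fps_mul f g : fps A := fun n => \sum_(i < n.+1) f i * g (n - i)%N.
Definition fps_one : fps A := fun n => (n == 0%N)%:R.

(** The ring laws are borrowed from polynomials: a coefficient of a product sees only coefficients
    up to its own index, so truncation costs nothing. *)
Lemma fps_mul_poly f g n (p q : {poly A}) :
  (forall i, (i <= n)%N -> p`_i = f i) -> (forall i, (i <= n)%N -> q`_i = g i) ->
  (p * q)`_n = fps_mul f g n.
Proof.
move=> pf qg; rewrite coefM; apply: eq_bigr => i _.
by rewrite pf ?qg ?leq_subr // -ltnS.
Qed.

Definition fps_trunc n f : {poly A} := \poly_(i < n.+1) f i.

Lemma fps_truncE n f i : (i <= n)%N -> (fps_trunc n f)`_i = f i.
Proof. by move=> i_n; rewrite coef_poly ltnS i_n. Qed.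

Lemma fps_trunc_mul n f g i : (i <= n)%N ->
  (fps_trunc n f * fps_trunc n g)`_i = fps_mul f g i.
Proof.
by move=> i_n; apply: fps_mul_poly => j j_i; rewrite fps_truncE ?(leq_trans j_i).
Qed.

Lemma fps_mulC : commutative fps_mul.
Proof.
by move=> f g; apply: funext => n; rewrite -!(@fps_trunc_mul n) // mulrC.
Qed.

Lemma fps_mulA : associative fps_mul.
Proof.
move=> f g h; apply: funext => n.
rewrite -(@fps_mul_poly f (fps_mul g h) n (fps_trunc n f)
    (fps_trunc n g * fps_trunc n h)).
- rewrite mulrA; apply: fps_mul_poly => i i_n.
    by rewrite fps_trunc_mul.
  by rewrite fps_truncE.
- by move=> i i_n; rewrite fps_truncE.
- by move=> i i_n; rewrite fps_trunc_mul.
Qed.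

Lemma fps_mul1 : left_id fps_one fps_mul.
Proof.
move=> f; apply: funext => n; rewrite /fps_mul big_ord_recl /= subn0 mul1r.
by rewrite big1 ?addr0 // => i _; rewrite /fps_one /= mul0r.
Qed.

Lemma fps_mulDl : left_distributive fps_mul (@fps_add A).
Proof.
move=> f g h; apply: funext => n; rewrite /fps_mul /fps_add -big_split /=.
by apply: eq_bigr => i _; rewrite mulrDl.
Qed.

Lemma fps_one_neq0 : fps_one != 0.
Proof.
apply/eqP => /(congr1 (fun f => f 0%N)); rewrite /fps_one /= fps0E => /eqP.
by rewrite oner_eq0.
Qed.

HB.instance Definition _ := GRing.Zmodule_isComNzRing.Build (fps A)
  fps_mulA fps_mulC fps_mul1 fps_mulDl fps_one_neq0.

Lemma fpsME f g n : (f * g) n = \sum_(i < n.+1) f i * g (n - i)%N.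
Proof. by []. Qed.

Lemma fps1E n : (1 : fps A) n = (n == 0%N)%:R. Proof. by []. Qed.

Definition fpsC (a : A) : fps A := fun n => if n == 0%N then a else 0.

Lemma fpsC_mulE a f n : (fpsC a * f) n = a * f n.
Proof.
rewrite fpsME big_ord_recl /= subn0 big1 ?addr0 // => i _.
by rewrite /fpsC /= mul0r.
Qed.

Lemma fpsC_is_additive : additive fpsC.
Proof.
move=> a b; apply: funext => n.
by rewrite fpsBE /fpsC; case: ifP => _; rewrite ?subr0.
Qed.

Lemma fpsC_is_multiplicative : multiplicative fpsC.
Proof.
split; last by apply: funext => -[].
move=> a b; apply: funext => n; rewrite fpsC_mulE /fpsC.
by case: ifP => _; rewrite ?mulr0.
Qed.

HB.instance Definition _ := GRing.isAdditive.Build A (fps A) fpsC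
  fpsC_is_additive.
HB.instance Definition _ := GRing.isMultiplicative.Build A (fps A) fpsC
  fpsC_is_multiplicative.

Definition fpsX : fps A := fun n => (n == 1%N)%:R.

Lemma fpsXM0 f : (fpsX * f) 0%N = 0.
Proof. by rewrite fpsME big_ord1 /fpsX /= mul0r. Qed.

Lemma fpsXMS f n : (fpsX * f) n.+1 = f n.
Proof.
rewrite fpsME big_ord_recl /= /fpsX /= mul0r add0r big_ord_recl /= mul1r.
by rewrite subSS subn0 big1 ?addr0 // => i _; rewrite mul0r.
Qed.

Lemma fps_exp_val f m n : f 0%N = 0 -> (n < m)%N -> (f ^+ m) n = 0.
Proof.
move=> f0; elim: m n => // m IH n nm; rewrite exprS fpsME big1 // => i _.
case: (posnP i) => [->|i0]; first by rewrite f0 mul0r.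
by rewrite IH ?mulr0 //; move: (ltn_ord i); lia.
Qed.

Lemma fps_mul_val f g m n : (forall i, (i < m)%N -> g i = 0) -> (n < m)%N ->
  (f * g) n = 0.
Proof. by move=> gm nm; rewrite fpsME big1 // => i _; rewrite gm ?mulr0 //; lia. Qed.

End FpsRing.

(** * Substitution into power series *)

Section FpsComp.
Variable A : comNzRingType.
Implicit Types (F G : fps (fps A)) (f y : fps A).

(** When [y 0 = 0], the power [y ^+ m] starts at index m, so that the sum cut at n is the full
    one. *)
Definition fps_comp (F : fps (fps A)) (y : fps A) : fps A :=
  fun n => (\sum_(m < n.+1) F m * y ^+ m) n.

Lemma fps_comp_trunc F y n N : y 0%N = 0 -> (n <= N)%N ->
  fps_comp F y n = (fps_trunc N F).[y] n.
Proof.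
move=> y0 nN; rewrite /fps_trunc horner_poly /fps_comp !fps_sumE.
rewrite (big_ord_widen N.+1 (fun m => (F m * y ^+ m) n)) // big_mkcond /=.
apply: eq_bigr => m _; case: ifPn => //; rewrite -leqNgt => nm.
by rewrite (@fps_mul_val _ _ _ m) // => i im; rewrite fps_exp_val.
Qed.

Lemma fps_compD F G y : fps_comp (F + G) y = fps_comp F y + fps_comp G y.
Proof.
apply: funext => n; rewrite fpsDE /fps_comp -fpsDE -big_split /=.
by congr (_ n); apply: eq_bigr => i _; rewrite mulrDl.
Qed.

Lemma fps_compN F y : fps_comp (- F) y = - fps_comp F y.
Proof.
apply: funext => n; rewrite fpsNE /fps_comp -fpsNE -sumrN.
by congr (_ n); apply: eq_bigr => i _; rewrite mulNr.
Qed.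

Lemma fps_compM F G y : y 0%N = 0 ->
  fps_comp (F * G) y = fps_comp F y * fps_comp G y.
Proof.
move=> y0; apply: funext => n; rewrite (fps_comp_trunc _ y0 (leqnn n)).
have -> : (fps_comp F y * fps_comp G y) n =
    ((fps_trunc n F * fps_trunc n G).[y]) n.
  rewrite hornerM !fpsME; apply: eq_bigr => i _.
  by rewrite !(@fps_comp_trunc _ _ _ n) ?leq_subr // -ltnS.
apply/eqP; rewrite -subr_eq0 -fpsBE -hornerN -hornerD; apply/eqP.
(* The coefficients of [P] up to index n vanish, and [y ^+ i] has no coefficient of index n when i >
   n. *)
set P := _ - _; rewrite horner_coef fps_sumE big1 // => i _.
have [ni|ni] := ltnP n i.
  by rewrite (@fps_mul_val _ _ _ i) // => j ji; rewrite fps_exp_val.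
by rewrite /P coefB fps_trunc_mul // fps_truncE // subrr mul0r.
Qed.

Lemma fps_compC (f y : fps A) :
  fps_comp (fun n => if n == 0%N then f else 0) y = f.
Proof.
apply: funext => n; rewrite /fps_comp big_ord_recl /= expr0 mulr1.
by rewrite big1 ?addr0 // => i _; rewrite mul0r.
Qed.

End FpsComp.

Lemma fps_comp_C (A : comNzRingType) (f y : fps A) : fps_comp (fpsC f) y = f.
Proof. exact: fps_compC. Qed.

Lemma fps_comp_X (A : comNzRingType) (y : fps A) : y 0%N = 0 ->
  fps_comp (@fpsX (fps A)) y = y.
Proof.
move=> y0; apply: funext => n; rewrite (fps_comp_trunc _ y0 (leqnSn n)).
rewrite /fps_trunc horner_poly big_ord_recl big_ord_recl /= /fpsX /= mul0r.
rewrite add0r mul1r expr1 big1 ?addr0 // => i _.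
by rewrite mul0r.
Qed.

(** * Coefficientwise maps and fixed points *)

Definition fps_map (A B : Type) (phi : A -> B) (f : fps A) : fps B :=
  fun n => phi (f n).

Section FpsMap.
Variables (A B : comNzRingType) (phi : {rmorphism A -> B}).

Lemma fps_map_is_additive : additive (fps_map phi).
Proof. by move=> f g; apply: funext => n; rewrite /fps_map !fpsBE rmorphB. Qed.

Lemma fps_map_is_multiplicative : multiplicative (fps_map phi).
Proof.
split=> [f g|]; apply: funext => n.
  rewrite /fps_map !fpsME rmorph_sum; apply: eq_bigr => i _.
  by rewrite rmorphM.
by rewrite /fps_map !fps1E rmorph_nat.
Qed.

HB.instance Definition _ := GRing.isAdditive.Build (fps A) (fps B) (fps_map phi)
  fps_map_is_additive.
HB.instance Definition _ := GRing.isMultiplicative.Build (fps A) (fps B)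
  (fps_map phi) fps_map_is_multiplicative.

End FpsMap.

(* Locked: otherwise unification unfolds it while matching sums and products. *)
HB.lock Definition fps_fix (A : comNzRingType) (I : Type)
    (Phi : (I -> fps A) -> I -> fps A) (i : I) : fps A :=
  fun n => iter n.+1 Phi (fun=> 0) i n.

Section FpsFixpoint.
Variables (A : comNzRingType) (I : Type).
Variable Phi : (I -> fps A) -> I -> fps A.
Hypothesis contract : forall k (f g : I -> fps A),
  (forall i n, (n < k)%N -> f i n = g i n) ->
  forall i n, (n < k.+1)%N -> Phi f i n = Phi g i n.

(** Each application of [Phi] settles one more coefficient, whatever the starting point. *)
Lemma iter_stable k l f i n : (n < k)%N -> (k <= l)%N ->
  iter l Phi f i n = iter k Phi (fun=> 0) i n.
Proof.
elim: k l i n => // k IH [//|l] i n nk kl /=.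
by apply: contract nk => j m mk; apply: IH.
Qed.

Lemma fps_fixE k i n : (n < k)%N -> fps_fix Phi i n = iter k Phi (fun=> 0) i n.
Proof. by move=> nk; rewrite fps_fix.unlock; apply: esym; apply: iter_stable. Qed.

Lemma fps_fixP i : Phi (fps_fix Phi) i = fps_fix Phi i.
Proof.
apply: funext => n; rewrite [RHS](@fps_fixE n.+1) //=.
by apply: (@contract n) => // j m mn; apply: fps_fixE.
Qed.

End FpsFixpoint.

(** * The pairing of two walks by fair coin tosses *)

Notation fps_polyC := (fps_map polyC).

Section BinomialKernel.
Variable C : numFieldType.
Implicit Types p q : {poly C}.

(** The probability that a + b fair tosses assign a steps to the first walk and b to the second. *)
Definition binK (a b : nat) : C := 'C(a + b, a)%:R / 2 ^+ (a + b).

Lemma binKC a b : binK a b = binK b a.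
Proof.
rewrite /binK [in LHS]addnC; congr (_%:R / _).
by rewrite -[RHS]bin_sub ?leq_addr // addKn.
Qed.

Lemma binK0n b : binK 0 b = 2^-1 ^+ b.
Proof. by rewrite /binK add0n bin0 mul1r exprVn. Qed.

Lemma binKSS a b : binK a.+1 b.+1 = (binK a.+1 b + binK a b.+1) / 2.
Proof.
rewrite /binK addSn binS addnS addSn natrD !exprS.
by rewrite addrC; field; rewrite expf_neq0 // pnatr_eq0.
Qed.

Lemma binK_ge0 a b : 0 <= binK a b.
Proof. by rewrite divr_ge0 ?exprn_ge0 ?ler0n. Qed.

Definition Kp p q : C := \sum_(a < size p) \sum_(b < size q) p`_a * q`_b * binK a b.

Lemma Kp_wide p q m n : (size p <= m)%N -> (size q <= n)%N ->
  Kp p q = \sum_(a < m) \sum_(b < n) p`_a * q`_b * binK a b.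
Proof.
move=> pm qn; rewrite /Kp.
rewrite (big_ord_widen m (fun a => \sum_(b < size q) p`_a * q`_b * binK a b)) //.
rewrite big_mkcond; apply: eq_bigr => a _ /=; case: ifPn => [_|].
  rewrite (big_ord_widen n (fun b => p`_a * q`_b * binK a b)) // big_mkcond.
  apply: eq_bigr => b _ /=; case: ifPn => //; rewrite -leqNgt => qb.
  by rewrite (nth_default _ qb) mulr0 mul0r.
rewrite -leqNgt => pa; rewrite big1 // => b _.
by rewrite (nth_default _ pa) !mul0r.
Qed.

Lemma KpC p q : Kp p q = Kp q p.
Proof.
rewrite /Kp exchange_big; apply: eq_bigr => a _; apply: eq_bigr => b _.
by rewrite binKC [q`__ * _]mulrC.
Qed.

Lemma Kp_is_additive p : additive (Kp p).
Proof.
move=> q r; set n := maxn (size q) (size r).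
have nB : (size (q - r)%R <= n)%N by rewrite /n -(size_polyN r) size_polyD.
rewrite !(@Kp_wide p _ (size p) n) ?leq_maxl ?leq_maxr // -sumrB.
apply: eq_bigr => a _; rewrite -sumrB; apply: eq_bigr => b _.
by rewrite coefB; ring.
Qed.

HB.instance Definition _ p := GRing.isAdditive.Build {poly C} C (Kp p)
  (Kp_is_additive p).

Lemma KpDl p1 p2 q : Kp (p1 + p2) q = Kp p1 q + Kp p2 q.
Proof. by rewrite KpC raddfD /= !(KpC q). Qed.

Lemma KpCr a p q : Kp p (a%:P * q) = a * Kp p q.
Proof.
rewrite (@Kp_wide _ _ (size p) (size q)) //; last first.
  by rewrite mul_polyC size_scale_leq.
rewrite /Kp mulr_sumr; apply: eq_bigr => i _; rewrite mulr_sumr.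
by apply: eq_bigr => b _; rewrite coefCM; ring.
Qed.

Lemma KpCl a p q : Kp (a%:P * p) q = a * Kp p q.
Proof. by rewrite KpC KpCr KpC. Qed.

Lemma size_XM_le p : (size ('X * p)%R <= (size p).+1)%N.
Proof. by rewrite (leq_trans (size_polyMleq _ _)) // size_polyX. Qed.

Lemma KpXl p q : Kp ('X * p) q =
  \sum_(a < size p) \sum_(b < size q) p`_a * q`_b * binK a.+1 b.
Proof.
rewrite (@Kp_wide _ _ (size p).+1 (size q)) ?size_XM_le // big_ord_recl /=.
rewrite big1 ?add0r => [|b _]; last by rewrite coefXM /= !mul0r.
by apply: eq_bigr => a _; apply: eq_bigr => b _; rewrite coefXM.
Qed.

Lemma KpXr p q : Kp p ('X * q) =
  \sum_(a < size p) \sum_(b < size q) p`_a * q`_b * binK a b.+1.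
Proof.
rewrite KpC KpXl exchange_big; apply: eq_bigr => a _; apply: eq_bigr => b _.
by rewrite binKC [q`__ * _]mulrC.
Qed.

Lemma KpXX p q : Kp ('X * p) ('X * q) = (Kp ('X * p) q + Kp p ('X * q)) / 2.
Proof.
have -> : Kp ('X * p) ('X * q) = \sum_(a < size p) \sum_(b < size q)
    p`_a * q`_b * binK a.+1 b.+1.
  rewrite (@Kp_wide _ _ (size p).+1 (size q).+1) ?size_XM_le // big_ord_recl /=.
  rewrite big1 ?add0r => [|b _]; last by rewrite coefXM /= !mul0r.
  apply: eq_bigr => a _; rewrite big_ord_recl coefXM /= [('X * q)`_0]coefXM /=.
  rewrite mulr0 mul0r add0r.
  by apply: eq_bigr => b _; rewrite !coefXM.
rewrite KpXl KpXr -big_split /= mulr_suml; apply: eq_bigr => a _.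
rewrite -big_split /= mulr_suml; apply: eq_bigr => b _.
by rewrite binKSS; ring.
Qed.

(** The boundary case of [KpXX]: with no step on one side, the kernel is a power of 1 / 2. *)
Lemma KpCX a q : Kp a%:P ('X * q) = Kp a%:P q / 2.
Proof.
have sa : (size a%:P <= 1)%N by rewrite size_polyC leq_b1.
rewrite KpXr /Kp mulr_suml; apply: eq_bigr => i _; rewrite mulr_suml.
apply: eq_bigr => b _; have -> : val i = 0%N.
  by case: i => i /= ilt; apply/eqP; rewrite -leqn0 -ltnS (leq_trans ilt).
by rewrite !binK0n exprS; ring.
Qed.

Lemma KpXC a q : Kp ('X * q) a%:P = Kp q a%:P / 2.
Proof. by rewrite KpC KpCX KpC. Qed.

Lemma KpCC a b : Kp a%:P b%:P = a * b.
Proof.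
rewrite (@Kp_wide _ _ 1 1) ?size_polyC ?leq_b1 // !big_ord1 !coefC /=.
by rewrite binK0n expr0 mulr1.
Qed.

Lemma Kp_ge0 p q : (forall a, 0 <= p`_a) -> (forall a, 0 <= q`_a) -> 0 <= Kp p q.
Proof.
move=> p0 q0; apply: sumr_ge0 => a _; apply: sumr_ge0 => b _.
by rewrite !mulr_ge0 ?binK_ge0.
Qed.

Lemma KpXn p b : Kp p 'X^b = \sum_(a < size p) p`_a * binK a b.
Proof.
rewrite (@Kp_wide _ _ (size p) b.+1) ?size_polyXn //.
apply: eq_bigr => a _; rewrite big_ord_recr /= coefXn eqxx mulr1 big1 ?add0r //.
by move=> i _; rewrite coefXn (ltn_eqF (ltn_ord i)) mulr0 mul0r.
Qed.

(** Two walks run side by side: their lengths add up, and their steps are interleaved with the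
    weight [binK]. *)
Definition pair (f g : fps {poly C}) : fps C :=
  fun n => \sum_(i < n.+1) Kp (f i) (g (n - i)%N).

Lemma pairDl f1 f2 g : pair (f1 + f2) g = pair f1 g + pair f2 g.
Proof.
apply: funext => n; rewrite fpsDE /pair -big_split /=; apply: eq_bigr => i _.
by rewrite fpsDE KpDl.
Qed.

Lemma pairC f g : pair f g = pair g f.
Proof.
apply: funext => n; rewrite /pair (reindex_inj rev_ord_inj) /=.
by apply: eq_bigr => i _; rewrite subSS (subKn (leq_ord i)) KpC.
Qed.

Lemma pairDr f g1 g2 : pair f (g1 + g2) = pair f g1 + pair f g2.
Proof. by rewrite pairC pairDl !(pairC f). Qed.

Lemma pair0 f : pair f 0 = 0.
Proof.
apply: funext => n; rewrite /pair big1 // => i _.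
by rewrite fps0E raddf0.
Qed.

Lemma pair_sumr f I (r : seq I) (F : I -> fps {poly C}) :
  pair f (\sum_(i <- r) F i) = \sum_(i <- r) pair f (F i).
Proof.
elim: r => [|i r IH]; first by rewrite !big_nil pair0.
by rewrite !big_cons pairDr IH.
Qed.

(** A series free of the step variable is a scalar for the pairing. This applies to consumed
    subwords, whose inner letters have length but are not steps. *)
Lemma pairZr (s : fps C) f g : pair f (fps_polyC s * g) = s * pair f g.
Proof.
apply: funext => n; rewrite /pair.
under eq_bigr => i _ do rewrite fpsME raddf_sum /=.
have E (i j : nat) : Kp (f i) (fps_polyC s j * g (n - i - j)%N) =
    s j * Kp (f i) (g (n - i - j)%N) by rewrite KpCr.
under eq_bigr => i _ do under eq_bigr => j _ do rewrite E.
rewrite fpsME /pair; under [RHS]eq_bigr => i _ do rewrite mulr_sumr.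
have W (i : 'I_n.+1) : \sum_(j < (n - i).+1) s j * Kp (f i) (g (n - i - j)%N) =
    \sum_(j < n.+1 | (i + j <= n)%N) s j * Kp (f i) (g (n - i - j)%N).
  rewrite (big_ord_widen n.+1 (fun j => s j * Kp (f i) (g (n - i - j)%N))).
    apply: eq_bigl => j; move: (ltn_ord i) (ltn_ord j); lia.
  by rewrite ltnS leq_subr.
have V (i : 'I_n.+1) : \sum_(j < (n - i).+1) s i * Kp (f j) (g (n - i - j)%N) =
    \sum_(j < n.+1 | (j + i <= n)%N) s i * Kp (f j) (g (n - j - i)%N).
  rewrite (big_ord_widen n.+1 (fun j => s i * Kp (f j) (g (n - i - j)%N))).
    rewrite (eq_bigl (fun j : 'I_n.+1 => (j + i <= n)%N)); last first.
      by move=> j; move: (ltn_ord i) (ltn_ord j); lia.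
    by apply: eq_bigr => j _; rewrite subnAC.
  by rewrite ltnS leq_subr.
under eq_bigr => i _ do rewrite W.
under [RHS]eq_bigr => i _ do rewrite V.
by rewrite (exchange_big_dep xpredT).
Qed.

Lemma pair_rec0 f g (a b : C) : f 0%N = a%:P -> g 0%N = b%:P ->
  pair f g 0%N = a * b.
Proof. by move=> fa gb; rewrite /pair big_ord1 /= fa gb KpCC. Qed.

(* The identity [KpXX] is Pascal's rule: the last step is made either
   on the first coordinate or on the second one, with probability 1/2. *)
Lemma pair_recS f g F G (a b : C) n : f 0%N = a%:P -> g 0%N = b%:P ->
  (forall m, f m.+1 = 'X * F m) -> (forall m, g m.+1 = 'X * G m) ->
  pair f g n.+1 = (pair F g n + pair f G n) / 2.
Proof.
move=> fa gb fF gG; rewrite /pair big_ord_recl big_ord_recr /= subnn.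
rewrite [in RHS]big_ord_recr /= subnn [in RHS](big_ord_recl n) /= subn0 /bump /=.
rewrite add1n subn0 fa gb fF gG KpCX KpXC.
have -> : \sum_(i < n) Kp (f (0 + i.+1)%N) (g (n.+1 - (0 + i.+1))%N) =
    (\sum_(i < n) Kp (F i) (g (n - i)%N)
     + \sum_(i < n) Kp (f (0 + i.+1)%N) (G (n - (0 + i.+1))%N)) / 2.
  rewrite -big_split mulr_suml /=; apply: eq_bigr => i _.
  rewrite add0n subSS fF.
  have -> : (n - i)%N = (n - i.+1).+1 by move: (ltn_ord i); lia.
  by rewrite gG KpXX addrC.
by field.
Qed.

End BinomialKernel.

(** * One-dimensional walks *)

Section EqModulo.
Variable A : comNzRingType.
Implicit Types f g : fps A.

Definition eqm k f g := forall n, (n < k)%N -> f n = g n.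

Lemma eqmD k f g f' g' : eqm k f f' -> eqm k g g' -> eqm k (f + g) (f' + g').
Proof. by move=> ef eg n nk; rewrite !fpsDE ef ?eg. Qed.

Lemma eqmM k f g f' g' : eqm k f f' -> eqm k g g' -> eqm k (f * g) (f' * g').
Proof.
move=> ef eg n nk; rewrite !fpsME; apply: eq_bigr => i _.
by rewrite ef ?eg //; move: (ltn_ord i); lia.
Qed.

Lemma eqm_refl k f : eqm k f f. Proof. by []. Qed.

Lemma eqm_exp k f g m : eqm k f g -> eqm k (f ^+ m) (g ^+ m).
Proof. by move=> e; elim: m => [|m IH]; rewrite ?exprS //; apply: eqmM. Qed.

Lemma eqm_sum k I (r : seq I) (F G : I -> fps A) :
  (forall i, eqm k (F i) (G i)) ->
  eqm k (\sum_(i <- r) F i) (\sum_(i <- r) G i).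
Proof. by move=> e n nk; rewrite !fps_sumE; apply: eq_bigr => i _; apply: e. Qed.

Lemma eqm_comp k F f g : eqm k f g -> eqm k (fps_comp F f) (fps_comp F g).
Proof.
move=> e n nk; rewrite /fps_comp; apply: (@eqm_sum k) => // i.
by apply: eqmM => //; apply: eqm_exp.
Qed.

End EqModulo.

Lemma fps_comp_mulE (A : comNzRingType) (F : fps (fps A)) (y f : fps A) n :
  y 0%N = 0 -> (fps_comp F y * f) n = \sum_(m < n.+1) (F m * (y ^+ m * f)) n.
Proof.
move=> y0; transitivity (((fps_trunc n F).[y] * f) n).
  rewrite !fpsME; apply: eq_bigr => i _.
  by rewrite (@fps_comp_trunc _ _ _ _ n) // -ltnS.
rewrite /fps_trunc horner_poly mulr_suml fps_sumE.
by apply: eq_bigr => m _; rewrite mulrA.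
Qed.

Lemma fps_comp_map (A B : comNzRingType) (phi : {rmorphism A -> B}) F y :
  fps_map phi (fps_comp F y) = fps_comp (fps_map (fps_map phi) F) (fps_map phi y).
Proof.
apply: funext => n.
transitivity (fps_map phi (\sum_(m < n.+1) F m * y ^+ m) n) => //.
rewrite rmorph_sum /= /fps_comp; congr (_ n); apply: eq_bigr => m _.
by rewrite rmorphM rmorphXn.
Qed.

Section Renewal.
Variables (C : numFieldType) (p : C) (D0 : nat -> nat -> C).
Local Notation S := (fps {poly C}).

(* In [fps {poly C}] the exponent of the series variable is the length of a word,
   and that of 'X its number of steps, a subword consumed by a flexible order
   counting as one step.
   [D0 l m] stands for the weight of the words of length l reducing to m orders
   of one type; [excS m] is the generating function, in the length, of the
   words consumed by a flexible order and reducing to m orders. *)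
Definition excS (m : nat) : fps C := fun n => if n is l.+1 then D0 l m / 2 else 0.
Definition excP : fps S := fun m => fps_polyC (excS m).

Definition kS (a : C) : S := fpsC a%:P.
Definition ZX : S := fpsC 'X * @fpsX _.

Lemma kSE a (f : S) n : (kS a * f) n = a%:P * f n.
Proof. exact: fpsC_mulE. Qed.

Lemma ZX0 f : (ZX * f) 0%N = 0.
Proof. by rewrite /ZX -mulrA fpsC_mulE fpsXM0 mulr0. Qed.

Lemma ZXS f n : (ZX * f) n.+1 = 'X * f n.
Proof. by rewrite /ZX -mulrA fpsC_mulE fpsXMS. Qed.

Lemma ZX_eqm k f g : eqm k f g -> eqm k.+1 (ZX * f) (ZX * g).
Proof. by move=> e [|n] nk; rewrite ?ZX0 ?ZXS ?e. Qed.

Lemma ZXI f g : ZX * f = ZX * g -> f = g.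
Proof.
move=> e; apply: funext => n; have := congr1 (fun h => h n.+1) e.
by rewrite !ZXS; apply: mulfI; rewrite polyX_eq0.
Qed.

(** Read backwards, a passage is a first descent by one level: its first step descends, or rises by
    one and leaves two descents, or rises by m, a consumed word being read, and leaves m + 1
    descents. *)
Definition step_gf (c : S) : S :=
  kS 2^-1 + kS ((1 - p) / 2) * c ^+ 2 + kS (p / 2) * (c * fps_comp excP c).

Lemma step_eqm k f g : eqm k f g -> eqm k (step_gf f) (step_gf g).
Proof.
move=> e; apply: eqmD; [apply: eqmD; [exact: eqm_refl|]|].
  by apply: eqmM; [exact: eqm_refl|exact: eqm_exp].
by apply: eqmM; [exact: eqm_refl|apply: eqmM; [exact: e|exact: eqm_comp]].
Qed.

(* The part of a walk between its last visits to two consecutive heights. *)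
Definition passS : S :=
  fps_fix (fun (f : unit -> S) (_ : unit) => ZX * step_gf (f tt)) tt.

Lemma passE : passS = ZX * step_gf passS.
Proof.
apply/esym/(@fps_fixP _ _ (fun f _ => ZX * step_gf (f tt))) => k f g e i n nk.
by apply: ZX_eqm nk => m mk; apply: step_eqm mk => j jk; apply: e.
Qed.

Lemma pass0 : passS 0%N = 0.
Proof. by rewrite passE ZX0. Qed.

Lemma passSE n : passS n.+1 = 'X * step_gf passS n.
Proof. by rewrite {1}passE ZXS. Qed.

(** The walks that stay nonnegative and end at 0: a passage is such a walk together with one step up
    of weight 1 / 2, which is [ZX_null]. *)
Definition nullS : S := kS 2 * step_gf passS.

Lemma kSM a b : kS (a * b) = kS a * kS b.
Proof. by rewrite /kS !rmorphM. Qed.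

Lemma kS1 : kS 1 = 1. Proof. by rewrite /kS !rmorph1. Qed.

Lemma two_neq0 : (2 : C) != 0. Proof. by rewrite pnatr_eq0. Qed.

Lemma kS2V : kS 2 * kS 2^-1 = 1.
Proof. by rewrite -kSM divff ?two_neq0 // kS1. Qed.

Lemma nullSE n : nullS n = 2%:P * step_gf passS n.
Proof. by rewrite /nullS kSE. Qed.

Lemma ZX_null : ZX * nullS = kS 2 * passS.
Proof. by rewrite [in RHS]passE /nullS mulrCA. Qed.

(* The walks that stay nonnegative and end at height h. *)
Definition stayS (h : nat) : S := nullS * passS ^+ h.

Definition stay_step (h : nat) : S :=
  (if h is h'.+1 then kS 2^-1 * stayS h' else 0)
  + kS ((1 - p) / 2) * stayS h.+1
  + kS (p / 2) * (fps_comp excP passS * stayS h).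

Lemma stayE h : stayS h = (if h == 0%N then 1 else 0) + ZX * stay_step h.
Proof.
have nullE : nullS = 1 + ZX * (nullS * (kS ((1 - p) / 2) * passS +
    kS (p / 2) * fps_comp excP passS)).
  rewrite mulrA ZX_null /nullS {1}/step_gf !mulrDr kS2V -!addrA; congr (_ + _).
  by ring.
case: h => [|h] /=.
  rewrite /stay_step /stayS expr0 mulr1 add0r {1}nullE expr1; congr (_ + _).
  by ring.
rewrite /stay_step /stayS !exprS add0r.
transitivity (ZX * step_gf passS * (nullS * passS ^+ h)).
  by rewrite -passE; ring.
by rewrite /step_gf; ring.
Qed.

Lemma stay_at0 h : stayS h 0%N = ((h == 0%N)%:R)%:P.
Proof. by rewrite stayE fpsDE ZX0 addr0; case: h. Qed.

Lemma stay_atS h n : stayS h n.+1 = 'X * stay_step h n.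
Proof.
rewrite {1}stayE fpsDE ZXS; case: h => [|h] /=; last by rewrite fps0E add0r.
by rewrite fps1E add0r.
Qed.

Lemma pair_kS a f g : pair (kS a * f) g = fpsC a * pair f g.
Proof.
have -> : kS a = fps_polyC (fpsC a).
  by apply: funext => n; rewrite /kS /fps_map /fpsC; case: ifP.
by rewrite pairC pairZr pairC.
Qed.

Lemma pair_excl (f g : S) n :
  pair (fps_comp excP passS * f) g n =
  \sum_(m < n.+1) \sum_(l < n) D0 l m / 2 * pair (passS ^+ m * f) g (n - l.+1)%N.
Proof.
have -> : pair (fps_comp excP passS * f) g n =
    pair (\sum_(m < n.+1) excP m * (passS ^+ m * f)) g n.
  rewrite /pair; apply: eq_bigr => i _; congr (Kp _ _).
  rewrite fps_comp_mulE ?pass0 // fps_sumE.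
  rewrite (big_ord_widen n.+1 (fun m => (excP m * (passS ^+ m * f)) i)) //.
  rewrite big_mkcond /=; apply: eq_bigr => m _; case: ifPn => //.
  rewrite -leqNgt => im; apply/esym; rewrite mulrCA mulrC.
  by apply: (@fps_mul_val _ _ _ m) => // j jm; rewrite fps_exp_val ?pass0.
rewrite pairC pair_sumr fps_sumE; apply: eq_bigr => m _.
rewrite /excP (pairZr (excS m)) pairC fpsME big_ord_recl /= mul0r add0r.
by apply: eq_bigr => l _.
Qed.

Lemma pair_stay0 h k : pair (stayS h) (stayS k) 0%N = (h == 0%N)%:R * (k == 0%N)%:R.
Proof. by rewrite (pair_rec0 (stay_at0 h) (stay_at0 k)). Qed.

Definition pair_step (A : nat -> nat -> nat -> C) n h k : C :=
  (if h is h'.+1 then A n h' k else 0) / 2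
  + (1 - p) / 2 * A n h.+1 k
  + p / 4 * \sum_(m < n.+1) \sum_(l < n) D0 l m * A (n - l.+1)%N (h + m)%N k.

Lemma pair_stay_step n h k : pair (stay_step h) (stayS k) n =
  pair_step (fun n h k => pair (stayS h) (stayS k) n) n h k.
Proof.
rewrite /stay_step /pair_step !pairDl !fpsDE !pair_kS !fpsC_mulE.
congr (_ + _ + _).
  case: h => [|h]; first by rewrite pairC pair0 mul0r.
  by rewrite pair_kS fpsC_mulE mulrC.
rewrite pair_excl !mulr_sumr; apply: eq_bigr => m _; rewrite !mulr_sumr.
apply: eq_bigr => l _; rewrite /stayS exprD [_ ^+ h * _]mulrC.
by rewrite [_ ^+ m * (_ * _)]mulrCA; field.
Qed.

Lemma pair_stayS n h k : pair (stayS h) (stayS k) n.+1 =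
  (pair_step (fun n h k => pair (stayS h) (stayS k) n) n h k
   + pair_step (fun n k h => pair (stayS h) (stayS k) n) n k h) / 2.
Proof.
rewrite (pair_recS n (stay_at0 h) (stay_at0 k) (stay_atS h) (stay_atS k)).
rewrite pair_stay_step [pair (stayS h) (stay_step k)]pairC pair_stay_step.
congr ((_ + _) / _); rewrite /pair_step; congr (_ / _ + _ * _ + _ * _).
- by case: k => // k; rewrite pairC.
- by rewrite pairC.
- by apply: eq_bigr => m _; apply: eq_bigr => l _; rewrite pairC.
Qed.

(** The recursion determines its solution, so the weights of words need only be shown to satisfy
    it. *)
Lemma stay_pairP (A : nat -> nat -> nat -> C) :
  (forall h k, A 0%N h k = (h == 0%N)%:R * (k == 0%N)%:R) ->
  (forall n h k, A n.+1 h k =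
    (pair_step A n h k + pair_step (fun n k h => A n h k) n k h) / 2) ->
  forall n h k, A n h k = pair (stayS h) (stayS k) n.
Proof.
move=> A0 AS n; elim/ltn_ind: n => -[|n] IH h k.
  by rewrite A0 pair_stay0.
rewrite AS pair_stayS; congr ((_ + _) / _); rewrite /pair_step;
  congr (_ / _ + _ * _ + _ * _).
- by case: h => // h; rewrite IH.
- by rewrite IH.
- apply: eq_bigr => m _; apply: eq_bigr => l _; rewrite IH //.
  by rewrite ltnS leq_subr.
- by case: k => // k; rewrite IH.
- by rewrite IH.
- apply: eq_bigr => m _; apply: eq_bigr => l _; rewrite IH //.
  by rewrite ltnS leq_subr.
Qed.

End Renewal.

(** * The kernel method *)

Section Kernel.
Variables (C : numFieldType) (p : C) (D : nat -> nat -> nat -> C).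
Local Notation S := (fps {poly C}).
Local Notation D0 := (fun l m => D l 0%N m).
Local Notation passS := (passS p D0).
Local Notation nullS := (nullS p D0).
Local Notation step_gf := (step_gf p D0).
Local Notation excP := (excP D0).
Local Notation excS := (excS D0).
Local Notation ZX := (ZX C).

Definition back_step (d : nat -> S) (i : nat) : S :=
  (if i is i'.+1 then kS ((1 - p) / 2) * d i' else 0) + kS 2^-1 * d i.+1
  + kS (p / 2) * \sum_(m < i.+1) excP m * d (i - m)%N.

(* The same walk, read from its first step, with the orders left unconsumed as
   its height: the solution of a recursion running in the opposite direction. *)
Definition backS : nat -> S :=
  fps_fix (fun d i => (if i == 0%N then 1 else 0) + ZX * back_step d i).

Lemma backE i : backS i = (if i == 0%N then 1 else 0) + ZX * back_step backS i.
Proof.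
apply/esym/(@fps_fixP _ _ (fun d i => (if i == 0%N then 1 else 0) +
  ZX * back_step d i)) => k f g e {}i.
apply: eqmD; first exact: eqm_refl.
apply: ZX_eqm; apply: eqmD; [apply: eqmD|].
- by case: i => [|i]; [exact: eqm_refl|apply: eqmM; [exact: eqm_refl|exact: e]].
- by apply: eqmM; [exact: eqm_refl|exact: e].
- apply: eqmM; [exact: eqm_refl|]; apply: eqm_sum => m.
  by apply: eqmM; [exact: eqm_refl|exact: e].
Qed.

Lemma back_at0 i : backS i 0%N = ((i == 0%N)%:R)%:P.
Proof. by rewrite backE fpsDE ZX0 addr0; case: i. Qed.

Lemma back_atS i n : backS i n.+1 = 'X * back_step backS i n.
Proof.
rewrite {1}backE fpsDE ZXS; case: i => [|i] /=; last by rewrite fps0E add0r.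
by rewrite fps1E add0r.
Qed.

Definition back_pair_step (A : nat -> nat -> nat -> C) n i j : C :=
  (1 - p) / 2 * (if i is i'.+1 then A n i' j else 0)
  + A n i.+1 j / 2
  + p / 4 * \sum_(m < i.+1) \sum_(l < n) D l 0%N m * A (n - l.+1)%N (i - m)%N j.

Lemma pair_back_step n i j : pair (back_step backS i) (backS j) n =
  back_pair_step (fun n i j => pair (backS i) (backS j) n) n i j.
Proof.
rewrite /back_step /back_pair_step !pairDl !fpsDE !pair_kS !fpsC_mulE.
congr (_ + _ + _).
- case: i => [|i]; first by rewrite pairC pair0 mulr0.
  by rewrite pair_kS fpsC_mulE.
- by rewrite mulrC.
rewrite pairC pair_sumr fps_sumE !mulr_sumr; apply: eq_bigr => m _.
rewrite pairZr fpsME big_ord_recl /= mul0r add0r !mulr_sumr.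
by apply: eq_bigr => l _; rewrite /bump /= add1n pairC; field.
Qed.

Hypothesis DP0 : forall i j, D 0%N i j = (i == 0%N)%:R * (j == 0%N)%:R.
Hypothesis DPS : forall n i j, D n.+1 i j =
  (back_pair_step D n i j + back_pair_step (fun n j i => D n i j) n j i) / 2.

(** Since [excP] is built from [D] itself, the weights [D l 0 m] agree in both recursions, and only
    the other factor calls for the induction hypothesis. *)
Lemma back_pairP n i j : D n i j = pair (backS i) (backS j) n.
Proof.
elim/ltn_ind: n i j => -[|n] IH i j.
  by rewrite DP0 (pair_rec0 (back_at0 i) (back_at0 j)).
rewrite DPS (pair_recS n (back_at0 i) (back_at0 j) (back_atS i) (back_atS j)).
rewrite pair_back_step [pair _ (back_step _ j)]pairC pair_back_step.
congr ((_ + _) / _); rewrite /back_pair_step; congr (_ * _ + _ / _ + _ * _).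
- by case: i => // i; rewrite IH.
- by rewrite IH.
- apply: eq_bigr => m _; apply: eq_bigr => l _; rewrite -IH //.
  by rewrite ltnS leq_subr.
- by case: j => // j; rewrite IH // pairC.
- by rewrite IH // pairC.
- apply: eq_bigr => m _; apply: eq_bigr => l _; rewrite pairC -IH //.
  by rewrite ltnS leq_subr.
Qed.

(* The family [backS], read as a power series in a new variable Y, satisfies the
   kernel equation
   Y d = Y + ZX ((d - d_0) / 2 + (1 - p) / 2 Y^2 d + p / 2 Y excP d),
   in which an element of positive valuation is then substituted for Y. *)
Lemma back_kernel (y : S) : y 0%N = 0 ->
  y * fps_comp backS y =
  y + ZX * step_gf y * fps_comp backS y - ZX * kS 2^-1 * backS 0%N.
Proof.
move=> y0; pose Y : fps S := @fpsX _; pose k (a : S) : fps S := fpsC a.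
have E : Y * (backS : fps S) = Y + k ZX * (k (kS 2^-1) * (backS - k (backS 0%N))
   + k (kS ((1 - p) / 2)) * (Y * (Y * backS)) + k (kS (p / 2)) * (Y * (excP * backS))).
  apply: funext => -[|i].
    rewrite fpsDE !fpsC_mulE !fpsDE !fpsC_mulE !fpsXM0 fpsBE /k /fpsC /=.
    by rewrite subrr !mulr0 !addr0 mulr0 /Y /fpsX /= addr0.
  rewrite fpsDE !fpsC_mulE !fpsDE !fpsC_mulE !fpsXMS fpsBE /k /fpsC /= subr0.
  rewrite {1}backE /back_step; congr (_ + _); first by case: i.
  congr (_ * _); rewrite -addrA addrCA -addrA; congr (_ + (_ + _)).
    by case: i => [|i]; rewrite ?fpsXM0 ?mulr0 // fpsXMS.
have /= := congr1 (fun f : fps S => fps_comp f y) E.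
rewrite /Y /k !(fps_compD, fps_compN, fps_compM, fps_comp_C, fps_comp_X) //.
by move=> ->; rewrite /step_gf; ring.
Qed.

(** At [y = passS] the kernel vanishes by [passE], and what is left of [back_kernel] gives the
    boundary term. *)
Lemma back0_null : backS 0%N = nullS.
Proof.
apply: ZXI; rewrite ZX_null.
have := back_kernel (pass0 p D0); rewrite -(passE p D0) => E.
have e : passS = ZX * kS 2^-1 * backS 0%N.
  apply/eqP; rewrite -subr_eq0; apply/eqP.
  by apply: (addIr (passS * fps_comp backS passS)); rewrite add0r [RHS]E; ring.
rewrite [in RHS]e -[LHS]mul1r -(kS2V C); ring.
Qed.

(** This closes the system: the law of the flexible steps is a pairing of the two walks that it
    drives. *)
Lemma excS_pair m : excS m = @fpsC C 2^-1 * (@fpsX _ * pair nullS (backS m)).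
Proof.
apply: funext => -[|n]; rewrite fpsC_mulE ?fpsXM0 ?mulr0 // fpsXMS /=.
by rewrite -back0_null -back_pairP mulrC.
Qed.

Section Evaluation.
Variable z : C.

Local Notation evS := (fps_map (horner_eval z)).

Lemma evSE f n : evS f n = (f n).[z]. Proof. by []. Qed.

Lemma ev_pass0 : evS passS 0%N = 0.
Proof. by rewrite evSE pass0 horner0. Qed.

(** The one term of [step_gf] that is not explicit in [passS], with the step variable set to z. *)
Definition exc_pass : fps C := evS (passS * fps_comp excP passS).

Lemma ev_polyC (s : fps C) : evS (fps_polyC s) = s.
Proof. by apply: funext => n; rewrite evSE /fps_map hornerC. Qed.

Lemma comp_excP_polyC (s : fps C) :
  fps_comp excP (fps_polyC s) = fps_polyC (fps_comp (excS : fps (fps C)) s).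
Proof. by rewrite (fps_comp_map polyC). Qed.

Lemma ev_comp_exc :
  evS (fps_comp excP passS) = fps_comp (excS : fps (fps C)) (evS passS).
Proof.
apply: (etrans (fps_comp_map (horner_eval z) _ _)).
by congr (fps_comp _ _); apply: funext => m; exact: ev_polyC.
Qed.

Lemma exc_passE : exc_pass = evS passS * fps_comp (excS : fps (fps C)) (evS passS).
Proof. by rewrite /exc_pass rmorphM -ev_comp_exc. Qed.

Let s : fps C := evS passS.
Let y : S := fps_polyC s.

Lemma y_at0 : y 0%N = 0.
Proof. by rewrite -[LHS]/((s 0%N)%:P) /s ev_pass0. Qed.

Lemma kS_polyC (a : C) : kS a = fps_polyC (fpsC a).
Proof. by apply: funext => n; rewrite /kS /fps_map /fpsC; case: ifP. Qed.

Lemma step_y : step_gf y = fps_polyC (evS (step_gf passS)).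
Proof.
rewrite /step_gf comp_excP_polyC !rmorphD expr2 !rmorphM /=.
by rewrite ev_comp_exc !kS_polyC !ev_polyC.
Qed.
(** In y the step variable is frozen at z, while it stays free in the walk. As y solves the equation
    of [passS] at z, [ZX * step_gf y] is y times 'X / z, and the kernel becomes 1 - 'X / z instead
    of 0. *)
Lemma pass_telescope :
  (kS z - fpsC 'X) * (y * fps_comp backS y) = kS z * (y - passS).
Proof.
have zE : kS z * ZX * step_gf y = fpsC 'X * y.
  rewrite /ZX step_y /y /s [in RHS](passE p D0).
  have -> : evS (ZX * step_gf passS) = fpsC z * @fpsX _ * evS (step_gf passS).
    rewrite rmorphM; congr (_ * _); apply: funext => n.
    rewrite -[LHS]/((ZX n).[z]) /ZX !fpsC_mulE /fpsX hornerM hornerX.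
    by case: eqP => _; rewrite /= !hornerE.
  rewrite !rmorphM /= -kS_polyC.
  have -> : fps_polyC (@fpsX C) = @fpsX {poly C}.
    by apply: funext => n; rewrite /fps_map /fpsX; case: eqP.
  by ring.
have E := back_kernel y_at0; rewrite back0_null in E.
have e : kS z * (ZX * kS 2^-1 * nullS) = kS z * passS.
  by rewrite -[passS in RHS]mul1r -(kS2V C) mulrAC ZX_null; ring.
transitivity (kS z * y + kS z * ZX * step_gf y * fps_comp backS y
  - kS z * (ZX * kS 2^-1 * nullS) - fpsC 'X * (y * fps_comp backS y)).
  by rewrite mulrBl {1}E; ring.
by rewrite e zE; ring.
Qed.

Lemma pass_telescope_coef n : (y * fps_comp backS y) n =
  \sum_(a < size (passS n)) \sum_(b < a) ((passS n)`_a * z ^+ (a - b))%:P * 'X^b.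
Proof.
have zX : z%:P - 'X != 0 :> {poly C}.
  by rewrite -opprB oppr_eq0 polyXsubC_eq0.
apply: (mulfI zX).
have -> : (z%:P - 'X) * (y * fps_comp backS y) n =
    z%:P * (((passS n).[z])%:P - passS n).
  have := congr1 (fun f : S => f n) pass_telescope.
  by rewrite mulrBl fpsBE !fpsC_mulE fpsBE mulrBl => ->.
have cE : passS n = \sum_(a < size (passS n)) (passS n)`_a *: 'X^a.
  by rewrite -poly_def coefK.
rewrite {2}cE horner_coef rmorph_sum -sumrB !mulr_sumr.
apply: eq_bigr => a _ /=.
transitivity (((passS n)`_a)%:P * z%:P * (z%:P ^+ a - 'X^a)).
  by rewrite -mul_polyC !rmorphM rmorphXn /=; ring.
rewrite subrXX !mulr_sumr; apply: eq_bigr => b _.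
rewrite rmorphM rmorphXn /=.
have -> : (a - b)%N = (a.-1 - b).+1 by move: (ltn_ord b); lia.
rewrite exprS -subn1; ring.
Qed.

Lemma exc_pass_pair :
  exc_pass = @fpsC C 2^-1 * (@fpsX _ * pair nullS (y * fps_comp backS y)).
Proof.
rewrite exc_passE -/s mulrC; apply: funext => n.
rewrite fps_comp_mulE ?ev_pass0 //.
have -> : (@fpsC C 2^-1 * (@fpsX _ * pair nullS (y * fps_comp backS y))) n =
    (@fpsC C 2^-1 * (@fpsX _ * pair nullS
      (\sum_(m < n.+1) fps_polyC (s ^+ m * s) * backS m))) n.
  rewrite !fpsC_mulE; congr (_ * _); case: n => [|n]; first by rewrite !fpsXM0.
  rewrite !fpsXMS /pair; apply: eq_bigr => i _; congr (Kp _ _).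
  rewrite mulrC fps_comp_mulE ?y_at0 // fps_sumE.
  rewrite (big_ord_widen n.+2 (fun m => (backS m * (y ^+ m * y)) (n - i)%N)).
    rewrite big_mkcond /=; apply: eq_bigr => m _.
    have -> : fps_polyC (s ^+ m * s) = y ^+ m * y by rewrite rmorphM rmorphXn.
    case: ifPn => [_|]; first by rewrite mulrC.
    rewrite -leqNgt => nm; apply/esym; rewrite mulrC -exprSr.
    apply: (@fps_mul_val _ _ _ m.+1) => // [j jm|].
      by rewrite fps_exp_val // y_at0.
    by rewrite ltnS ltnW.
  by rewrite ltnS (leq_trans (leq_subr _ _)).
rewrite pair_sumr !mulr_sumr fps_sumE; apply: eq_bigr => m _.
rewrite pairZr excS_pair; congr (_ n).
  by rewrite -!mulrA [pair _ _ * _]mulrC -!mulrA.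
exact: ev_pass0.
Qed.

Lemma exc_pass0 : exc_pass 0%N = 0.
Proof. by rewrite exc_pass_pair fpsC_mulE fpsXM0 mulr0. Qed.

(* Twice the mean of z^m over the event that, of two players tossing the same
   fair coin, the first one gets the a points needed while the second one still
   lacks m of the a' needed. *)
Definition race (a a' : nat) : C :=
  if a is a1.+1 then \sum_(b < a') binK C a1 b * z ^+ (a' - b) else 0.

Definition race_form (q r : {poly C}) : C :=
  \sum_(a < size q) \sum_(a' < size r) q`_a * r`_a' * race a a'.

Lemma race_form_wide (q r : {poly C}) m n : (size q <= m)%N -> (size r <= n)%N ->
  race_form q r = \sum_(a < m) \sum_(a' < n) q`_a * r`_a' * race a a'.
Proof.
move=> qm rn; rewrite /race_form.
rewrite (big_ord_widen m (fun a => \sum_(a' < size r) q`_a * r`_a' * race a a')) //.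
rewrite big_mkcond; apply: eq_bigr => a _ /=; case: ifPn => [_|].
  rewrite (big_ord_widen n (fun a' => q`_a * r`_a' * race a a')) // big_mkcond.
  apply: eq_bigr => b _ /=; case: ifPn => //; rewrite -leqNgt => qb.
  by rewrite (nth_default _ qb) mulr0 mul0r.
rewrite -leqNgt => pa; rewrite big1 // => b _.
by rewrite (nth_default _ pa) !mul0r.
Qed.

Lemma race_formX (g r : {poly C}) : race_form ('X * g) r =
  Kp g (\sum_(a < size r) \sum_(b < a) (r`_a * z ^+ (a - b))%:P * 'X^b).
Proof.
rewrite (@race_form_wide _ _ (size g).+1 (size r)) ?size_XM_le // big_ord_recl.
rewrite big1 ?add0r => [|a _]; last by rewrite coefXM /= !mul0r.
rewrite exchange_big raddf_sum; apply: eq_bigr => a' _ /=.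
rewrite raddf_sum /=.
under [RHS]eq_bigr => b _ do rewrite KpCr KpXn mulr_sumr.
rewrite exchange_big; apply: eq_bigr => a _ /=.
rewrite coefXM /= mulr_sumr; apply: eq_bigr => b _; ring.
Qed.

(** The factor [nullS] is, up to a constant, [passS] short of one step; this is why [race] starts
    its kernel at [a.-1]. *)
Lemma exc_pass_race n : exc_pass n =
  \sum_(i < n.+1) race_form (passS i) (passS (n - i)%N).
Proof.
have r0 (r : {poly C}) : race_form 0 r = 0 by rewrite /race_form size_poly0 big_ord0.
case: n => [|n]; first by rewrite exc_pass0 big_ord1 /= pass0 r0.
rewrite exc_pass_pair fpsC_mulE fpsXMS big_ord_recl /= pass0 r0 add0r mulr_sumr.
apply: eq_bigr => i _.
rewrite /bump /= add1n subSS pass_telescope_coef passSE race_formX.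
rewrite nullSE KpCl mulrA mulVf ?mul1r // pnatr_eq0.
Qed.

End Evaluation.

Lemma race0 z a : race z a 0 = 0.
Proof. by case: a => //= a; rewrite big_ord0. Qed.

(** Condition on the first toss; a first player in need of a single point may win at once, the other
    one still lacking all b + 1. *)
Lemma raceSS z a b : race z a.+1 b.+1 =
  ((if a is 0%N then 2 * z ^+ b.+1 else race z a b.+1) + race z a.+1 b) / 2.
Proof.
rewrite /= big_ord_recl subn0.
have -> : \sum_(i < b) binK C a (bump 0 i) * z ^+ (b.+1 - bump 0 i) =
    \sum_(i < b) binK C a i.+1 * z ^+ (b - i).
  by apply: eq_bigr => i _; rewrite /bump /= add1n subSS.
case: a => [|a] /=.
  rewrite binK0n expr0 mul1r mulrDl mulrAC divff ?mul1r ?pnatr_eq0 //.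
  congr (_ + _); rewrite mulr_suml; apply: eq_bigr => i _.
  by rewrite !binK0n exprS; field.
rewrite big_ord_recl subn0 -addrA mulrDl; congr (_ + _).
  rewrite binKC binK0n binKC binK0n exprS; ring.
have -> : \sum_(i < b) binK C a (bump 0 i) * z ^+ (b.+1 - bump 0 i) =
    \sum_(i < b) binK C a i.+1 * z ^+ (b - i).
  by apply: eq_bigr => i _; rewrite /bump /= add1n subSS.
rewrite -big_split /= mulr_suml; apply: eq_bigr => i _.
by rewrite binKSS; ring.
Qed.

(* Exactly one of the two players wins the race. *)
Lemma race_sym z z' a b : z + z' = 2 * z * z' ->
  race z a.+1 b.+1 + race z' b.+1 a.+1 = 2 * z ^+ b.+1 * z' ^+ a.+1.
Proof.
(* For nonzero z, [zz] says that 1 / z and 1 / z' have mean 1. Hence z^j z'^i is a martingale, where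
   i and j are the points that the two players still lack, and the sum is twice its initial
   value. *)
move=> zz; elim: a b => [|a IHa] b; elim: b => [|b IHb].
- rewrite !raceSS !race0 !expr1; transitivity (z + z'); first by field.
  by rewrite zz.
- rewrite raceSS [race z' _ _]raceSS race0.
  transitivity (z ^+ b.+2 + (race z 1 b.+1 + race z' b.+1 1) / 2); first by field.
  rewrite IHb !expr1 [in RHS]exprS; transitivity (z ^+ b.+1 * (z + z')).
    by rewrite [z ^+ b.+2]exprS; field.
  by rewrite zz; ring.
- rewrite raceSS [race z' _ _]raceSS race0.
  transitivity (z' ^+ a.+2 + (race z a.+1 1 + race z' 1 a.+1) / 2); first by field.
  rewrite IHa !expr1 [in RHS]exprS; transitivity (z' ^+ a.+1 * (z + z')).
    by rewrite [z' ^+ a.+2]exprS; field.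
  by rewrite zz; ring.
rewrite raceSS [race z' _ _]raceSS.
transitivity ((race z a.+1 b.+2 + race z' b.+2 a.+1) / 2
  + (race z a.+2 b.+1 + race z' b.+1 a.+2) / 2); first by field.
rewrite IHa IHb; transitivity (z ^+ b.+1 * z' ^+ a.+1 * (z + z')).
  by rewrite [z ^+ b.+2]exprS [z' ^+ a.+2]exprS; field.
by rewrite zz [z ^+ b.+2]exprS [z' ^+ a.+2]exprS; ring.
Qed.

Lemma race_form_sym z z' (q r : {poly C}) : z + z' = 2 * z * z' ->
  q`_0 = 0 -> r`_0 = 0 ->
  race_form z q r + race_form z' r q = 2 * r.[z] * q.[z'].
Proof.
move=> zz q0 r0; rewrite /race_form [X in _ + X]exchange_big -big_split /=.
rewrite !horner_coef [RHS]mulrC mulr_suml; apply: eq_bigr => a _.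
rewrite -big_split !mulr_sumr; apply: eq_bigr => b _ /=.
case: a => -[|a] /= alt; first by rewrite q0 !(mul0r, mulr0) addr0.
case: b => -[|b] /= blt; first by rewrite r0 !(mul0r, mulr0) addr0.
transitivity (q`_a.+1 * r`_b.+1 * (race z a.+1 b.+1 + race z' b.+1 a.+1)).
  by rewrite /race; ring.
by rewrite race_sym //; ring.
Qed.

(** The flexible terms at z and z' are race forms with exchanged arguments, and [race_form_sym] adds
    them up to a product; no excursion series is left. *)
Lemma step_sum z z' n : z + z' = 2 * z * z' ->
  (step_gf passS n).[z] + (step_gf passS n).[z'] = (n == 0%N)%:R
  + (1 - p) / 2 * \sum_(i < n.+1) ((passS i).[z] * (passS (n - i)%N).[z]
                                   + (passS i).[z'] * (passS (n - i)%N).[z'])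
  + p * \sum_(i < n.+1) (passS i).[z'] * (passS (n - i)%N).[z].
Proof.
move=> zz.
have pass00 i : (passS i)`_0 = 0.
  by case: i => [|i]; rewrite ?pass0 ?coef0 // passSE coefXM.
have E w : (step_gf passS n).[w] = (n == 0%N)%:R / 2
    + (1 - p) / 2 * \sum_(i < n.+1) (passS i).[w] * (passS (n - i)%N).[w]
    + p / 2 * \sum_(i < n.+1) race_form w (passS i) (passS (n - i)%N).
  rewrite -exc_pass_race /exc_pass /step_gf !fpsDE !kSE !hornerD !hornerM !hornerC.
  congr (_ + _ * _ + _); last first.
  - by rewrite expr2 fpsME horner_sum; apply: eq_bigr => i _; rewrite hornerM.
  - by rewrite /kS /fpsC; case: eqP => _; rewrite ?hornerC ?horner0 ?mul1r ?mul0r.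
rewrite !E.
have -> : \sum_(i < n.+1) race_form z' (passS i) (passS (n - i)%N) =
    \sum_(i < n.+1) race_form z' (passS (n - i)%N) (passS i).
  rewrite (reindex_inj rev_ord_inj) /=; apply: eq_bigr => i _.
  by rewrite subSS subKn // -ltnS.
transitivity ((n == 0%N)%:R
  + (1 - p) / 2 * (\sum_(i < n.+1) (passS i).[z] * (passS (n - i)%N).[z] +
      \sum_(i < n.+1) (passS i).[z'] * (passS (n - i)%N).[z'])
  + p / 2 * (\sum_(i < n.+1) race_form z (passS i) (passS (n - i)%N) +
     \sum_(i < n.+1) race_form z' (passS (n - i)%N) (passS i))); first by field.
rewrite -!big_split /=; congr (_ + _); rewrite !mulr_sumr; apply: eq_bigr => i _.
by rewrite race_form_sym //; field.
Qed.

End Kernel.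

(** * Reduced words *)

Lemma Theta_congr_cat x y v : Theta_congr x y -> Theta_congr (x ++ v) (y ++ v).
Proof.
elim=> [u l r w lr|{}x|{}x {}y _|{}x {}y z _ xy _ yz].
- by rewrite -!catA; exact: congr_rel.
- exact: congr_refl.
- exact: congr_sym.
- exact: congr_trans xy yz.
Qed.

Lemma reduce_cat x y : reduce (x ++ y) = foldr reduce_cons (reduce y) x.
Proof. by rewrite /reduce foldr_cat. Qed.

Lemma reduce_catl x y : reduce (x ++ y) = reduce (reduce x ++ y).
Proof. by apply: reduce_eq; apply: Theta_congr_cat; apply: reduce_congr. Qed.

Lemma reduceK x : reduce (reduce x) = reduce x.
Proof. exact/reduce_id/reduce_reduced. Qed.

Lemma reduce_catr x y : reduce (x ++ y) = reduce (x ++ reduce y).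
Proof. by rewrite !reduce_cat reduceK. Qed.

Lemma reduce_orders_cat o y : all is_order o -> reduce (o ++ y) = o ++ reduce y.
Proof.
by elim: o => //= t o IH /andP[tO oO]; rewrite /= IH // /reduce_cons tO.
Qed.

Definition is_stack (h c : nat) (r : seq Theta) : bool :=
  [&& all is_burger r, count_mem B_H r == h & count_mem B_C r == c].

Definition is_debt (i j : nat) (r : seq Theta) : bool :=
  [&& all (fun t => (t == O_H) || (t == O_C)) r, count_mem O_H r == i
    & count_mem O_C r == j].

Definition swap_letter (t : Theta) : Theta :=
  match t with B_H => B_C | B_C => B_H | O_H => O_C | O_C => O_H | O_F => O_F end.

Lemma burger_cons_swap b r : is_burger b ->
  burger_cons (swap_letter b) (map swap_letter r) = map swap_letter (burger_cons b r).
Proof.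
move=> bB; elim: r => [|t r IH]; first by case: b bB.
by case: b bB IH => // _ /= IH; case: t => //=; rewrite IH.
Qed.

Lemma reduce_swap x : reduce (map swap_letter x) = map swap_letter (reduce x).
Proof.
elim: x => //= t x ->; rewrite /reduce_cons.
have -> : is_order (swap_letter t) = is_order t by case: t.
by case: ifPn => // tB; rewrite burger_cons_swap.
Qed.

Lemma is_debt_swap i j r : is_debt i j (map swap_letter r) = is_debt j i r.
Proof.
rewrite /is_debt all_map !count_map andbA [LHS]andbAC -andbA.
congr [&& _, _ & _]; first by apply: eq_all => -[].
- by congr (_ == _); apply: eq_count => -[].
- by congr (_ == _); apply: eq_count => -[].
Qed.

Lemma is_stack_swap i j r : is_stack i j (map swap_letter r) = is_stack j i r.
Proof.
rewrite /is_stack all_map !count_map andbA [LHS]andbAC -andbA.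
congr [&& _, _ & _]; first by apply: eq_all => -[].
- by congr (_ == _); apply: eq_count => -[].
- by congr (_ == _); apply: eq_count => -[].
Qed.

Lemma burger_cons_burgers b s : is_burger b -> all is_burger s ->
  burger_cons b s = b :: s.
Proof. by case: b => // _; case: s => [|[] s]. Qed.

Lemma reduce_burgers s : all is_burger s -> reduce s = s.
Proof. by move=> sB; apply: reduce_id; exists [::], s. Qed.

Lemma reduce_stack_OC s : all is_burger s ->
  if B_C \in s
  then [/\ all is_burger (reduce (rcons s O_C)),
     count_mem B_H (reduce (rcons s O_C)) = count_mem B_H s &
     (count_mem B_C (reduce (rcons s O_C))).+1 = count_mem B_C s]
  else reduce (rcons s O_C) = O_C :: s.
Proof.
elim: s => [|b s IH] //= /andP[bB sB]; have {IH} := IH sB.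
rewrite in_cons /= /reduce_cons; case: (B_C \in s).
  move=> [rB rH rC]; rewrite orbT (negbTE bB) burger_cons_burgers //=.
  by rewrite rB rH -rC bB; split => //; rewrite addnS.
move=> ->; rewrite orbF; case: b bB => //= _.
by case: s sB => [|[] s].
Qed.

Lemma reduce_stack_OF s b : all is_burger s -> is_burger b ->
  reduce (rcons (rcons s b) O_F) = s.
Proof.
move=> sB bB; rewrite -!cats1 -catA /= reduce_catr.
have -> : reduce [:: b; O_F] = [::] by case: b bB.
by rewrite cats0 reduce_burgers.
Qed.

(** Orders at the left end of a reduced word survive whatever is added on the right. *)
Lemma stack_rcons x t h c : is_stack h c (reduce (rcons x t)) ->
  all is_burger (reduce x).
Proof.
have [ o [b [rE oO bB]]] := reduce_reduced x.
rewrite -cats1 reduce_catl rE -catA reduce_orders_cat // => /andP[].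
by rewrite !all_cat bB; case: o oO rE => //= u o /andP[]; rewrite /is_burger => ->.
Qed.

Lemma reduce_rcons x t : reduce (rcons x t) = reduce (rcons (reduce x) t).
Proof. by rewrite -!cats1 -reduce_catl. Qed.

Lemma stack_BH x h c :
  is_stack h c (reduce (rcons x B_H)) = (0 < h)%N && is_stack h.-1 c (reduce x).
Proof.
have [xB|/negP xB] := boolP (all is_burger (reduce x)); last first.
  rewrite [RHS](_ : _ = false); first by apply/negP => /stack_rcons.
  by apply/negP => /andP[_ /andP[]].
rewrite reduce_rcons reduce_burgers ?all_rcons ?xB // /is_stack all_rcons xB /=.
rewrite -cats1 !count_cat /= !addn0 addn1.
by case: h => [|h] //=; rewrite ?andbF // eqSS.
Qed.

Lemma stack_BC x h c :
  is_stack h c (reduce (rcons x B_C)) = (0 < c)%N && is_stack h c.-1 (reduce x).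
Proof.
have := stack_BH (map swap_letter x) c h.
rewrite -[B_H]/(swap_letter B_C) -map_rcons !reduce_swap !is_stack_swap; exact.
Qed.

Lemma stack_OC x h c :
  is_stack h c (reduce (rcons x O_C)) = is_stack h c.+1 (reduce x).
Proof.
have [xB|/negP xB] := boolP (all is_burger (reduce x)); last first.
  rewrite [RHS](_ : _ = false); first by apply/negP => /stack_rcons.
  by apply/negP => /andP[].
rewrite reduce_rcons; have := reduce_stack_OC xB.
have [xC|xC] := boolP (B_C \in reduce x).
  by case=> rB rH rC; rewrite /is_stack rB rH -rC eqSS xB.
move=> ->; rewrite /is_stack /= xB (count_memPn xC) /=.
by rewrite andbF.
Qed.

Lemma stack_OH x h c :
  is_stack h c (reduce (rcons x O_H)) = is_stack h.+1 c (reduce x).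
Proof.
have := stack_OC (map swap_letter x) c h.
rewrite -[ O_C]/(swap_letter O_H) -map_rcons !reduce_swap !is_stack_swap; exact.
Qed.

(** The default [O_F] of [last] fails both tests on the empty word, where a flexible order would
    remain unserved. *)
Lemma stack_OF x h c :
  is_stack h c (reduce (rcons x O_F)) =
  ((last O_F (reduce x) == B_H) && is_stack h.+1 c (reduce x))
  || ((last O_F (reduce x) == B_C) && is_stack h c.+1 (reduce x)).
Proof.
have [xB|/negP xB] := boolP (all is_burger (reduce x)); last first.
  rewrite [RHS](_ : _ = false); first by apply/negP => /stack_rcons.
  by apply/negP => /orP[] /andP[_ /andP[]].
rewrite reduce_rcons; move: xB; case/lastP: (reduce x) => [//|s b].
rewrite all_rcons => /andP[bB sB]; rewrite reduce_stack_OF // last_rcons.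
rewrite /is_stack !all_rcons sB bB /= -!cats1 !count_cat /= !addn0.
by case: b bB => //= _; rewrite ?addn0 ?addn1 ?eqSS ?orbF ?andbF.
Qed.

(** The only orders that a burger can have to its right without being consumed. *)
Definition opp_order (t : Theta) : Theta := if t is B_H then O_C else O_H.

Lemma stack_OC_nseq x h c m :
  is_stack h c (reduce (x ++ nseq m O_C)) = is_stack h (c + m) (reduce x).
Proof.
elim: m c => [|m IH] c; first by rewrite cats0 addn0.
by rewrite -addn1 nseqD catA cats1 stack_OC IH addn1 addSnnS.
Qed.

Lemma has_burger_cons b r : is_burger b -> has is_burger r ->
  has is_burger (burger_cons b r) /\ last O_F (burger_cons b r) = last O_F r.
Proof.
have lastE (s : seq Theta) u v : has is_burger s -> last u s = last v s.
  by case: s.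
move=> bB; elim: r => //= t r IH rB.
case: b bB IH => // _ IH; case: t rB => //= rB; try by split.
- by split=> //; exact: lastE.
- have [h1 h2] := IH rB; split=> //.
  by rewrite (lastE _ _ O_F h1) h2; exact: lastE.
- have [h1 h2] := IH rB; split=> //.
  by rewrite (lastE _ _ O_F h1) h2; exact: lastE.
- by split=> //; exact: lastE.
Qed.

Lemma all_order_hasN r : all is_order r = ~~ has is_burger r.
Proof. by rewrite -all_predC; apply: eq_all => t /=; rewrite negbK. Qed.

(** A burger moves past orders of the other type only, so it reaches the right end exactly when it
    meets no other order. *)
Lemma last_burger_cons b r : is_burger b -> all is_order r ->
  (is_burger (last O_F (burger_cons b r)) = all (pred1 (opp_order b)) r)
  /\ (all (pred1 (opp_order b)) r -> last O_F (burger_cons b r) = b).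
Proof.
have lastO (s : seq Theta) u : is_order u -> all is_order s ->
    is_burger (last u s) = false.
  elim: s u => [|v s IH] u uO /=; first by rewrite /is_burger uO.
  by case/andP => vO sO; exact: IH.
move=> bB; elim: r => [_|t r IH /= /andP[tO rO]] /=; first by case: b bB.
have [IH1 IH2] := IH rO.
have lastB u : is_order u -> (is_burger (last u (burger_cons b r)) =
    all (pred1 (opp_order b)) r)
    /\ (all (pred1 (opp_order b)) r -> last u (burger_cons b r) = b).
  move=> uO; case E: (burger_cons b r) => [|v s]; last first.
    by move: IH1 IH2; rewrite E.
  by move: IH1; rewrite E /= => <-; rewrite /is_burger uO.
case: b bB {IH IH1 IH2} lastB => // _ lastB; case: t tO => //= _;
  try (by rewrite lastO //; split); exact: lastB.
Qed.

(** The top burger is a letter of x that the letters to its right neither consume nor cover.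
    Equating a sum of booleans with a boolean also records that its position is unique. *)
Lemma top_split b x : is_burger b ->
  (\sum_(l < size x) ((nth O_F x l == b)
     && all (pred1 (opp_order b)) (reduce (drop l.+1 x))))%N
  = (last O_F (reduce x) == b).
Proof.
move=> bB; elim: x => [|t x IH] /=; first by rewrite big_ord0; case: b bB.
rewrite big_ord_recl /= drop0 [X in (_ + X)%N]IH /reduce_cons.
have opp_orders r : all (pred1 (opp_order b)) r -> all is_order r.
  by apply: sub_all => u /eqP ->; case: b bB {IH}.
have [rB|] := boolP (has is_burger (reduce x)).
  have -> : all (pred1 (opp_order b)) (reduce x) = false.
    by apply/negP => /opp_orders; rewrite all_order_hasN rB.
  rewrite andbF add0n; case: ifPn => tO.
    by case: (reduce x) rB.
  by have [_ ->] := has_burger_cons tO rB.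
rewrite -all_order_hasN => rO.
have -> : (last O_F (reduce x) == b) = false.
  have : is_order (last O_F (reduce x)).
    case: (reduce x) rO => //= v s /andP[vO sO].
    by elim: s v vO sO => //= w s IHs v _ /andP[]; exact: IHs.
  by apply: contraTF => /eqP ->.
rewrite addn0; case: ifPn => tO.
  have -> : (t == b) = false by apply: contraTF tO => /eqP ->.
  rewrite /=; apply/esym/eqP; rewrite eqb0.
  have : is_order (last t (reduce x)).
    elim: (reduce x) t tO rO => //= w s IHs v _ /andP[]; exact: IHs.
  by apply: contraTN => /eqP ->.
have [E1 E2] := last_burger_cons tO rO.
have [tb|tb] := eqVneq t b.
  subst t; rewrite andTb; congr nat_of_bool; apply/idP/eqP => [/E2 //|e].
  by rewrite -E1 e.
rewrite andFb; apply/esym/eqP; rewrite eqb0; apply: contra tb => /eqP e.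
by rewrite -E2 ?e // -E1 e.
Qed.

Definition flex_split (o : seq Theta) (Q : pred (seq Theta)) (r : seq Theta) : bool :=
  [&& (size o < size r)%N, take (size o) r == o, nth B_H r (size o) == O_F
    & Q (drop (size o).+1 r)].

Lemma flex_splitP o (Q : pred (seq Theta)) r :
  reflect (exists2 s, r = o ++ O_F :: s & Q s) (flex_split o Q r).
Proof.
apply: (iffP and4P) => [[or /eqP ro /eqP rF Qr]|[s -> Qs]].
  by exists (drop (size o).+1 r) => //; rewrite -rF -drop_nth // -[X in X ++ _]ro cat_take_drop.
split; first by rewrite size_cat /= addnS ltnS leq_addr.
- by rewrite take_size_cat.
- by rewrite nth_cat ltnn subnn.
- by rewrite -cat_rcons drop_size_cat // size_rcons.
Qed.

(** A burger that leaves only orders has been consumed, hence does not see what follows. *)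
Lemma burger_cons_absorb b o o1 : is_burger b -> all is_order o1 ->
  burger_cons b o = o1 ->
  [/\ all is_order o, size o = (size o1).+1
    & forall s, burger_cons b (o ++ s) = o1 ++ s].
Proof.
move=> bB; elim: o o1 => [|t o IH] o1 o1O.
  by case: b bB => // _ e; rewrite -e in o1O.
case: b bB IH => // _ IH; case: t => /= e; try by rewrite -e in o1O.
all: try by rewrite -e in o1O *; split.
all: move: o1O; rewrite -e /= => o1O; have [h1 h2 h3] := IH _ o1O erefl.
all: by split=> [||s]; rewrite ?h2 ?h3.
Qed.

Lemma burger_cons_flex b r o1 s : is_burger b -> all is_order o1 ->
  burger_cons b r = o1 ++ O_F :: s ->
  exists2 o, r = o ++ O_F :: s & burger_cons b o = o1.
Proof.
move=> bB; elim: r o1 => [|t r IH] o1 o1O.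
  by case: b bB => // _; case: o1 o1O => [|u o1] //= /andP[uO _] [e]; rewrite -e in uO.
have burger u : is_burger u -> u :: t :: r = o1 ++ O_F :: s -> False.
  by move=> uB; case: o1 o1O => [_ [e]|v o1 /= /andP[vO _] [e]];
    [rewrite e in uB|rewrite -e /is_burger in uB vO *; rewrite vO in uB].
case: b bB IH burger => // _ IH burger; case: t burger => /= burger e;
  try by case: (burger _ _ e).
all: try by rewrite e; first [by exists (O_H :: o1) | by exists (O_C :: o1)
  | by exists (O_F :: o1)].
all: case: o1 {burger} o1O e => [_ [//]|v o1 /= /andP[_ o1O] [<- e]];
  have [ o -> <-] := IH _ o1O e;
  first [by exists (O_C :: o) | by exists (O_H :: o)].
Qed.

(** A flexible order of the reduced word is a letter of x that finds no burger, and the letters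
    before it reduce to the orders before it; so its position in x is unique. *)
Lemma flex_split_count o (Q : pred (seq Theta)) x : all is_order o ->
  (\sum_(l < size x) [&& nth B_H x l == O_F, reduce (take l x) == o
     & Q (reduce (drop l.+1 x))])%N = flex_split o Q (reduce x).
Proof.
elim: x o => [|t x IH] o oO; first by rewrite big_ord0.
rewrite big_ord_recl /= drop0.
case: (boolP (is_order t)) => tO.
  rewrite /reduce_cons tO; case: o oO => [_|u o /= /andP[uO oO]].
    rewrite big1 ?addn0 => [|l _]; last by rewrite /= andbF.
    by rewrite /flex_split /= ?take0 ?drop0 ?eqxx.
  rewrite andbF add0n.
  transitivity ((t == u) * \sum_(l < size x) [&& nth B_H x l == O_F,
    reduce (take l x) == o & Q (reduce (drop l.+1 x))])%N.
    rewrite big_distrr /=; apply: eq_bigr => l _; rewrite eqseq_cons.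
    by case: (t == u); rewrite /= ?mul1n ?andbF.
  rewrite IH // /flex_split /= eqseq_cons ltnS.
  by case: (t == u); rewrite /= ?mul1n ?andbF.
have -> : (t == O_F) = false by apply: contraNF tO => /eqP ->.
rewrite andFb add0n /reduce_cons (negbTE tO).
(* An absorbed burger removes exactly one order, so the prefix of [reduce x] that it turns into [o]
   has length [(size o).+1]. *)
set o0 := take (size o).+1 (reduce x).
transitivity ((burger_cons t o0 == o) * \sum_(l < size x) [&& nth B_H x l == O_F,
    reduce (take l x) == o0 & Q (reduce (drop l.+1 x))])%N.
  rewrite big_distrr /=; apply: eq_bigr => l _.
  have [xF|] := eqVneq (nth B_H x l) O_F; last by rewrite !andFb muln0.
  rewrite !andTb.
  have [e|ne] := eqVneq (burger_cons t (reduce (take l x))) o.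
    have [rO rs _] := burger_cons_absorb tO oO e.
    have rx : reduce x = reduce (take l x) ++ O_F :: reduce (drop l.+1 x).
      rewrite -[in LHS](cat_take_drop l x) reduce_catl (drop_nth B_H) // xF.
      by rewrite reduce_orders_cat.
    have -> : o0 = reduce (take l x) by rewrite /o0 rx -rs take_size_cat.
    by rewrite e !eqxx mul1n.
  have [e|] := eqVneq (reduce (take l x)) o0; last by rewrite muln0.
  by rewrite -e (negbTE ne) mul0n.
have [e|ne] := eqVneq (burger_cons t o0) o; last first.
  rewrite mul0n; apply/esym/eqP; rewrite eqb0; apply/flex_splitP => -[s es _].
  have [ o' ro' e'] := burger_cons_flex tO oO es.
  have [_ so' _] := burger_cons_absorb tO oO e'.
  by move: ne; rewrite /o0 ro' -so' take_size_cat // e' eqxx.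
have [ o0O so0 o0E] := burger_cons_absorb tO oO e.
rewrite mul1n IH //; congr nat_of_bool; apply/flex_splitP/flex_splitP.
  by move=> [s -> Qs]; exists s => //; rewrite o0E.
move=> [s es Qs]; exists s => //.
have [ o' ro' e'] := burger_cons_flex tO oO es.
have [_ so' _] := burger_cons_absorb tO oO e'.
by rewrite /o0 ro' -so' take_size_cat.
Qed.

(** In a debt the added hamburger has been consumed: by a hamburger order, or by a flexible order
    after passing m cheeseburger orders. *)
Lemma debt_burger_H r i j : nat_of_bool (is_debt i j (burger_cons B_H r)) =
  (is_debt i.+1 j r
   + \sum_(m < j.+1) flex_split (nseq m O_C) (is_debt i (j - m)) r)%N.
Proof.
elim: r i j => [|t r IH] i j.
  by rewrite big1 // => m _; rewrite /flex_split size_nseq ltn0.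
case: t => /=.
- rewrite big1 // => m _; rewrite /flex_split; case: (val m) => [|k] /=.
    by rewrite ?andbF.
  by rewrite ?eqseq_cons ?andbF.
- rewrite big1 // => m _; rewrite /flex_split; case: (val m) => [|k] /=.
    by rewrite ?andbF.
  by rewrite ?eqseq_cons ?andbF.
- rewrite big1 ?addn0 => [|m _].
    by rewrite /is_debt /= add1n eqSS.
  rewrite /flex_split; case: (val m) => [|k] /=; first by rewrite ?andbF.
  by rewrite ?eqseq_cons ?andbF.
- have -> : is_debt i j (O_C :: burger_cons B_H r) =
      (0 < j)%N && is_debt i j.-1 (burger_cons B_H r).
    by rewrite /is_debt /=; case: j => [|j] /=; rewrite ?andbF // add1n eqSS.
  have -> : is_debt i.+1 j (O_C :: r) = (0 < j)%N && is_debt i.+1 j.-1 r.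
    by rewrite /is_debt /=; case: j => [|j] /=; rewrite ?andbF // add1n eqSS.
  have E m Q : flex_split (nseq m.+1 O_C) Q (O_C :: r) = flex_split (nseq m O_C) Q r.
    by rewrite /flex_split /= ltnS eqseq_cons eqxx.
  have E0 Q : flex_split (nseq 0 O_C) Q (O_C :: r) = false.
    by rewrite /flex_split /= ?andbF.
  rewrite big_ord_recl E0 add0n; case: j => [|j] /=; first by rewrite big_ord0.
  by rewrite IH; congr (_ + _)%N; apply: eq_bigr => m _; rewrite E subSS.
- rewrite big_ord_recl big1 ?addn0 => [|m _]; last first.
    by rewrite /flex_split /= ?eqseq_cons ?andbF.
  by rewrite /flex_split /= ?take0 ?drop0 subn0 ?eqxx.
Qed.

(** * Weights of words *)

#[local] Arguments Theta_enum : simpl never.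

Section WordWeights.
Variables (R : realType) (p : R).
Local Notation wgt := (Theta_weight p).

Fixpoint words (n : nat) : seq (seq Theta) :=
  if n is n'.+1 then [seq t :: x | t <- Theta_enum, x <- words n'] else [:: [::]].

Lemma wordsS n : words n.+1 = [seq t :: x | t <- Theta_enum, x <- words n].
Proof. by []. Qed.

Definition Ew (n : nat) (f : seq Theta -> R) : R :=
  \sum_(x <- words n) (\prod_(t <- x) wgt t) * f x.

Lemma words_size n x : (x \in words n) = (size x == n).
Proof.
elim: n x => [|n IH] [|t x] //.
  by apply/negbTE/allpairsP => -[[]] ? ? [].
rewrite -[size _]/(size x).+1 eqSS -IH; apply/allpairsP/idP => [[[u y] /= [_ yn [_ ->]]] //|xn].
by exists (t, x); split => //; case: t.
Qed.

Lemma words_uniq n : uniq (words n).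
Proof.
by elim: n => [|n IH] //; apply: allpairs_uniq => // -[t x] [u y] _ _ [-> ->].
Qed.

Lemma Ew0 f : Ew 0 f = f [::].
Proof. by rewrite /Ew big_seq1 big_nil mul1r. Qed.

Lemma EwS n f : Ew n.+1 f = \sum_(t <- Theta_enum) wgt t * Ew n (fun x => f (t :: x)).
Proof.
rewrite /Ew wordsS big_allpairs_dep; apply: eq_bigr => t _; rewrite mulr_sumr.
by apply: eq_bigr => x _; rewrite big_cons mulrA.
Qed.

Lemma eq_Ew n f g : (forall x, size x = n -> f x = g x) -> Ew n f = Ew n g.
Proof.
move=> fg; rewrite /Ew big_seq [RHS]big_seq; apply: eq_bigr => x.
by rewrite words_size => /eqP /fg ->.
Qed.

Lemma EwD n f g : Ew n (fun x => f x + g x) = Ew n f + Ew n g.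
Proof. by rewrite /Ew -big_split; apply: eq_bigr => x _; rewrite mulrDr. Qed.

Lemma Ew_cst0 n : Ew n (fun=> 0) = 0.
Proof. by rewrite /Ew big1 // => x _; rewrite mulr0. Qed.

Lemma EwZ n a f : Ew n (fun x => a * f x) = a * Ew n f.
Proof. by rewrite /Ew mulr_sumr; apply: eq_bigr => x _; rewrite mulrCA. Qed.

Lemma Ew_sum n I (r : seq I) (F : I -> seq Theta -> R) :
  Ew n (fun x => \sum_(i <- r) F i x) = \sum_(i <- r) Ew n (F i).
Proof.
elim: r => [|i r IH].
  by rewrite big_nil -[RHS](Ew_cst0 n); apply: eq_Ew => x _; rewrite big_nil.
by rewrite big_cons -IH -EwD; apply: eq_Ew => x _; rewrite big_cons.
Qed.

Lemma Ew_cat m n f : Ew (m + n) f = Ew m (fun x => Ew n (fun y => f (x ++ y))).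
Proof.
elim: m f => [|m IH] f; first by rewrite Ew0.
by rewrite addSn !EwS; apply: eq_bigr => t _; rewrite IH.
Qed.

Lemma Ew_rcons n f :
  Ew n.+1 f = \sum_(t <- Theta_enum) wgt t * Ew n (fun x => f (rcons x t)).
Proof.
rewrite -addn1 Ew_cat.
under eq_Ew => x _ do rewrite EwS.
rewrite Ew_sum; apply: eq_bigr => t _; rewrite EwZ; congr (_ * _).
by apply: eq_Ew => x _; rewrite Ew0 cats1.
Qed.

Lemma big_Theta (V : zmodType) (F : Theta -> V) :
  \sum_(t <- Theta_enum) F t = F B_H + F B_C + F O_H + F O_C + F O_F.
Proof. by rewrite /Theta_enum !big_cons big_nil addr0 !addrA. Qed.

Lemma Ew_split n l x0 t (f g : seq Theta -> R) : (l < n)%N ->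
  Ew n (fun x => f (take l x) * (nth x0 x l == t)%:R * g (drop l.+1 x)) =
  Ew l f * wgt t * Ew (n - l.+1) g.
Proof.
move=> ln; have -> : n = (l + (n - l.+1).+1)%N by lia.
rewrite Ew_cat (_ : (l + _ - _)%N = (n - l.+1)%N); last by lia.
transitivity (Ew l (fun x => (wgt t * Ew (n - l.+1) g) * f x)); last first.
  by rewrite EwZ; ring.
apply: eq_Ew => x xl; rewrite EwS.
have tE : \sum_(u <- Theta_enum) wgt u *
    Ew (n - l.+1) (fun y => f x * (u == t)%:R * g y) =
    wgt t * Ew (n - l.+1) (fun y => f x * g y).
  have E u : wgt u * Ew (n - l.+1) (fun y => f x * (u == t)%:R * g y) =
      (u == t)%:R * (wgt u * Ew (n - l.+1) (fun y => f x * g y)).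
    by rewrite !EwZ; ring.
  under eq_bigr => u _ do rewrite E.
  by rewrite big_Theta; case: t {E} => /=; ring.
transitivity (\sum_(u <- Theta_enum) wgt u *
    Ew (n - l.+1) (fun y => f x * (u == t)%:R * g y)); last first.
  by rewrite tE EwZ; ring.
apply: eq_bigr => u _; congr (_ * _); apply: eq_Ew => y yn.
rewrite take_size_cat // nth_cat xl ltnn subnn /=.
by rewrite -cat_rcons drop_size_cat // size_rcons xl.
Qed.

Lemma Ew_swap n f : Ew n (fun x => f (map swap_letter x)) = Ew n f.
Proof.
elim: n f => [|n IH] f; first by rewrite !Ew0.
rewrite !EwS !big_Theta /= !(IH (fun x => f (_ :: x))) /=.
by ring.
Qed.

Definition stackW n h c : R := Ew n (fun x => (is_stack h c (reduce x))%:R).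
Definition debtW n i j : R := Ew n (fun x => (is_debt i j (reduce x))%:R).

Lemma debtWC n i j : debtW n i j = debtW n j i.
Proof.
rewrite /debtW -Ew_swap; apply: eq_Ew => x _.
by rewrite reduce_swap is_debt_swap.
Qed.

Lemma is_debt0 m r : is_debt 0 m r = (r == nseq m O_C).
Proof.
apply/and3P/eqP => [[rO /eqP rH /eqP rC]|->]; last first.
  split; first by elim: m => //= m ->.
    by elim: m => //= m.
  by elim: m => //= m /eqP ->.
elim: r m rO rH rC => [|t r IH] m //=; first by move=> _ _ <-.
move=> /andP[tO rO] rH; case: m => [|m]; case: t tO rH => //= _ rH [rC].
by rewrite (IH m).
Qed.

Lemma stackW0 h c : stackW 0 h c = (h == 0%N)%:R * (c == 0%N)%:R.
Proof. by rewrite /stackW Ew0 /is_stack /= -natrM mulnb ![0%N == _]eq_sym. Qed.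

Lemma debtW0 i j : debtW 0 i j = (i == 0%N)%:R * (j == 0%N)%:R.
Proof. by rewrite /debtW Ew0 /is_debt /= -natrM mulnb ![0%N == _]eq_sym. Qed.

Lemma Ew_flex n m (Q : pred (seq Theta)) :
  Ew n (fun x => (flex_split (nseq m O_C) Q (reduce x))%:R) =
  p / 2 * \sum_(l < n) debtW l 0 m * Ew (n - l.+1) (fun x => (Q (reduce x))%:R).
Proof.
transitivity (Ew n (fun x => \sum_(l < n) (is_debt 0 m (reduce (take l x)))%:R
    * (nth B_H x l == O_F)%:R * (Q (reduce (drop l.+1 x)))%:R)).
  apply: eq_Ew => x xn; rewrite -flex_split_count ?xn; last first.
    by elim: m => //= m ->.
  rewrite natr_sum; apply: eq_bigr => l _; rewrite is_debt0 -!natrM !mulnb.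
  by case: (nth B_H x l == O_F); rewrite /= ?andbT ?andbF.
rewrite Ew_sum mulr_sumr; apply: eq_bigr => l _.
rewrite (Ew_split B_H O_F (fun x => (is_debt 0 m (reduce x))%:R)
  (fun x => (Q (reduce x))%:R)) //=.
by rewrite -/(debtW _ _ _); ring.
Qed.

Lemma Ew_debt_BH n i j : Ew n (fun x => (is_debt i j (reduce (B_H :: x)))%:R) =
  debtW n i.+1 j + p / 2 *
    \sum_(m < j.+1) \sum_(l < n) debtW l 0 m * debtW (n - l.+1) i (j - m).
Proof.
under eq_Ew => x _ do rewrite /= /reduce_cons /= debt_burger_H natrD natr_sum.
rewrite EwD Ew_sum; congr (_ + _); rewrite mulr_sumr; apply: eq_bigr => m _.
by rewrite Ew_flex.
Qed.

Lemma Ew_debt_BC n i j : Ew n (fun x => (is_debt i j (reduce (B_C :: x)))%:R) =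
  debtW n i j.+1 + p / 2 *
    \sum_(m < i.+1) \sum_(l < n) debtW l 0 m * debtW (n - l.+1) (i - m) j.
Proof.
rewrite -Ew_swap.
under eq_Ew => x _ do rewrite -[B_C :: _]/(map swap_letter (B_H :: x))
  reduce_swap is_debt_swap.
rewrite Ew_debt_BH debtWC; congr (_ + _ * _).
by apply: eq_bigr => m _; apply: eq_bigr => l _; congr (_ * _); exact: debtWC.
Qed.

Lemma Ew_debt_OH n i j : Ew n (fun x => (is_debt i j (reduce (O_H :: x)))%:R) =
  if i is i'.+1 then debtW n i' j else 0.
Proof.
case: i => [|i]; last first.
  by apply: eq_Ew => x _; rewrite /= /reduce_cons /is_debt /= add1n eqSS.
by rewrite -(Ew_cst0 n); apply: eq_Ew => x _; rewrite /= /reduce_cons /is_debt /= andbF.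
Qed.

Lemma Ew_debt_OC n i j : Ew n (fun x => (is_debt i j (reduce (O_C :: x)))%:R) =
  if j is j'.+1 then debtW n i j' else 0.
Proof.
rewrite -Ew_swap.
under eq_Ew => x _ do rewrite -[ O_C :: _]/(map swap_letter (O_H :: x))
  reduce_swap is_debt_swap.
by rewrite Ew_debt_OH; case: j => // j; rewrite debtWC.
Qed.

Lemma debtWS n i j : debtW n.+1 i j =
  (back_pair_step p debtW debtW n i j
   + back_pair_step p debtW (fun n j i => debtW n i j) n j i) / 2.
Proof.
rewrite {1}/debtW EwS big_Theta Ew_debt_BH Ew_debt_BC Ew_debt_OH Ew_debt_OC.
(* A leading flexible order is never consumed, and a debt contains none. *)
rewrite [Ew n (fun x => (is_debt _ _ (reduce (O_F :: x)))%:R)](_ : _ = 0); last first.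
  by rewrite -(Ew_cst0 n); apply: eq_Ew => x _.
rewrite /back_pair_step /=.
set a := \sum_(m < i.+1) _; set b := \sum_(m < j.+1) _.
set u := match i with 0%N => 0 | i'.+1 => debtW n i' j end.
set v := match j with 0%N => 0 | j'.+1 => debtW n i j' end.
by move: a b u v => a b u v; field.
Qed.

Lemma size_burger_cons b r : (size (burger_cons b r) <= (size r).+1)%N.
Proof.
elim: r => [|t r IH]; first by case: b.
by case: b IH => //= IH; case: t => //=; rewrite ?ltnS // ltnW // ltnW.
Qed.

Lemma size_reduce x : (size (reduce x) <= size x)%N.
Proof.
elim: x => //= t x IH; rewrite /reduce_cons; case: ifP => _ //=.
by rewrite (leq_trans (size_burger_cons _ _)).
Qed.

Lemma all_nseqE (t : Theta) r k : (size r <= k)%N ->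
  nat_of_bool (all (pred1 t) r) = (\sum_(m < k.+1) (r == nseq m t))%N.
Proof.
move=> rk; have [/all_pred1P rt|rt] := boolP (all (pred1 t) r).
  rewrite (bigD1 (Ordinal (rk : (size r < k.+1)%N))) //= -rt eqxx big1 ?addn0 //.
  move=> m /eqP mr; apply/eqP; rewrite eqb0; apply/eqP => e.
  by apply: mr; apply: val_inj; rewrite /= e size_nseq.
rewrite big1 // => m _; apply/eqP; rewrite eqb0; apply: contraNN rt => /eqP ->.
by apply/all_pred1P; rewrite size_nseq.
Qed.

(** Cut the word at the top hamburger: the m cheeseburger orders left by the suffix are served by
    the prefix, whence c + m, and 1 / 4 is the weight of the letter. *)
Lemma Ew_stack_top_BH n h c :
  Ew n (fun x => ((last O_F (reduce x) == B_H) && is_stack h.+1 c (reduce x))%:R) =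
  4^-1 * \sum_(m < n.+1) \sum_(l < n) debtW l 0 m * stackW (n - l.+1) h (c + m).
Proof.
transitivity (Ew n (fun x => \sum_(m < n.+1) \sum_(l < n)
    (is_stack h (c + m) (reduce (take l x)))%:R * (nth O_F x l == B_H)%:R
    * (is_debt 0 m (reduce (drop l.+1 x)))%:R)).
  apply: eq_Ew => x xn; rewrite -mulnb natrM.
  rewrite -(@top_split B_H) // xn natr_sum mulr_suml exchange_big /=.
  apply: eq_bigr => l _; rewrite -mulnb (@all_nseqE _ _ n); last first.
    by rewrite (leq_trans (size_reduce _)) // size_drop xn leq_subr.
  rewrite natrM natr_sum mulr_sumr mulr_suml; apply: eq_bigr => m _.
  rewrite is_debt0; have [e|] := eqVneq (reduce _) (nseq m O_C); last first.
    by rewrite !mulr0 mul0r.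
  have [xl|] := eqVneq (nth O_F x l) B_H; last by rewrite !mul0r mulr0 mul0r.
  rewrite !mul1r !mulr1; congr (_%:R); congr nat_of_bool.
  have lx : (l < size x)%N by rewrite xn.
  rewrite -[in LHS](cat_take_drop l x) (drop_nth O_F lx) xl.
  rewrite -cat_rcons reduce_catr e stack_OC_nseq stack_BH /=.
  by [].
rewrite Ew_sum mulr_sumr; apply: eq_bigr => m _; rewrite Ew_sum.
(* From now on l is the length of the suffix, no longer the position of the hamburger. *)
rewrite (reindex_inj rev_ord_inj) mulr_sumr; apply: eq_bigr => l _ /=.
rewrite (Ew_split O_F B_H (fun x => (is_stack h (c + m) (reduce x))%:R)
  (fun x => (is_debt 0 m (reduce x))%:R)) /=; last by move: (ltn_ord l); lia.
have -> : (n - (n - l.+1).+1)%N = l by move: (ltn_ord l); lia.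
by rewrite -/(debtW _ _ _) -/(stackW _ _ _); field.
Qed.

Lemma stackWC n h c : stackW n h c = stackW n c h.
Proof.
rewrite /stackW -Ew_swap; apply: eq_Ew => x _.
by rewrite reduce_swap is_stack_swap.
Qed.

Lemma last_swap x : last O_F (map swap_letter x) = swap_letter (last O_F x).
Proof. by rewrite -[X in last X](_ : swap_letter O_F = _) // last_map. Qed.

Lemma Ew_stack_top_BC n h c :
  Ew n (fun x => ((last O_F (reduce x) == B_C) && is_stack h c.+1 (reduce x))%:R) =
  4^-1 * \sum_(m < n.+1) \sum_(l < n) debtW l 0 m * stackW (n - l.+1) (h + m) c.
Proof.
rewrite -Ew_swap.
transitivity (Ew n (fun x =>
    ((last O_F (reduce x) == B_H) && is_stack c.+1 h (reduce x))%:R)).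
  apply: eq_Ew => x _; rewrite reduce_swap is_stack_swap last_swap.
  by case: (last _ _).
rewrite Ew_stack_top_BH; congr (_ * _); apply: eq_bigr => m _.
by apply: eq_bigr => l _; congr (_ * _); exact: stackWC.
Qed.

Lemma stackWS n h c : stackW n.+1 h c =
  (pair_step p (fun l m => debtW l 0 m) stackW n h c
   + pair_step p (fun l m => debtW l 0 m) (fun n k h => stackW n h k) n c h) / 2.
Proof.
rewrite {1}/stackW Ew_rcons big_Theta.
under [Ew n (fun x => (is_stack h c (reduce (rcons x B_H)))%:R)]eq_Ew => x _
  do rewrite stack_BH -mulnb natrM.
under [Ew n (fun x => (is_stack h c (reduce (rcons x B_C)))%:R)]eq_Ew => x _
  do rewrite stack_BC -mulnb natrM.
under [Ew n (fun x => (is_stack h c (reduce (rcons x O_H)))%:R)]eq_Ew => x _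
  do rewrite stack_OH.
under [Ew n (fun x => (is_stack h c (reduce (rcons x O_C)))%:R)]eq_Ew => x _
  do rewrite stack_OC.
have -> : Ew n (fun x => (is_stack h c (reduce (rcons x O_F)))%:R) =
    Ew n (fun x => ((last O_F (reduce x) == B_H) && is_stack h.+1 c (reduce x))%:R)
    + Ew n (fun x => ((last O_F (reduce x) == B_C) && is_stack h c.+1 (reduce x))%:R).
  rewrite -EwD; apply: eq_Ew => x _; rewrite stack_OF.
  case: (last _ _); rewrite /= ?add0r ?addr0 //.
  by rewrite orbF.
rewrite Ew_stack_top_BH Ew_stack_top_BC !EwZ -!/(stackW _ _ _) /pair_step.
by case: h => [|h]; case: c => [|c] /=; field.
Qed.

Lemma Theta_weight_ge0 t : 0 <= p -> p <= 1 -> 0 <= wgt t.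
Proof. by move=> p0 p1; case: t => /=; lra. Qed.

Lemma Ew_ge0 n f : 0 <= p -> p <= 1 -> (forall x, 0 <= f x) -> 0 <= Ew n f.
Proof.
move=> p0 p1 f0; apply: sumr_ge0 => x _; rewrite mulr_ge0 // prodr_ge0 // => t _.
exact: Theta_weight_ge0.
Qed.

Lemma debtW_ge0 n i j : 0 <= p -> p <= 1 -> 0 <= debtW n i j.
Proof. by move=> p0 p1; apply: Ew_ge0 => // x; rewrite ler0n. Qed.

End WordWeights.

(** * Nonnegative coefficients *)

Section Positivity.
Variable C : numFieldType.
Local Notation S := (fps {poly C}).

(** The degree bound says that a word of length n makes at most n steps; it tells how many roots of
    unity suffice for the means over z. *)
Definition nonneg_fps (f : S) : Prop :=
  forall n, (size (f n) <= n.+1)%N /\ forall a, 0 <= (f n)`_a.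

Lemma nonneg_fpsD f g : nonneg_fps f -> nonneg_fps g -> nonneg_fps (f + g).
Proof.
move=> hf hg n; have [sf pf] := hf n; have [sg pg] := hg n; split.
  by rewrite fpsDE (leq_trans (size_polyD _ _)) // geq_max sf sg.
by move=> a; rewrite fpsDE coefD addr_ge0.
Qed.

Lemma nonneg_fps0 : nonneg_fps 0.
Proof. by move=> n; rewrite fps0E size_poly0; split => // a; rewrite coef0. Qed.

Lemma nonneg_fps_sum I (r : seq I) (F : I -> S) :
  (forall i, nonneg_fps (F i)) -> nonneg_fps (\sum_(i <- r) F i).
Proof.
by move=> FP; elim/big_ind: _ => //; [exact: nonneg_fps0|exact: nonneg_fpsD].
Qed.

Lemma nonneg_fpsM f g : nonneg_fps f -> nonneg_fps g -> nonneg_fps (f * g).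
Proof.
move=> hf hg n; rewrite fpsME; split.
  apply: (leq_trans (size_sum _ _ _)); apply/bigmax_leqP => i _.
  have [sf _] := hf i; have [sg _] := hg (n - i)%N.
  rewrite (leq_trans (size_polyMleq _ _)) //; move: (ltn_ord i); lia.
move=> a; rewrite coef_sum; apply: sumr_ge0 => i _; rewrite coefM.
by apply: sumr_ge0 => j _; rewrite mulr_ge0 //; [apply: (hf i).2|apply: (hg _).2].
Qed.

Lemma nonneg_fpsC a : 0 <= a -> nonneg_fps (kS a).
Proof.
move=> a0 n; rewrite /kS /fpsC; case: eqP => _.
  split; first by rewrite size_polyC (leq_trans (leq_b1 _)).
  by move=> b; rewrite coefC; case: ifP.
by rewrite size_poly0; split => // b; rewrite coef0.
Qed.

Lemma nonneg_fps1 : nonneg_fps 1.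
Proof. by rewrite -(kS1 C); apply: nonneg_fpsC. Qed.

Lemma nonneg_fpsX f m : nonneg_fps f -> nonneg_fps (f ^+ m).
Proof.
move=> hf; elim: m => [|m IH]; first exact: nonneg_fps1.
by rewrite exprS; apply: nonneg_fpsM.
Qed.

Lemma nonneg_ZX f : nonneg_fps f -> nonneg_fps (ZX C * f).
Proof.
move=> hf [|n]; first by rewrite ZX0 size_poly0; split => // b; rewrite coef0.
have [sf pf] := hf n; rewrite ZXS; split.
  by rewrite (leq_trans (size_XM_le _)).
by move=> a; rewrite coefXM; case: ifP.
Qed.

Variables (p : C) (D0 : nat -> nat -> C).
Hypotheses (p0 : 0 <= p) (p1 : p <= 1) (D00 : forall l m, 0 <= D0 l m).

Lemma nonneg_excP m : nonneg_fps (excP D0 m).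
Proof.
move=> n; split; first by rewrite size_polyC (leq_trans (leq_b1 _)).
move=> a; rewrite coefC; case: ifP => _ //; case: n => //= n.
by rewrite divr_ge0.
Qed.

Lemma nonneg_step f : nonneg_fps f -> nonneg_fps (step_gf p D0 f).
Proof.
move=> hf; apply: nonneg_fpsD; first apply: nonneg_fpsD.
- by apply: nonneg_fpsC; rewrite invr_ge0.
- apply: nonneg_fpsM; last exact: nonneg_fpsX.
  by apply: nonneg_fpsC; rewrite divr_ge0 // subr_ge0.
apply: nonneg_fpsM; first by apply: nonneg_fpsC; rewrite divr_ge0.
apply: nonneg_fpsM => // n; rewrite /fps_comp.
have : nonneg_fps (\sum_(m < n.+1) excP D0 m * f ^+ m).
  apply: nonneg_fps_sum => m; apply: nonneg_fpsM; first exact: nonneg_excP.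
  exact: nonneg_fpsX.
by apply.
Qed.

Lemma nonneg_pass : nonneg_fps (passS p D0).
Proof.
pose Phi (f : unit -> S) (_ : unit) := ZX C * step_gf p D0 (f tt).
have contr k (f g : unit -> S) : (forall i n, (n < k)%N -> f i n = g i n) ->
    forall i n, (n < k.+1)%N -> Phi f i n = Phi g i n.
  move=> e i n nk; apply: ZX_eqm nk => m mk; apply: step_eqm mk => j jk.
  exact: e.
move=> n; rewrite /passS (@fps_fixE _ _ Phi contr n.+1) //.
have : nonneg_fps (iter n.+1 Phi (fun=> 0) tt); last by apply.
elim: (n.+1) => [|k IH] /=; first exact: nonneg_fps0.
by apply: nonneg_ZX; apply: nonneg_step.
Qed.

Lemma nonneg_null_sub1 : nonneg_fps (nullS p D0 - 1).
Proof.
have -> : nullS p D0 - 1 = kS 2 * (kS ((1 - p) / 2) * passS p D0 ^+ 2 +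
    kS (p / 2) * (passS p D0 * fps_comp (excP D0) (passS p D0))).
  by rewrite /nullS /step_gf -!addrA mulrDr kS2V; ring.
apply: nonneg_fpsM; first exact: nonneg_fpsC.
apply: nonneg_fpsD; apply: nonneg_fpsM.
- by apply: nonneg_fpsC; rewrite divr_ge0 // subr_ge0.
- by apply: nonneg_fpsX; exact: nonneg_pass.
- by apply: nonneg_fpsC; rewrite divr_ge0.
apply: nonneg_fpsM; first exact: nonneg_pass.
move=> n; rewrite /fps_comp.
have : nonneg_fps (\sum_(m < n.+1) excP D0 m * passS p D0 ^+ m); last by apply.
apply: nonneg_fps_sum => m; apply: nonneg_fpsM; first exact: nonneg_excP.
by apply: nonneg_fpsX; exact: nonneg_pass.
Qed.

Lemma pair_ge0 f g n : nonneg_fps f -> nonneg_fps g -> 0 <= pair f g n.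
Proof.
move=> hf hg; apply: sumr_ge0 => i _; apply: Kp_ge0 => a.
  exact: (hf i).2.
exact: (hg _).2.
Qed.

Lemma nonneg_null : nonneg_fps (nullS p D0).
Proof. by rewrite -[nullS _ _](subrK 1); apply: nonneg_fpsD; [exact: nonneg_null_sub1|exact: nonneg_fps1]. Qed.

(** Keeping only the empty walk in [nullS] leaves a smaller pairing, all coefficients being
    nonnegative. *)
Lemma pair_stay_ge h k n :
  pair (passS p D0 ^+ h) (passS p D0 ^+ k) n <= pair (stayS p D0 h) (stayS p D0 k) n.
Proof.
have hX m : nonneg_fps (passS p D0 ^+ m) by apply: nonneg_fpsX; exact: nonneg_pass.
have hS m : nonneg_fps ((nullS p D0 - 1) * passS p D0 ^+ m).
  by apply: nonneg_fpsM; [exact: nonneg_null_sub1|exact: hX].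
have E m : stayS p D0 m = passS p D0 ^+ m + (nullS p D0 - 1) * passS p D0 ^+ m.
  by rewrite /stayS; ring.
rewrite !E pairDl !pairDr !fpsDE -addrA lerDl !addr_ge0 // ?pair_ge0 //.
Qed.

End Positivity.

(** * The weights as complex numbers *)

Section ComplexPass.
Variables (R : realType) (p : R).
Hypotheses (p0 : 0 <= p) (p1 : p <= 1).
Local Notation toC := (real_complex R).
Local Notation CC := (R[i] : numFieldType).

Definition debtC n i j : R[i] := toC (debtW p n i j).
Definition stackC n h k : R[i] := toC (stackW p n h k).

Lemma toC_back_step (A : nat -> nat -> nat -> R) n i j :
  toC (back_pair_step p (debtW p) A n i j) =
  back_pair_step (toC p) debtC (fun n i j => toC (A n i j)) n i j.
Proof.
rewrite /back_pair_step !rmorphD !rmorphM !fmorphV !rmorphB !rmorph1 !rmorph_nat.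
congr (_ * _ + _ + _ * _); first by case: i => [|i] //; rewrite rmorph0.
rewrite rmorph_sum; apply: eq_bigr => m _; rewrite rmorph_sum.
by apply: eq_bigr => l _; rewrite rmorphM.
Qed.

Lemma toC_pair_step (A : nat -> nat -> nat -> R) n i j :
  toC (pair_step p (fun l m => debtW p l 0 m) A n i j) =
  pair_step (toC p) (fun l m => debtC l 0 m) (fun n i j => toC (A n i j)) n i j.
Proof.
rewrite /pair_step !rmorphD !rmorphM !fmorphV !rmorphB !rmorph1 !rmorph_nat.
congr (_ * _ + _ + _ * _); first by case: i => [|i] //; rewrite rmorph0.
rewrite rmorph_sum; apply: eq_bigr => m _; rewrite rmorph_sum.
by apply: eq_bigr => l _; rewrite rmorphM.
Qed.

Lemma debtC0 i j : debtC 0 i j = (i == 0%N)%:R * (j == 0%N)%:R.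
Proof. by rewrite /debtC debtW0 rmorphM !rmorph_nat. Qed.

Lemma debtCS n i j : debtC n.+1 i j =
  (back_pair_step (toC p) debtC debtC n i j
   + back_pair_step (toC p) debtC (fun n j i => debtC n i j) n j i) / 2.
Proof.
rewrite {1}/debtC debtWS rmorphM rmorphD fmorphV rmorph_nat.
by congr ((_ + _) / _); exact: toC_back_step.
Qed.

Lemma stackC_pair n h k : stackC n h k =
  pair (stayS (toC p) (fun l m => debtC l 0 m) h)
       (stayS (toC p) (fun l m => debtC l 0 m) k) n.
Proof.
apply: stay_pairP => [{}h {}k|{}n {}h {}k].
  by rewrite /stackC stackW0 rmorphM !rmorph_nat.
rewrite {1}/stackC stackWS rmorphM rmorphD fmorphV rmorph_nat.
by congr ((_ + _) / _); exact: toC_pair_step.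
Qed.

Lemma debtC_ge0 l m : 0 <= debtC l 0 m.
Proof. by rewrite /debtC ler0c debtW_ge0. Qed.

Lemma toC_p0 : 0 <= toC p. Proof. by rewrite ler0c. Qed.
Lemma toC_p1 : toC p <= 1. Proof. by rewrite -(rmorph1 toC) lecR. Qed.

End ComplexPass.

(** * Averages over roots of unity *)

Local Notation Re := complex.Re.
Local Notation Im := complex.Im.

Section ComplexModulus.
Variable R : realType.
Local Notation C := R[i].
Local Notation toC := (real_complex R).
Implicit Types z w : C.

(** The norm of R[i] is valued in R[i]; this one is valued in R, where the estimates are made. *)
Definition cabs z : R := Re `|z|.

Lemma cabsE z : toC (cabs z) = `|z|.
Proof. by rewrite /cabs RRe_real // normr_real. Qed.

Lemma cabs_ge0 z : 0 <= cabs z.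
Proof. by rewrite -ler0c cabsE. Qed.

Lemma cabs0 : cabs 0 = 0. Proof. by rewrite /cabs normr0. Qed.
Lemma cabs1 : cabs 1 = 1. Proof. by rewrite /cabs normr1. Qed.

Lemma cabsM z w : cabs (z * w) = cabs z * cabs w.
Proof. by apply: complexI; rewrite cabsE normrM -!cabsE -rmorphM. Qed.

Lemma cabsX z n : cabs (z ^+ n) = cabs z ^+ n.
Proof. by apply: complexI; rewrite cabsE normrX -cabsE -rmorphXn. Qed.

Lemma cabsV z : cabs z^-1 = (cabs z)^-1.
Proof. by apply: complexI; rewrite cabsE normfV -cabsE -fmorphV. Qed.

Lemma cabsN z : cabs (- z) = cabs z. Proof. by rewrite /cabs normrN. Qed.

Lemma cabsD z w : cabs (z + w) <= cabs z + cabs w.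
Proof. by rewrite -lecR rmorphD !cabsE ler_normD. Qed.

Lemma cabsB z w : cabs (z - w) = cabs (w - z).
Proof. by rewrite -cabsN opprB. Qed.

Lemma cabs_dist z w : cabs z - cabs w <= cabs (z - w).
Proof. by rewrite lerBlDr -[X in cabs X <= _](subrK w) cabsD. Qed.

Lemma cabs_sum I (r : seq I) (P : pred I) (F : I -> C) :
  cabs (\sum_(i <- r | P i) F i) <= \sum_(i <- r | P i) cabs (F i).
Proof.
rewrite -lecR cabsE rmorph_sum; apply: le_trans (ler_norm_sum _ _ _) _.
by apply: ler_sum => i _; rewrite -cabsE.
Qed.

Lemma cabs_real (x : R) : cabs (toC x) = `|x|.
Proof.
by apply: complexI; rewrite cabsE normc_def /= expr0n addr0 sqrtr_sqr.
Qed.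

Lemma cabs_eq0 z : (cabs z == 0) = (z == 0).
Proof.
apply/eqP/eqP => [e|->]; last exact: cabs0.
by apply/eqP; rewrite -normr_eq0 -cabsE e rmorph0.
Qed.

Lemma cabs_conj z : cabs (conjc z) = cabs z.
Proof. by rewrite /cabs normcJ. Qed.

Lemma conjcM z w : conjc (z * w) = conjc z * conjc w. Proof. exact: rmorphM. Qed.
Lemma conjcX z n : conjc (z ^+ n) = conjc z ^+ n. Proof. exact: rmorphXn. Qed.

Lemma sqr_cabs z : cabs z ^+ 2 = Re z ^+ 2 + Im z ^+ 2.
Proof. by apply: complexI; rewrite rmorphXn /= cabsE -add_Re2_Im2. Qed.

Lemma toC_sqr_cabs z : toC (cabs z ^+ 2) = z * conjc z.
Proof. by rewrite rmorphXn /= cabsE sqr_normc. Qed.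

Lemma ReD z w : Re (z + w) = Re z + Re w. Proof. by case: z; case: w. Qed.
Lemma ImD z w : Im (z + w) = Im z + Im w. Proof. by case: z; case: w. Qed.
Lemma ReN z : Re (- z) = - Re z. Proof. by case: z. Qed.
Lemma ImN z : Im (- z) = - Im z. Proof. by case: z. Qed.
Lemma ReM z w : Re (z * w) = Re z * Re w - Im z * Im w.
Proof. by case: z; case: w. Qed.
Lemma Re_toCM (a : R) z : Re (toC a * z) = a * Re z.
Proof. by case: z => x y /=; rewrite mul0r subr0. Qed.
Lemma Re_sum I (r : seq I) (P : pred I) (F : I -> C) :
  Re (\sum_(i <- r | P i) F i) = \sum_(i <- r | P i) Re (F i).
Proof. by elim/big_rec2: _ => // i x y _ <-; rewrite ReD. Qed.
Lemma Re_le_cabs z : `|Re z| <= cabs z.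
Proof. by rewrite -lecR cabsE normc_ge_Re. Qed.

Lemma Im_le_cabs z : `|Im z| <= cabs z.
Proof.
rewrite -(@ler_pXn2r _ 2) ?nnegrE ?cabs_ge0 // sqr_cabs -normrX ger0_norm ?sqr_ge0 //.
by rewrite lerDr sqr_ge0.
Qed.

Lemma cabs_le_ReIm z : cabs z <= `|Re z| + `|Im z|.
Proof.
rewrite -(@ler_pXn2r _ 2) ?nnegrE ?cabs_ge0 ?addr_ge0 // sqr_cabs.
rewrite -[Re z ^+ 2]real_normK ?num_real // -[Im z ^+ 2]real_normK ?num_real //.
have := mulr_ge0 (normr_ge0 (Re z)) (normr_ge0 (Im z)); nra.
Qed.

Definition cis (t : R) : C := Complex (cos t) (sin t).

Lemma cis0 : cis 0 = 1. Proof. by rewrite /cis cos0 sin0. Qed.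

Lemma cisD s t : cis (s + t) = cis s * cis t.
Proof.
rewrite /cis cosD sinD; apply/eqP; rewrite eq_complex /= eqxx /=.
by apply/eqP; ring.
Qed.

Lemma cabs_cis t : cabs (cis t) = 1.
Proof.
apply/eqP; rewrite -(@eqrXn2 _ 2) ?cabs_ge0 // sqr_cabs /= cos2Dsin2 expr1n.
exact: eqxx.
Qed.

Lemma cisX t n : cis t ^+ n = cis (t *+ n).
Proof. by elim: n => [|n IH]; rewrite ?mulr0n ?cis0 // exprS mulrS cisD IH. Qed.

Lemma cis_2pi : cis (pi *+ 2) = 1.
Proof. by rewrite /cis cos2pi sin2pi. Qed.

Lemma cis_neq1 t : 0 < t -> t < pi *+ 2 -> cis t != 1.
Proof.
move=> t0 t2; apply/eqP => -[ct _].
have s0 : 0 < sin (t / 2) by apply: sin_gt0_pi; lra.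
have : cos t = 1 - sin (t / 2) ^+ 2 *+ 2.
  rewrite [t in LHS](_ : t = (t / 2) *+ 2); last by rewrite mulr2n; field.
  by rewrite cos_mulr2n cos2sin2 mulrnBl; ring.
have := exprn_gt0 2 s0; rewrite ct mulr2n; lra.
Qed.

Definition zroot (L j : nat) : C := cis (pi *+ 2 * (j%:R / L%:R)).

Lemma cabs_zroot L j : cabs (zroot L j) = 1.
Proof. exact: cabs_cis. Qed.

Lemma zroot_conj L j : zroot L j * conjc (zroot L j) = 1.
Proof. by rewrite -toC_sqr_cabs cabs_zroot expr1n rmorph1. Qed.

Lemma zrootX L j i : zroot L j ^+ i = (zroot L 1 ^+ i) ^+ j.
Proof.
rewrite -exprM /zroot !cisX; congr cis.
by rewrite -[LHS]mulr_natr -[RHS]mulr_natr natrM; ring.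
Qed.

Lemma zroot_order L : (0 < L)%N -> zroot L 1 ^+ L = 1.
Proof.
move=> L0; rewrite /zroot cisX -[RHS]cis_2pi; congr cis.
by rewrite -[LHS]mulr_natr; field; rewrite pnatr_eq0; lia.
Qed.

Lemma sum_zroot L i : (0 < i < L)%N -> \sum_(j < L) zroot L j ^+ i = 0.
Proof.
move=> /andP[i0 iL]; set q := zroot L 1 ^+ i.
have q1 : q != 1.
  have L0 : 0 < L%:R :> R by rewrite ltr0n (leq_ltn_trans _ iL).
  have pi2 : 0 < pi *+ 2 :> R by rewrite mulrn_wgt0 ?pi_gt0.
  have -> : q = cis (pi *+ 2 * (i%:R / L%:R)).
    by rewrite /q /zroot cisX; congr cis; rewrite -[LHS]mulr_natr; ring.
  apply: cis_neq1; first by rewrite mulr_gt0 // divr_gt0 // ltr0n.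
  by rewrite gtr_pMr // ltr_pdivrMr // mul1r ltr_nat.
have -> : \sum_(j < L) zroot L j ^+ i = \sum_(j < L) q ^+ j.
  by apply: eq_bigr => j _; rewrite zrootX.
have /eqP := subrX1 q L; rewrite -exprM mulnC exprM zroot_order ?expr1n; last by lia.
by rewrite subrr eq_sym mulf_eq0 subr_eq0 (negbTE q1) /= => /eqP.
Qed.

Definition avg (L : nat) (f : nat -> C) : C := L%:R^-1 * \sum_(j < L) f j.

Lemma avg1 L : (0 < L)%N -> avg L (fun=> 1) = 1.
Proof.
by move=> L0; rewrite /avg sumr_const card_ord mulVf // pnatr_eq0; lia.
Qed.

Lemma avg_sum L I (r : seq I) (F : I -> nat -> C) :
  avg L (fun j => \sum_(i <- r) F i j) = \sum_(i <- r) avg L (F i).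
Proof. by rewrite /avg exchange_big mulr_sumr. Qed.

Lemma avgZ L a f : avg L (fun j => a * f j) = a * avg L f.
Proof. by rewrite /avg -mulr_sumr mulrCA. Qed.

Lemma eq_avg L f g : f =1 g -> avg L f = avg L g.
Proof. by move=> fg; congr (_ * _); apply: eq_bigr => j _. Qed.

Lemma avg_conj L f : avg L (fun j => conjc (f j)) = conjc (avg L f).
Proof. by rewrite /avg rmorphM fmorphV rmorph_nat rmorph_sum. Qed.

Lemma avg_zroot L i : (i < L)%N -> avg L (fun j => zroot L j ^+ i) = (i == 0%N)%:R.
Proof.
case: i => [|i] iL; first by rewrite -(@avg1 L) //; apply: eq_avg => j; rewrite expr0.
by rewrite /avg sum_zroot ?mulr0 // iL.
Qed.

(** The Cauchy formula over L roots of unity, exact for degrees below L by orthogonality. *)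
Lemma avg_coef L (q : {poly C}) n : (size q <= L)%N -> (n < L)%N ->
  q`_n = avg L (fun j => conjc (zroot L j) ^+ n * q.[zroot L j]).
Proof.
move=> qL nL.
have E i : (i < L)%N ->
    avg L (fun j => conjc (zroot L j) ^+ n * zroot L j ^+ i) = (i == n)%:R.
  move=> iL; have [in_|ni] := leqP i n.
    rewrite (eq_avg L (g := fun j => conjc (zroot L j ^+ (n - i)))).
      rewrite avg_conj avg_zroot; last by rewrite (leq_ltn_trans (leq_subr _ _)).
      by rewrite conjc_nat subn_eq0 eqn_leq in_.
    move=> j; rewrite -{1}(subnK in_) exprD -mulrA -exprMn.
    by rewrite [conjc _ * zroot _ _]mulrC zroot_conj expr1n mulr1 rmorphXn.
  rewrite (eq_avg L (g := fun j => zroot L j ^+ (i - n))).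
    rewrite avg_zroot; last by rewrite (leq_ltn_trans (leq_subr _ _)).
    by rewrite subn_eq0 leqNgt ni /= gtn_eqF.
  move=> j; rewrite -{1}(subnK (ltnW ni)) exprD mulrCA -exprMn.
  by rewrite [conjc _ * zroot _ _]mulrC zroot_conj expr1n mulr1.
rewrite (eq_avg L (g := fun j =>
  \sum_(i < size q) q`_i * (conjc (zroot L j) ^+ n * zroot L j ^+ i))).
  rewrite avg_sum.
  under eq_bigr => i _ do rewrite avgZ E ?(leq_trans (ltn_ord i)) //.
  have [nq|qn] := ltnP n (size q).
    rewrite (bigD1 (Ordinal nq)) //= eqxx mulr1 big1 ?addr0 // => i.
    by rewrite -val_eqE /= => /negbTE ->; rewrite mulr0.
  rewrite nth_default // big1 // => i _.
  by rewrite (ltn_eqF (leq_trans (ltn_ord i) qn)) mulr0.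
move=> j; rewrite horner_coef mulr_sumr; apply: eq_bigr => i _.
by rewrite mulrCA.
Qed.

Definition zhalf (L j : nat) : C := (1 + zroot L j) / 2.

(** This is the relation z + z' = 2 z z' of [step_sum], for z' the conjugate of z. *)
Lemma zhalf_circle w : w * conjc w = 1 ->
  (1 + w) / 2 + conjc ((1 + w) / 2) = 2 * ((1 + w) / 2) * conjc ((1 + w) / 2).
Proof.
move=> ww; rewrite rmorphM rmorphD rmorph1 fmorphV rmorph_nat.
transitivity ((1 + w + conjc w + w * conjc w) / 2); last by field.
by rewrite ww; field.
Qed.

(** By [zhalf_circle] the mean obeys Pascal's rule [binKSS]; when a or b is 0, only the constant
    term of the binomial expansion has a nonzero mean. *)
Lemma avg_binK L a b : (a < L)%N -> (b < L)%N ->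
  avg L (fun j => zhalf L j ^+ a * conjc (zhalf L j) ^+ b) = binK C a b.
Proof.
have base c : (c < L)%N -> avg L (fun j => zhalf L j ^+ c) = 2^-1 ^+ c.
  move=> cL; rewrite (eq_avg L (g := fun j => \sum_(i < c.+1)
      (2^-1 ^+ c *+ 'C(c, i)) * zroot L j ^+ i)).
    rewrite avg_sum big_ord_recl big1 => [|i _].
      by rewrite avgZ avg_zroot ?(leq_ltn_trans _ cL) // mulr1 addr0 bin0.
    by rewrite avgZ avg_zroot ?mulr0 // (leq_ltn_trans _ cL) // -ltnS ltn_ord.
  move=> j; rewrite /zhalf exprMn exprDn mulr_suml; apply: eq_bigr => i _.
  by rewrite expr1n mul1r -[_ *+ _]mulr_natr -[2^-1 ^+ _ *+ _]mulr_natr; ring.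
elim: a b => [|a IHa] b aL bL.
  rewrite binK0n (eq_avg L (g := fun j => conjc (zhalf L j ^+ b))).
    by rewrite avg_conj base // rmorphXn fmorphV rmorph_nat.
  by move=> j; rewrite expr0 mul1r rmorphXn.
elim: b bL => [|b IHb] bL.
  rewrite binKC binK0n -base //; apply: eq_avg => j.
  by rewrite expr0 mulr1.
rewrite binKSS -IHb ?(ltnW bL) // -IHa ?(ltnW aL) //.
rewrite /avg -mulrDr -big_split -mulrA mulr_suml; congr (_ * _).
apply: eq_bigr => j _; have := zhalf_circle (zroot_conj L j).
rewrite -/(zhalf L j); move: (zhalf L j) (conjc _) => z z' zz.
transitivity (z ^+ a * z' ^+ b * (2 * z * z') / 2); first by rewrite !exprS; field.
rewrite -zz -[X in _ = X / 2]/(z ^+ a.+1 * z' ^+ b + z ^+ a * z' ^+ b.+1) !exprS.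
by field.
Qed.

Lemma avg_Kp L (q r : {poly C}) : (size q <= L)%N -> (size r <= L)%N ->
  Kp q r = avg L (fun j => q.[zhalf L j] * r.[conjc (zhalf L j)]).
Proof.
move=> qL rL; rewrite (eq_avg L (g := fun j => \sum_(a < size q) \sum_(b < size r)
    (q`_a * r`_b) * (zhalf L j ^+ a * conjc (zhalf L j) ^+ b))).
  rewrite avg_sum; apply: eq_bigr => a _; rewrite avg_sum; apply: eq_bigr => b _.
  by rewrite avgZ avg_binK // ?(leq_trans (ltn_ord _)).
move=> j; rewrite !horner_coef mulr_suml; apply: eq_bigr => a _.
by rewrite mulr_sumr; apply: eq_bigr => b _; ring.
Qed.

End ComplexModulus.

(** * Estimates *)

Section TruncApprox.
Variable A : comNzRingType.

Definition approx n (f : fps A) (q : {poly A}) := forall i, (i <= n)%N -> q`_i = f i.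

Lemma approxM n f g q r : approx n f q -> approx n g r -> approx n (f * g) (q * r).
Proof.
move=> fq gr i i_n; apply: fps_mul_poly => j ji; [apply: fq|apply: gr];
  exact: leq_trans ji i_n.
Qed.

Lemma approxX n f q m : approx n f q -> approx n (f ^+ m) (q ^+ m).
Proof.
move=> fq; elim: m => [|m IH]; last by rewrite !exprS; apply: approxM.
by move=> i _; rewrite !expr0 coef1.
Qed.

Lemma approx_trunc n N f : (n <= N)%N -> approx n f (fps_trunc N f).
Proof. by move=> nN i i_n; rewrite fps_truncE // (leq_trans i_n). Qed.

End TruncApprox.

Lemma le_of_eq (R : numDomainType) (x y : R) : x = y -> x <= y.
Proof. by move=> ->. Qed.

Section Triangle.
Variable V : zmodType.

Lemma triangle_sum (B : nat -> nat -> V) N :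
  \sum_(n < N.+1) \sum_(i < n.+1) B i (n - i)%N =
  \sum_(i < N.+1) \sum_(k < N.+1 | (i + k <= N)%N) B i k.
Proof.
transitivity (\sum_(i < N.+1) \sum_(k < (N - i).+1) B i k); last first.
  apply: eq_bigr => i _; rewrite (big_ord_widen N.+1 (fun k => B i k)).
    by apply: eq_bigl => k; move: (ltn_ord i); lia.
  by rewrite ltnS leq_subr.
elim: N => [|N IH]; first by rewrite !big_ord1.
rewrite big_ord_recr IH [RHS]big_ord_recr /= subnn big_ord1.
rewrite [X in _ + X]big_ord_recr /= subnn addrA -big_split /=; congr (_ + _).
apply: eq_bigr => i _; rewrite subSn; last by rewrite -ltnS ltn_ord.
by rewrite [RHS]big_ord_recr.
Qed.

(** The product of two partial sums is a partial sum of the Cauchy product and a corner; the corner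
    is the error term of the later approximations. *)
Lemma square_sum (B : nat -> nat -> V) N :
  \sum_(i < N.+1) \sum_(k < N.+1) B i k =
  \sum_(n < N.+1) \sum_(i < n.+1) B i (n - i)%N +
  \sum_(i < N.+1) \sum_(k < N.+1 | (N < i + k)%N) B i k.
Proof.
rewrite triangle_sum -big_split; apply: eq_bigr => i _ /=.
rewrite (bigID (fun k : 'I_N.+1 => (i + k <= N)%N)) /=; congr (_ + _).
by apply: eq_bigl => k; rewrite ltnNge.
Qed.

End Triangle.

Lemma square_le_triangle (R : realDomainType) (B : nat -> nat -> R) M : (forall i k, 0 <= B i k) ->
  \sum_(i < M.+1) \sum_(k < M.+1) B i k <=
  \sum_(n < (M + M).+1) \sum_(i < n.+1) B i (n - i)%N.
Proof.
move=> B0; rewrite triangle_sum.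
have MM : (M.+1 <= (M + M).+1)%N by rewrite ltnS leq_addr.
rewrite (big_ord_widen _ (fun i => \sum_(k < M.+1) B i k) MM) big_mkcond /=.
apply: ler_sum => i _; case: ifP => iM; last exact: sumr_ge0.
rewrite (big_ord_widen _ (fun k => B i k) MM).
rewrite big_mkcond [leRHS]big_mkcond /=; apply: ler_sum => k _.
case: ifP => kM; first by rewrite ifT //; move: iM kM; lia.
by case: ifP.
Qed.

Section Estimates.
Variables (R : realType) (p : R).
Local Notation C := R[i].
Local Notation CC := (R[i] : numFieldType).
Local Notation toC := (real_complex R).

Definition ravg (L : nat) (f : nat -> R) : R := L%:R^-1 * \sum_(j < L) f j.

Lemma cabs_avg L (f : nat -> C) : cabs (avg L f) <= ravg L (fun j => cabs (f j)).
Proof.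
rewrite /avg cabsM cabsV -(rmorph_nat toC) cabs_real ger0_norm ?ler0n //.
by rewrite ler_wpM2l ?invr_ge0 ?ler0n // cabs_sum.
Qed.

Lemma ler_ravg L f g : (forall j, (j < L)%N -> f j <= g j) -> ravg L f <= ravg L g.
Proof.
move=> fg; rewrite ler_wpM2l ?invr_ge0 ?ler0n // ler_sum // => j _.
exact: fg.
Qed.

Lemma nonneg_poly_horner1 (q : {poly C}) : (forall a, 0 <= q`_a) ->
  q.[1] = toC (Re q.[1]) /\ 0 <= Re q.[1].
Proof.
move=> q0; have q1 : 0 <= q.[1].
  by rewrite horner_coef sumr_ge0 // => i _; rewrite expr1n mulr1.
have e : q.[1] = toC (Re q.[1]) by rewrite RRe_real // ger0_real.
by split => //; rewrite -ler0c -e.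
Qed.

Lemma nonneg_poly_cabs (q : {poly C}) z : (forall a, 0 <= q`_a) -> cabs z <= 1 ->
  cabs q.[z] <= Re q.[1].
Proof.
move=> q0 z1; rewrite -lecR -(nonneg_poly_horner1 q0).1 cabsE !horner_coef.
apply: le_trans (ler_norm_sum _ _ _) _; apply: ler_sum => i _.
rewrite normrM normrX ger0_norm // expr1n ler_wpM2l // exprn_ile1 //.
by rewrite -cabsE -(rmorph1 toC) lecR.
Qed.

Lemma conj_horner_nonneg (q : {poly C}) z : (forall a, 0 <= q`_a) ->
  q.[conjc z] = conjc q.[z].
Proof.
move=> q0; rewrite !horner_coef rmorph_sum; apply: eq_bigr => i _.
have e : q`_i = toC (Re q`_i) by rewrite RRe_real // ger0_real.
by rewrite rmorphM rmorphXn; congr (_ * _); rewrite e; exact/esym/conjc_real.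
Qed.

(** * The passage series and its length law *)

Hypotheses (hp0 : 0 < p) (hp1 : p < 1 / 2).

Let p0 : 0 <= p. Proof. exact: ltW. Qed.
Let p1 : p <= 1. Proof. by move: hp1; lra. Qed.

Local Notation D0 := (fun l m => debtC p l 0 m).
Definition passC : fps {poly CC} := passS (toC p : CC) D0.
Definition retC : fps {poly CC} := step_gf (toC p : CC) D0 passC.

Lemma passC0 : passC 0%N = 0. Proof. exact: pass0. Qed.
Lemma passCS n : passC n.+1 = 'X * retC n. Proof. exact: passSE. Qed.

Lemma nonneg_passC : nonneg_fps passC.
Proof. by apply: nonneg_pass; [exact: toC_p0|exact: toC_p1|move=> l m; exact: debtC_ge0]. Qed.

Lemma nonneg_retC : nonneg_fps retC.
Proof.
by apply: nonneg_step; [exact: toC_p0|exact: toC_p1|move=> l m; exact: debtC_ge0|exact: nonneg_passC].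
Qed.

(** The law of the length of a passage. By [massS] it is, for every p, the law of the first passage
    of a simple random walk to a neighbouring site. *)
Definition mass n : R := Re (passC n).[1].

Lemma mass_ge0 n : 0 <= mass n.
Proof. exact: (nonneg_poly_horner1 (nonneg_passC n).2).2. Qed.

Lemma passC1 n : (passC n).[1] = toC (mass n).
Proof. exact: (nonneg_poly_horner1 (nonneg_passC n).2).1. Qed.

Lemma retC_mass n : Re (retC n).[1] = mass n.+1.
Proof. by rewrite /mass passCS hornerM hornerX mul1r. Qed.

Lemma passC_cabs n z : cabs z <= 1 -> cabs (passC n).[z] <= mass n.
Proof. exact: nonneg_poly_cabs (nonneg_passC n).2. Qed.

Lemma retC_sum z z' n : z + z' = 2 * z * z' ->
  (retC n).[z] + (retC n).[z'] = (n == 0%N)%:R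
  + (1 - toC p) / 2 * \sum_(i < n.+1) ((passC i).[z] * (passC (n - i)%N).[z]
                                   + (passC i).[z'] * (passC (n - i)%N).[z'])
  + toC p * \sum_(i < n.+1) (passC i).[z'] * (passC (n - i)%N).[z].
Proof.
by apply: step_sum; [exact: debtC0|exact: debtCS].
Qed.

(** At z = z' = 1 the weights 1 - p and p in [retC_sum] multiply the same convolution and add up to
    1. *)
Lemma massS n :
  mass n.+1 = ((n == 0%N)%:R + \sum_(i < n.+1) mass i * mass (n - i)%N) / 2.
Proof.
have E : (1 : C) + 1 = 2 * 1 * 1 by ring.
have := retC_sum n E.
have -> : (retC n).[1] = toC (mass n.+1).
  by rewrite -retC_mass; exact: (nonneg_poly_horner1 (nonneg_retC n).2).1.
have s1 : \sum_(i < n.+1) (passC i).[1] * (passC (n - i)%N).[1] =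
    toC (\sum_(i < n.+1) mass i * mass (n - i)%N).
  by rewrite rmorph_sum; apply: eq_bigr => i _; rewrite rmorphM !passC1.
rewrite big_split /= s1; move: (\sum_(i < n.+1) _) => s {s1} h.
apply: complexI; have := congr1 (fun x => x / 2) h.
rewrite rmorphM rmorphD fmorphV !rmorph_nat => {}h.
by transitivity ((toC (mass n.+1) + toC (mass n.+1)) / 2);
  [field|rewrite h; field].
Qed.

Lemma mass0 : mass 0 = 0. Proof. by rewrite /mass passC0 horner0. Qed.

Definition smass N : R := \sum_(n < N.+1) mass n.

Lemma smassS N : smass N.+1 = \sum_(n < N.+1) mass n.+1.
Proof. by rewrite /smass big_ord_recl mass0 add0r. Qed.

Lemma smass_ge0 N : 0 <= smass N.
Proof. by apply: sumr_ge0 => n _; exact: mass_ge0. Qed.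

Lemma smass_le m n : (m <= n)%N -> smass m <= smass n.
Proof.
move=> mn; rewrite /smass (big_ord_widen n.+1 (fun i => mass i)) //.
by rewrite big_mkcond /= ler_sum // => i _; case: ifP => // _; exact: mass_ge0.
Qed.

(** Up to a nonnegative corner, the partial sums follow s -> (1 + s^2) / 2, which preserves s <=
    1. *)
Lemma smass_le1 N : smass N <= 1.
Proof.
elim: N => [|N IH]; first by rewrite /smass big_ord1 mass0.
rewrite /smass big_ord_recl mass0 add0r.
have -> : \sum_(i < N.+1) mass (lift ord0 i) =
    (1 + \sum_(n < N.+1) \sum_(i < n.+1) mass i * mass (n - i)%N) / 2.
  rewrite (eq_bigr (fun i : 'I_N.+1 => ((val i == 0%N)%:R +
      \sum_(j < i.+1) mass j * mass (i - j)%N) / 2)); last first.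
    by move=> i _; rewrite lift0 massS.
  rewrite -mulr_suml big_split /= big_ord_recl /= big1 ?addr0 //.
have : smass N * smass N = \sum_(i < N.+1) \sum_(k < N.+1) mass i * mass k.
  by rewrite /smass mulr_suml; apply: eq_bigr => i _; rewrite mulr_sumr.
rewrite (square_sum (fun i k => mass i * mass k)).
have : 0 <= \sum_(i < N.+1) \sum_(k < N.+1 | (N < i + k)%N) mass i * mass k.
  by apply: sumr_ge0 => i _; apply: sumr_ge0 => k _; rewrite mulr_ge0 ?mass_ge0.
have := smass_ge0 N; move: (\sum_(n < N.+1) _) (\sum_(i < N.+1) _) => a b.
by move: IH; nra.
Qed.

#[local] Hint Resolve mass_ge0 smass_ge0 smass_le1 : core.

Let o1 : cabs (1 : C) <= 1. Proof. by rewrite cabs1. Qed.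

Definition yN (N : nat) (z x : C) : C := \sum_(n < N.+1) (passC n).[z] * x ^+ n.

(** A passage makes at least one step, whence the factor z. *)
Lemma yN_le_z N z x : cabs z <= 1 -> cabs x <= 1 -> cabs (yN N z x) <= cabs z.
Proof.
move=> z1 x1; apply: le_trans (cabs_sum _ _ _) _.
apply: (@le_trans _ _ (cabs z * smass N)); last first.
  by rewrite ler_piMr ?cabs_ge0 ?smass_le1.
rewrite /smass mulr_sumr; apply: ler_sum => n _; rewrite cabsM cabsX.
apply: (@le_trans _ _ (cabs (passC n).[z])).
  by rewrite ler_piMr ?cabs_ge0 // exprn_ile1 ?cabs_ge0.
case: (val n) => [|k]; first by rewrite passC0 horner0 cabs0 mass0 mulr0.
rewrite passCS hornerM hornerX cabsM ler_wpM2l ?cabs_ge0 // -retC_mass.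
exact: nonneg_poly_cabs (nonneg_retC k).2 z1.
Qed.

Lemma yN_le1 N z x : cabs z <= 1 -> cabs x <= 1 -> cabs (yN N z x) <= 1.
Proof. by move=> z1 x1; exact: le_trans (yN_le_z N z1 x1) z1. Qed.

Lemma cabs2 : cabs (2 : C) = 2.
Proof. by rewrite -(rmorph_nat toC) cabs_real ger0_norm. Qed.

Definition nullC : fps {poly CC} := nullS (toC p : CC) D0.

Lemma nullCE n : nullC n = 2%:P * retC n.
Proof. exact: nullSE. Qed.

Lemma null_le2 N z x : cabs z <= 1 -> cabs x <= 1 ->
  cabs (\sum_(n < N.+1) (nullC n).[z] * x ^+ n) <= 2.
Proof.
move=> z1 x1; apply: le_trans (cabs_sum _ _ _) _.
apply: (@le_trans _ _ (2 * smass N.+1)); last first.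
  by rewrite -[leRHS]mulr1 ler_wpM2l // smass_le1.
rewrite smassS mulr_sumr; apply: ler_sum => n _.
rewrite cabsM cabsX nullCE hornerM hornerC cabsM cabs2.
rewrite -mulrA ler_wpM2l // -retC_mass.
apply: le_trans _ (nonneg_poly_cabs (nonneg_retC n).2 z1).
by rewrite ler_piMr ?cabs_ge0 // exprn_ile1 ?cabs_ge0.
Qed.

(** * Fourier bound on the stack weights *)

Definition half1 (w : C) : C := (1 + w) / 2.

Lemma cabs_half1 w : cabs w = 1 -> cabs (half1 w) <= 1.
Proof.
move=> w1; rewrite cabsM cabsV cabs2 ler_pdivrMr // mul1r.
by apply: le_trans (cabsD _ _) _; rewrite cabs1 w1.
Qed.

Lemma cabs_zhalf L j : cabs (zhalf R L j) <= 1.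
Proof. exact: cabs_half1 (cabs_zroot R L j). Qed.

Local Notation ev z := (fps_map (horner_eval z)).

(** The constant is 2 * 2, from the two factors [nullC]. The threshold L0 lies above the degrees in
    x of the truncated products, so that [avg_coef] extracts the coefficient of x^n. *)
Lemma stackW_le N n h k L : (n <= N)%N -> (N < L)%N ->
  exists L0, forall L', (L0 <= L')%N ->
  stackW p n h k <= 4 * ravg L (fun j => ravg L' (fun l =>
    cabs (yN N (zhalf R L j) (zroot R L' l)) ^+ h *
    cabs (yN N (conjc (zhalf R L j)) (zroot R L' l)) ^+ k)).
Proof.
move=> nN NL.
pose tr (f : fps {poly CC}) z := fps_trunc N (ev z f : fps C).
pose Q z : {poly C} := (tr nullC z * tr passC z ^+ h) *
  (tr nullC (conjc z) * tr passC (conjc z) ^+ k).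
have trE f z x : (tr f z).[x] = \sum_(i < N.+1) (f i).[z] * x ^+ i.
  by rewrite /tr /fps_trunc horner_poly.
exists (maxn n.+1 (\max_(j < L) size (Q (zhalf R L j)))) => L' L0L'.
have sE : stackC p n h k = avg L (fun j => (Q (zhalf R L j))`_n).
  rewrite stackC_pair /pair.
  have hS m : nonneg_fps (stayS (toC p : CC) D0 m).
    apply: nonneg_fpsM; last by apply: nonneg_fpsX; exact: nonneg_passC.
    by apply: nonneg_null; [exact: toC_p0|exact: toC_p1|move=> l m'; exact: debtC_ge0].
  have E (i : 'I_n.+1) : Kp (stayS (toC p : CC) D0 h i) (stayS (toC p : CC) D0 k (n - i)%N)
      = avg L (fun j => (stayS (toC p : CC) D0 h i).[zhalf R L j] *
          (stayS (toC p : CC) D0 k (n - i)%N).[conjc (zhalf R L j)]).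
    apply: avg_Kp.
      by rewrite (leq_trans (hS _ _).1) // (leq_trans _ NL) // ltnS (leq_trans _ nN) // -ltnS.
    by rewrite (leq_trans (hS _ _).1) // (leq_trans _ NL) // ltnS (leq_trans _ nN) // leq_subr.
  rewrite (eq_bigr _ (fun i _ => E i)) -avg_sum; apply: eq_avg => j.
  set z := zhalf R L j.
  have ap f w : approx n (ev w f : fps C) (tr f w) by exact: approx_trunc.
  have apS m w : approx n (ev w (stayS (toC p : CC) D0 m) : fps C)
      (tr nullC w * tr passC w ^+ m).
    rewrite /stayS rmorphM rmorphXn; apply: approxM; first exact: (ap nullC).
    by apply: approxX; exact: (ap passC).
  by rewrite (approxM (apS h z) (apS k (conjc z)) (leqnn n)).
have sW : stackW p n h k = cabs (stackC p n h k).
  rewrite cabs_real ger0_norm //.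
  by apply: Ew_ge0 => [||x]; [exact: p0|exact: p1|exact: ler0n].
rewrite sW sE; apply: le_trans (cabs_avg _ _) _.
rewrite /ravg mulrCA ler_wpM2l ?invr_ge0 ?ler0n // mulr_sumr.
apply: ler_sum => j _; set z := zhalf R L j.
rewrite (@avg_coef R L'); first last.
- by rewrite (leq_trans _ L0L') // leq_max leqnn.
- rewrite (leq_trans _ L0L') // leq_max; apply/orP; right.
  exact: (leq_bigmax (F := fun j : 'I_L => size (Q (zhalf R L j))) j).
apply: le_trans (cabs_avg _ _) _.
rewrite /ravg mulrCA ler_wpM2l ?invr_ge0 ?ler0n // mulr_sumr.
apply: ler_sum => l _; rewrite cabsM cabsX cabs_conj cabs_zroot expr1n mul1r.
rewrite /Q !hornerM !horner_exp !cabsM !cabsX !trE -!/(yN _ _ _).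
have z1 : cabs z <= 1 by exact: cabs_zhalf.
have zc1 : cabs (conjc z) <= 1 by rewrite cabs_conj.
have x1 : cabs (zroot R L' l) <= 1 by rewrite cabs_zroot.
have g1 := null_le2 N z1 x1; have g2 := null_le2 N zc1 x1.
rewrite mulrACA ler_wpM2r ?mulr_ge0 ?exprn_ge0 ?cabs_ge0 //.
have -> : (4 : R) = 2 * 2 by ring.
by rewrite ler_pM ?cabs_ge0.
Qed.

Lemma unit_conj (w : C) : cabs w = 1 -> w * conjc w = 1.
Proof. by move=> w1; rewrite -toC_sqr_cabs w1 expr1n rmorph1. Qed.

Lemma half1_conj w : conjc (half1 w) = half1 (conjc w).
Proof. by rewrite /half1 rmorphM rmorphD rmorph1 fmorphV rmorph_nat. Qed.

(* With t = exp(i s) and w = exp(i r), the number t (half1 w)^a (half1 w^* )^b is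
   the mean of exp(i (s + r (A - B))) for independent binomial variables A and B;
   so this is an average of |cos x| <= (3 + cos (2 x)) / 4. *)
Lemma Re_half1_kernel (w t : C) a b : cabs w = 1 -> cabs t = 1 ->
  `|Re (t * half1 w ^+ a * half1 (conjc w) ^+ b)| <=
  (3 + Re (t ^+ 2 * half1 (w ^+ 2) ^+ a * half1 (conjc w ^+ 2) ^+ b)) / 4.
Proof.
have Rehalf (u v : C) : Re ((u + v) / 2) = (Re u + Re v) / 2.
  have -> : (u + v) / 2 = toC 2^-1 * (u + v) by rewrite fmorphV rmorph_nat mulrC.
  by rewrite Re_toCM ReD mulrC.
have step (u v u2 v2 : C) :
    `|Re u| <= (3 + Re u2) / 4 -> `|Re v| <= (3 + Re v2) / 4 ->
    `|Re ((u + v) / 2)| <= (3 + Re ((u2 + v2) / 2)) / 4.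
  move=> hu hv; rewrite !Rehalf normrM [`|2^-1|]ger0_norm ?invr_ge0 //.
  have := ler_normD (Re u) (Re v); lra.
move=> w1; elim: a t => [|a IHa] t t1; last first.
  have tw1 : cabs (t * w) = 1 by rewrite cabsM w1 t1 mulr1.
  have := step _ _ _ _ (IHa _ t1) (IHa _ tw1).
  rewrite [half1 w ^+ a.+1]exprS [half1 (w ^+ 2) ^+ a.+1]exprS.
  move: (half1 w ^+ a) (half1 (w ^+ 2) ^+ a) (half1 _ ^+ b) (half1 _ ^+ b).
  move=> P P2 Q Q2; congr (`|Re _| <= (3 + Re _) / 4); rewrite /half1; by field.
elim: b t t1 => [|b IHb] t t1; last first.
  have tw1 : cabs (t * conjc w) = 1 by rewrite cabsM cabs_conj w1 t1 mulr1.
  have := step _ _ _ _ (IHb _ t1) (IHb _ tw1).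
  rewrite [half1 _ ^+ b.+1]exprS [half1 (conjc w ^+ 2) ^+ b.+1]exprS !expr0 !mulr1.
  move: (half1 (conjc w) ^+ b) (half1 (conjc w ^+ 2) ^+ b).
  move=> Q Q2; congr (`|Re _| <= (3 + Re _) / 4); rewrite /half1; by field.
rewrite !expr0 !mulr1.
have : Re t ^+ 2 + Im t ^+ 2 = 1 by rewrite -sqr_cabs t1 expr1n.
have -> : Re (t ^+ 2) = Re t ^+ 2 - Im t ^+ 2 by rewrite expr2 ReM !expr2.
have : `|Re t| ^+ 2 = Re t ^+ 2 by rewrite real_normK ?num_real.
move: `|Re t| (Re t) (Im t) => x y z; nra.
Qed.

Lemma sqr_cabs_sum (I : finType) (k : I -> R) (f : I -> C) :
  cabs (\sum_i toC (k i) * f i) ^+ 2 =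
  \sum_i \sum_j k i * k j * Re (f i * conjc (f j)).
Proof.
have -> : cabs (\sum_i toC (k i) * f i) ^+ 2 =
    Re (toC (cabs (\sum_i toC (k i) * f i) ^+ 2)) by [].
have sumE : conjc (\sum_i toC (k i) * f i) = \sum_i toC (k i) * conjc (f i).
  rewrite rmorph_sum; apply: eq_bigr => i _; rewrite rmorphM; congr (_ * _).
  exact: conjc_real.
rewrite toC_sqr_cabs sumE mulr_suml Re_sum; apply: eq_bigr => i _.
rewrite mulr_sumr Re_sum; apply: eq_bigr => j _.
rewrite (_ : _ * _ = toC (k i * k j) * (f i * conjc (f j))) ?Re_toCM //.
by rewrite rmorphM; ring.
Qed.

Lemma yN_pairs N z x : yN N z x = \sum_(i : 'I_N.+1 * 'I_N.+1)
  toC (Re (passC i.1)`_(i.2)) * (z ^+ i.2 * x ^+ i.1).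
Proof.
rewrite /yN -(pair_bigA _ (fun n a : 'I_N.+1 =>
  toC (Re (passC n)`_a) * (z ^+ a * x ^+ n))) /=.
apply: eq_bigr => n _; rewrite (@horner_coef_wide _ N.+1); last first.
  by rewrite (leq_trans (nonneg_passC n).1).
rewrite mulr_suml; apply: eq_bigr => a _.
by rewrite RRe_real ?mulrA // ger0_real //; exact: (nonneg_passC n).2.
Qed.

Lemma smass_pairs N : smass N =
  \sum_(i : 'I_N.+1 * 'I_N.+1) Re (passC i.1)`_(i.2).
Proof.
apply: complexI; have -> : toC (smass N) = yN N 1 1.
  rewrite /smass /yN rmorph_sum; apply: eq_bigr => n _.
  by rewrite expr1n mulr1 passC1.
rewrite yN_pairs rmorph_sum; apply: eq_bigr => i _.
by rewrite !expr1n !mulr1.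
Qed.

(* Exchanging the two coordinates changes the sign of the exponent of w only,
   hence the sum of the two squares decouples w and x. *)
Lemma swap_bound N (w x : C) : cabs w = 1 -> cabs x = 1 ->
  cabs (yN N (half1 w) x) * cabs (yN N (half1 (conjc w)) x) <=
  1 - ((1 - cabs (yN N (half1 (w ^+ 2)) 1) ^+ 2)
       + (1 - cabs (yN N 1 (x ^+ 2)) ^+ 2)) / 8.
Proof.
move=> w1 x1; set u := cabs _; set v := cabs _.
set u2 := cabs (yN N _ 1); set t2 := cabs (yN N 1 _).
pose k (i : 'I_N.+1 * 'I_N.+1) := Re (passC i.1)`_(i.2).
have k0 i : 0 <= k i.
  have := (nonneg_passC i.1).2 i.2.
  by rewrite /k -ler0c RRe_real // ger0_real //; exact: (nonneg_passC i.1).2.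
have key : u ^+ 2 + v ^+ 2 <= 3 / 2 * smass N ^+ 2 + (u2 ^+ 2 + t2 ^+ 2) / 4.
  rewrite /u /v /u2 /t2 !yN_pairs !sqr_cabs_sum smass_pairs expr2 mulr_suml.
  rewrite mulr_sumr -!big_split mulr_suml -big_split; apply: ler_sum => i _.
  rewrite /= mulr_sumr mulr_sumr -!big_split mulr_suml -big_split.
  apply: ler_sum => j _; rewrite /= -!/(k _).
  set A := half1 w ^+ i.2 * half1 (conjc w) ^+ j.2.
  set B := x ^+ i.1 * conjc x ^+ j.1.
  have -> : Re (half1 w ^+ i.2 * x ^+ i.1 *
      conjc (half1 w ^+ j.2 * x ^+ j.1)) = Re A * Re B - Im A * Im B.
    rewrite -ReM /A /B -half1_conj conjcM !conjcX; congr Re; ring.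
  have -> : Re (half1 (conjc w) ^+ i.2 * x ^+ i.1 *
      conjc (half1 (conjc w) ^+ j.2 * x ^+ j.1)) = Re A * Re B + Im A * Im B.
    have -> : Re A * Re B + Im A * Im B = Re (conjc A * B).
      by rewrite ReM; case: (A) => a b /=; ring.
    rewrite /A /B !conjcM !conjcX -!half1_conj !conjcK; congr Re; ring.
  have hA := Re_half1_kernel i.2 j.2 w1 (cabs1 R).
  rewrite !mul1r expr1n mul1r -/A in hA.
  have -> : Re (half1 (w ^+ 2) ^+ i.2 * 1 ^+ i.1 *
      conjc (half1 (w ^+ 2) ^+ j.2 * 1 ^+ j.1)) =
      Re (half1 (w ^+ 2) ^+ i.2 * half1 (conjc w ^+ 2) ^+ j.2).
    by rewrite !expr1n !mulr1 conjcX half1_conj conjcX.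
  have xB : cabs B = 1 by rewrite /B cabsM !cabsX cabs_conj x1 !expr1n mulr1.
  have hB := @Re_half1_kernel w B 0 0 w1 xB.
  rewrite !expr0 !mulr1 in hB.
  have -> : Re (1 ^+ i.2 * (x ^+ 2) ^+ i.1 * conjc (1 ^+ j.2 * (x ^+ 2) ^+ j.1)) =
      Re (B ^+ 2).
    rewrite !expr1n !mul1r !conjcX /B [in RHS]exprMn -!exprM; congr Re.
    by rewrite [(2 * i.1)%N]mulnC [(2 * j.1)%N]mulnC.
  set A2 := Re (half1 (w ^+ 2) ^+ i.2 * _) in hA *; set B2 := Re (B ^+ 2) in hB *.
  have hA1 : `|Re A| <= 1.
    apply: le_trans (Re_le_cabs _) _; rewrite /A cabsM !cabsX -half1_conj cabs_conj.
    by rewrite mulr_ile1 ?exprn_ge0 ?cabs_ge0 // exprn_ile1 ?cabs_ge0 ?cabs_half1.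
  have hB1 : `|Re B| <= 1 by apply: le_trans (Re_le_cabs _) _; rewrite xB.
  have kk : 0 <= k i * k j by rewrite mulr_ge0.
  (* For a and b in [0, 1] one has 2 a b <= a + b, and [hA], [hB] bound the two summands. *)
  have AB : 2 * (Re A * Re B) <= 3 / 2 + (A2 + B2) / 4.
    have : Re A * Re B <= `|Re A| * `|Re B| by rewrite -normrM ler_norm.
    have : 0 <= `|Re A| * (1 - `|Re B|) by rewrite mulr_ge0 // subr_ge0.
    have : 0 <= `|Re B| * (1 - `|Re A|) by rewrite mulr_ge0 // subr_ge0.
    move: hA hB; move: `|Re A| `|Re B| (Re A * Re B) => a b c; lra.
  move: kk AB; move: (k i * k j) (Re A * Re B) (Im A * Im B) => c r s c0 rs.
  have := ler_wpM2l c0 rs; lra.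
(* As 2 u v <= u^2 + v^2, half of [key] bounds u v by 3 / 4 + (u2^2 + t2^2) / 8, which is the
   right-hand side. *)
have s1 : smass N ^+ 2 <= 1.
  by rewrite expr_le1 ?smass_le1 ?smass_ge0.
have := sqr_ge0 (u - v); rewrite sqrrB.
move: key; move: (u ^+ 2) (v ^+ 2) => uu vv; lra.
Qed.

(** * Total mass one and the limit of the truncated series *)

Lemma mass_square_le M :
  smass M ^+ 2 <= \sum_(n < (M + M).+1) \sum_(i < n.+1) mass i * mass (n - i)%N.
Proof.
have -> : smass M ^+ 2 = \sum_(i < M.+1) \sum_(k < M.+1) mass i * mass k.
  by rewrite expr2 mulr_suml; apply: eq_bigr => i _; rewrite mulr_sumr.
by apply: (square_le_triangle (B := fun i k => mass i * mass k)) => i k; rewrite mulr_ge0 ?mass_ge0.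
Qed.

Lemma smass_rec M : (1 + smass M ^+ 2) / 2 <= smass (M + M).+1.
Proof.
rewrite smassS // (eq_bigr (fun i : 'I_(M + M).+1 => ((val i == 0%N)%:R +
    \sum_(j < i.+1) mass j * mass (i - j)%N) / 2)); last first.
  by move=> i _; rewrite massS.
rewrite -mulr_suml big_split /= ler_pM2r ?invr_gt0 // lerD //.
  by rewrite big_ord_recl /= lerDl sumr_ge0.
exact: mass_square_le.
Qed.

(** The supremum l satisfies (1 + l^2) / 2 <= l, that is (1 - l)^2 <= 0: passages are almost surely
    finite. *)
Lemma smass_lim e : 0 < e -> exists N, forall M, (N <= M)%N -> 1 - smass M < e.
Proof.
move=> e0; pose E : set R := range smass.
have hE : has_sup E.
  by split; [exists (smass 0), 0%N|exists 1 => _ [n _ <-]; exact: smass_le1].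
set l := sup E.
have le_l n : smass n <= l by apply: ub_le_sup; [exact: hE.2|exists n].
have l0 : 0 <= l by exact: le_trans (smass_ge0 0%N) (le_l 0%N).
have l1 : l <= 1 by apply: ge_sup; [exact: hE.1|move=> _ [n _ <-]; exact: smass_le1].
have sl n : smass n ^+ 2 <= 2 * l - 1.
  by have := le_trans (smass_rec n) (le_l _); lra.
have l2 : l ^+ 2 <= 2 * l - 1.
  have h : 0 <= 2 * l - 1 by exact: le_trans (sqr_ge0 _) (sl 0%N).
  rewrite -(sqr_sqrtr h) ler_pXn2r ?nnegrE ?sqrtr_ge0 //.
  apply: ge_sup; [exact: hE.1|move=> _ [n _ <-]].
  by rewrite -(@ler_pXn2r _ 2) ?nnegrE ?sqrtr_ge0 ?smass_ge0 // sqr_sqrtr.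
have lE : l = 1 by apply/eqP; rewrite eq_le l1 /= -subr_le0; nra.
have [_ [N _ <-] hN] := sup_adherent e0 hE.
exists N => M NM; have := smass_le NM; move: hN; rewrite -/l lE; lra.
Qed.

Lemma yN_diff N M z x : (N <= M)%N -> cabs z <= 1 -> cabs x <= 1 ->
  cabs (yN M z x - yN N z x) <= smass M - smass N.
Proof.
move=> NM z1 x1.
have split_sum (V : zmodType) (F : nat -> V) : \sum_(n < M.+1) F n - \sum_(n < N.+1) F n =
    \sum_(N.+1 <= n < M.+1) F n.
  by rewrite -!(big_mkord xpredT) (@big_cat_nat _ _ _ N.+1 0%N M.+1) //= addrAC subrr add0r.
rewrite /yN /smass (split_sum _ (fun n => (passC n).[z] * x ^+ n)) split_sum.
apply: le_trans (cabs_sum _ _ _) _.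
apply: ler_sum => n _; rewrite cabsM cabsX.
apply: le_trans _ (passC_cabs n z1).
by rewrite ler_piMr ?cabs_ge0 // exprn_ile1 ?cabs_ge0.
Qed.

(* [u + smass] is nondecreasing, so that [sup] gives the limit. *)
Lemma mass_dominated_lim (u : nat -> R) :
  (forall N M, (N <= M)%N -> `|u M - u N| <= smass M - smass N) ->
  exists a, forall N, `|a - u N| <= 1 - smass N.
Proof.
move=> hu; pose E : set R := range (fun N => u N + smass N).
have ub N M : u M + smass M <= u N + 2 - smass N.
  have [NM|/ltnW MN] := leqP N M.
    by have := le_trans (ler_norm _) (hu _ _ NM); have := smass_le1 M; lra.
  have := hu _ _ MN; rewrite ler_norml => /andP[h _].
  by have := smass_le1 N; lra.
have hE : has_sup E.
  by split; [exists (u 0 + smass 0), 0%N|exists (u 0 + 2 - smass 0) => _ [M _ <-]].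
exists (sup E - 1) => N; rewrite ler_norml; apply/andP; split.
  have : u N + smass N <= sup E by apply: ub_le_sup; [exact: hE.2|exists N].
  lra.
have : sup E <= u N + 2 - smass N.
  by apply: ge_sup; [exact: hE.1|move=> _ [M _ <-]].
lra.
Qed.

Lemma yL_ex z x : cabs z <= 1 -> cabs x <= 1 ->
  exists y : C, forall N, cabs (y - yN N z x) <= 2 * (1 - smass N).
Proof.
move=> z1 x1.
have [a ha] : exists a, forall N, `|a - Re (yN N z x)| <= 1 - smass N.
  apply: mass_dominated_lim => N M NM; rewrite -ReN -ReD.
  exact: le_trans (Re_le_cabs _) (yN_diff NM z1 x1).
have [b hb] : exists b, forall N, `|b - Im (yN N z x)| <= 1 - smass N.
  apply: mass_dominated_lim => N M NM; rewrite -ImN -ImD.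
  exact: le_trans (Im_le_cabs _) (yN_diff NM z1 x1).
exists (Complex a b) => N; apply: le_trans (cabs_le_ReIm _) _.
by rewrite ReD ReN ImD ImN /= mulrDl mul1r lerD.
Qed.

(** The sum of the series, singled out by the rate at which [yN] approaches it; the default 0 does
    not occur for z and x in the closed unit disc. *)
Definition yL (z x : C) : C :=
  xget 0 [set y | forall N, cabs (y - yN N z x) <= 2 * (1 - smass N)].

Lemma yLP z x N : cabs z <= 1 -> cabs x <= 1 ->
  cabs (yL z x - yN N z x) <= 2 * (1 - smass N).
Proof.
move=> z1 x1; rewrite /yL; case: xgetP => [y _|none]; first exact.
by have [y hy] := yL_ex z1 x1; case: (none y).
Qed.

(** Turns identities that hold up to a truncation error into exact ones. *)
Lemma small_eq0 (a : C) (K : R) : 0 <= K ->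
  (forall N, cabs a <= K * (1 - smass N)) -> a = 0.
Proof.
move=> K0 ha; apply/eqP; rewrite -cabs_eq0 eq_le cabs_ge0 andbT.
apply/ler_addgt0Pl => e e0; rewrite addr0.
have K1 : 0 < K + 1 by lra.
have [N hN] := smass_lim (divr_gt0 e0 K1).
apply: le_trans (ha N) _; apply: (@le_trans _ _ ((K + 1) * (1 - smass N))).
  by rewrite ler_wpM2r ?subr_ge0 // lerDl.
by rewrite mulrC -ler_pdivlMr // ltW // hN.
Qed.

Lemma yL_unique z x y K : 0 <= K -> cabs z <= 1 -> cabs x <= 1 ->
  (forall N, cabs (y - yN N z x) <= K * (1 - smass N)) -> y = yL z x.
Proof.
move=> K0 z1 x1 hy; apply/eqP; rewrite -subr_eq0; apply/eqP.
apply: (@small_eq0 _ (K + 2)); first lra.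
move=> N; rewrite -[_ - _](subrKA (yN N z x)) mulrDl.
apply: le_trans (cabsD _ _) _; apply: lerD; first exact: hy.
by rewrite cabsB; exact: yLP.
Qed.

Lemma yL_le1 z x : cabs z <= 1 -> cabs x <= 1 -> cabs (yL z x) <= cabs z.
Proof.
move=> z1 x1; apply/ler_addgt0Pl => e e0.
have [N hN] := smass_lim (divr_gt0 e0 (ltr0n R 2)).
rewrite -[yL _ _](subrK (yN N z x)); apply: le_trans (cabsD _ _) _.
have := yLP N z1 x1; have := yN_le_z N z1 x1; have := hN N (leqnn _).
lra.
Qed.

(** * Functional equations of the limit *)

(** The triangle of side 2 M contains the square of side M, so the corner that it misses has mass at
    most 1 - smass M ^ 2. *)
Lemma tri_approx (B : nat -> nat -> C) M :
  (forall i k, cabs (B i k) <= mass i * mass k) ->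
  cabs (\sum_(i < (M + M).+1) \sum_(k < (M + M).+1) B i k -
        \sum_(n < (M + M).+1) \sum_(i < n.+1) B i (n - i)%N) <=
  2 * (1 - smass M).
Proof.
move=> hB; rewrite square_sum addrC addKr.
apply: le_trans (cabs_sum _ _ _) _.
apply: (@le_trans _ _ (\sum_(i < (M + M).+1)
    \sum_(k < (M + M).+1 | (M + M < i + k)%N) mass i * mass k)).
  apply: ler_sum => i _; apply: le_trans (cabs_sum _ _ _) _.
  exact: ler_sum.
have := mass_square_le M.
have : \sum_(i < (M + M).+1) \sum_(k < (M + M).+1) mass i * mass k <= 1.
  have -> : \sum_(i < (M + M).+1) \sum_(k < (M + M).+1) mass i * mass k =
      smass (M + M) * smass (M + M).
    by rewrite /smass mulr_suml; apply: eq_bigr => i _; rewrite mulr_sumr.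
  by rewrite mulr_ile1.
rewrite (square_sum (fun i k => mass i * mass k)).
have := sqr_ge0 (1 - smass M); rewrite sqrrB expr1n mul1r mulr2n.
move: (\sum_(n < _) _) (\sum_(i < _) _) => a b; lra.
Qed.

(** The constant is 2 + 2 + 2: two replacements of [yL] by [yN], and one corner. *)
Lemma prod_approx (z z' x x' : C) M :
  cabs z <= 1 -> cabs z' <= 1 -> cabs x <= 1 -> cabs x' <= 1 ->
  cabs (yL z x * yL z' x' - \sum_(n < (M + M).+1) \sum_(i < n.+1)
    ((passC i).[z] * x ^+ i) * ((passC (n - i)%N).[z'] * x' ^+ (n - i)))
  <= 6 * (1 - smass M).
Proof.
move=> z1 z1' x1 x1'; set T := \sum_(n < _) _.
have hT : cabs (yN (M + M) z x * yN (M + M) z' x' - T) <= 2 * (1 - smass M).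
  have -> : yN (M + M) z x * yN (M + M) z' x' = \sum_(i < (M + M).+1)
      \sum_(k < (M + M).+1) ((passC i).[z] * x ^+ i) * ((passC k).[z'] * x' ^+ k).
    by rewrite /yN mulr_suml; apply: eq_bigr => i _; rewrite mulr_sumr.
  apply: (tri_approx M
    (B := fun i k => (passC i).[z] * x ^+ i * ((passC k).[z'] * x' ^+ k))) => i k.
  rewrite !cabsM !cabsX ler_pM ?mulr_ge0 ?exprn_ge0 ?cabs_ge0 //.
    apply: le_trans _ (passC_cabs i z1).
    by rewrite ler_piMr ?cabs_ge0 // exprn_ile1 ?cabs_ge0.
  apply: le_trans _ (passC_cabs k z1').
  by rewrite ler_piMr ?cabs_ge0 // exprn_ile1 ?cabs_ge0.
have sM : 1 - smass (M + M) <= 1 - smass M by rewrite lerB // smass_le // leq_addr.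
have h1 := yLP (M + M) z1 x1; have h2 := yLP (M + M) z1' x1'.
have n1 : cabs (yL z x) <= 1 := le_trans (yL_le1 z1 x1) z1.
have n2 := yN_le1 (M + M) z1' x1'.
set a := yL z x in h1 n1 *; set b := yL z' x' in h2 *.
set a' := yN _ z x in h1 hT; set b' := yN _ z' x' in h2 hT n2.
have -> : a * b - T = a * (b - b') + ((a - a') * b' + (a' * b' - T)) by ring.
apply: le_trans (cabsD _ _) _.
have e1 : cabs (a * (b - b')) <= cabs (b - b').
  by rewrite cabsM ler_piMl ?cabs_ge0.
have e2 : cabs ((a - a') * b') <= cabs (a - a').
  by rewrite cabsM ler_piMr ?cabs_ge0.
have e3 := cabsD ((a - a') * b') (a' * b' - T).
by lra.
Qed.

Lemma yL_quad (x : C) : cabs x <= 1 -> 2 * yL 1 x = x * (1 + yL 1 x ^+ 2).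
Proof.
move=> x1.
apply/eqP; rewrite -subr_eq0; apply/eqP.
(* 10 = 2 * 2 + 6: twice the error of [yLP], and that of [prod_approx]. *)
apply: (@small_eq0 _ 10) => // M.
have h1 := yLP (M + M).+1 o1 x1.
have h2 := prod_approx M o1 o1 x1 x1; rewrite -expr2 in h2.
set T := \sum_(n < _) _ in h2.
have E : 2 * yN (M + M).+1 1 x = x * (1 + T).
  rewrite /yN big_ord_recl passC0 horner0 mul0r add0r.
  have -> : \sum_(i < (M + M).+1) (passC (lift ord0 i)).[1] * x ^+ lift ord0 i =
      \sum_(i < (M + M).+1) x / 2 * ((val i == 0%N)%:R * x ^+ i +
        \sum_(j < i.+1) ((passC j).[1] * x ^+ j) *
           ((passC (i - j)%N).[1] * x ^+ (i - j))).
    apply: eq_bigr => n _; rewrite lift0 passC1 // massS //.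
    rewrite rmorphM rmorphD fmorphV !rmorph_nat exprS rmorph_sum.
    have -> : \sum_(j < n.+1) ((passC j).[1] * x ^+ j) *
         ((passC (n - j)%N).[1] * x ^+ (n - j)) =
         (\sum_(j < n.+1) toC (mass j * mass (n - j)%N)) * x ^+ n.
      rewrite mulr_suml; apply: eq_bigr => j _; rewrite !passC1 // rmorphM.
      have -> : x ^+ n = x ^+ j * x ^+ (n - j).
        by rewrite -exprD subnKC // -ltnS.
      by rewrite mulrACA.
    by field.
  rewrite -mulr_sumr big_split -/T.
  have -> : \sum_(i < (M + M).+1) (val i == 0%N)%:R * x ^+ i = 1 :> C.
    rewrite big_ord_recl big1 => [|i _]; last by rewrite lift0 mul0r.
    by rewrite -[LHS]/(_ + _) addr0 mul1r expr0.
  by rewrite -[X in 2 * (_ * X)]/(_ + _); field.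
have sM : 1 - smass (M + M).+1 <= 1 - smass M.
  by rewrite lerB // smass_le // ltnW // ltnS leq_addr.
set y := yL 1 x in h1 h2 *; set y' := yN _ 1 x in h1 E.
have -> : 2 * y - x * (1 + y ^+ 2) = 2 * (y - y') + (- x) * (y ^+ 2 - T).
  by transitivity (2 * y - 2 * y' + x * (1 + T) - x * (1 + y ^+ 2)); [rewrite E|]; ring.
apply: le_trans (cabsD _ _) _; rewrite !cabsM cabsN cabs2.
have : cabs x * cabs (y ^+ 2 - T) <= cabs (y ^+ 2 - T) by rewrite ler_piMl ?cabs_ge0.
by lra.
Qed.

Lemma yN_conj N z : yN N (conjc z) 1 = conjc (yN N z 1).
Proof.
rewrite /yN rmorph_sum; apply: eq_bigr => n _.
rewrite !expr1n !mulr1; apply: conj_horner_nonneg.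
exact: (nonneg_passC n).2.
Qed.

Lemma yL_conj z : cabs z <= 1 -> yL (conjc z) 1 = conjc (yL z 1).
Proof.
move=> z1.
apply/esym; apply: (@yL_unique _ _ _ 2); rewrite ?cabs_conj // => N.
rewrite yN_conj; have -> : conjc (yL z 1) - conjc (yN N z 1) = conjc (yL z 1 - yN N z 1).
  by rewrite rmorphB.
by rewrite cabs_conj; exact: yLP.
Qed.

Lemma yL11 : yL 1 1 = 1.
Proof.
apply/esym; apply: (@yL_unique _ _ _ 1) => // N.
have -> : yN N 1 1 = toC (smass N).
  rewrite /yN /smass rmorph_sum; apply: eq_bigr => n _.
  by rewrite expr1n mulr1 passC1.
rewrite -(rmorph1 toC) -rmorphB cabs_real mul1r ger0_norm //.
by rewrite subr_ge0.
Qed.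

(** The sum over all lengths of [retC_sum] at z and its conjugate: dividing by z undoes the factor
    'X between [passC] and [retC]. *)
Lemma yL_circle (z : C) : z != 0 -> cabs z <= 1 -> z + conjc z = 2 * z * conjc z ->
  let y := yL z 1 in
  y / z + conjc y / conjc z = 1 + (1 - toC p) / 2 * (y ^+ 2 + conjc y ^+ 2)
    + toC p * (conjc y * y).
Proof.
move=> z0 z1 zz y.
have zc1 : cabs (conjc z) <= 1 by rewrite cabs_conj.
have zc0 : conjc z != 0 by rewrite conjc_eq0.
have yE : yL (conjc z) 1 = conjc y by exact: yL_conj.
apply/eqP; rewrite -subr_eq0; apply/eqP.
have iz0 : 0 <= (cabs z)^-1 by rewrite invr_ge0 cabs_ge0.
(* Each of the two quotients costs 2 / |z|, and the quadratic terms cost at most 12. *)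
apply: (@small_eq0 _ (4 * (cabs z)^-1 + 12)); first by lra.
move=> M.
pose T (u v : C) : C := \sum_(n < (M + M).+1) \sum_(i < n.+1)
   (passC i).[u] * (passC (n - i)%N).[v].
have hT u v : cabs u <= 1 -> cabs v <= 1 ->
    cabs (yL u 1 * yL v 1 - T u v) <= 6 * (1 - smass M).
  move=> u1 v1; have := prod_approx M u1 v1 o1 o1.
  congr (cabs (_ - _) <= _); apply: eq_bigr => n _; apply: eq_bigr => i _.
  by rewrite !expr1n !mulr1.
have h1 := hT _ _ z1 z1; have h2 := hT _ _ zc1 zc1; have h3 := hT _ _ zc1 z1.
rewrite yE -expr2 in h2; rewrite yE in h3; rewrite -expr2 in h1.
have retE u : u != 0 -> \sum_(n < (M + M).+1) (retC n).[u] = yN (M + M).+1 u 1 / u.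
  move=> u0; rewrite /yN [in RHS]big_ord_recl passC0 horner0 mul0r add0r mulr_suml.
  apply: eq_bigr => n _; rewrite lift0 passCS hornerM hornerX expr1n mulr1.
  by rewrite mulrAC divff ?mul1r.
have E : yN (M + M).+1 z 1 / z + yN (M + M).+1 (conjc z) 1 / conjc z =
    1 + (1 - toC p) / 2 * (T z z + T (conjc z) (conjc z)) + toC p * T (conjc z) z.
  rewrite -!retE // -big_split.
  rewrite (eq_bigr _ (fun (n : 'I_(M + M).+1) _ => retC_sum n zz)).
  rewrite !big_split /= -!mulr_sumr big_ord_recl /= big1 ?addr0 //.
  congr (_ + _ * _ + _); rewrite /T -big_split; apply: eq_bigr => n _.
  by rewrite big_split.
have sM : 1 - smass (M + M).+1 <= 1 - smass M.
  by rewrite lerB // smass_le // ltnW // ltnS leq_addr.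
have g1 := yLP (M + M).+1 z1 o1; have g2 := yLP (M + M).+1 zc1 o1.
rewrite yE in g2; rewrite -/y in g1 h1 h3.
move: E g1 g2; set a := yN _ z 1; set b := yN _ (conjc z) 1 => E g1 g2.
have -> : y / z + conjc y / conjc z - (1 + (1 - toC p) / 2 * (y ^+ 2 + conjc y ^+ 2)
    + toC p * (conjc y * y)) =
  ((y - a) / z + (conjc y - b) / conjc z) +
  (- ((1 - toC p) / 2) * ((y ^+ 2 - T z z) + (conjc y ^+ 2 - T (conjc z) (conjc z)))
  + - toC p * (conjc y * y - T (conjc z) z)).
  transitivity (y / z + conjc y / conjc z - (1 + (1 - toC p) / 2 * (y ^+ 2 + conjc y ^+ 2)
    + toC p * (conjc y * y)) - (a / z + b / conjc z) + (a / z + b / conjc z)).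
    by rewrite subrK.
  rewrite {2}E; move: (T z z) (T _ _) (T _ _) (z^-1) ((conjc z)^-1) => t1 t2 t3 iz ic.
  by ring.
apply: le_trans (cabsD _ _) _; rewrite [leRHS]mulrDl; apply: lerD.
  apply: le_trans (cabsD _ _) _; rewrite !cabsM !cabsV cabs_conj.
  have := ler_wpM2r iz0 g1; have := ler_wpM2r iz0 g2; have := ler_wpM2r iz0 sM.
  by lra.
apply: le_trans (cabsD _ _) _; rewrite !cabsM !cabsN !cabs_real.
have -> : (1 - toC p) / 2 = toC ((1 - p) / 2).
  by rewrite rmorphM rmorphB rmorph1 fmorphV rmorph_nat.
have hp : 0 <= (1 - p) / 2 by move: hp1; lra.
rewrite cabs_real (ger0_norm hp) (ger0_norm (ltW hp0)).
have h4 := cabsD (y ^+ 2 - T z z) (conjc y ^+ 2 - T (conjc z) (conjc z)).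
have h5 : (1 - p) / 2 * cabs (y ^+ 2 - T z z + (conjc y ^+ 2 - T (conjc z) (conjc z)))
    <= (1 - p) / 2 * (12 * (1 - smass M)) by rewrite ler_wpM2l //; lra.
have h6 : p * cabs (conjc y * y - T (conjc z) z) <= p * (6 * (1 - smass M)).
  by rewrite ler_wpM2l // ltW.
have := smass_le1 M; by lra.
Qed.

(* Squaring the real and imaginary parts of 2 Y = x (1 + Y^2) gives
   (1 - r)^2 = 4 r |Im x| for r = |Y|^2. *)
Lemma yL_gap (x : C) : cabs x = 1 ->
  9 / 16 * `|Im x| <= (1 - cabs (yL 1 x) ^+ 2) ^+ 2.
Proof.
move=> x1; have xle : cabs x <= 1 by rewrite x1.
have Q := yL_quad xle; have y1 := yL_le1 o1 xle.
rewrite cabs1 in y1; set Y := yL 1 x in Q y1 *.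
have xc := unit_conj x1.
have E : 2 * (Y * conjc Y) * conjc x = conjc Y + (Y * conjc Y) * Y.
  transitivity (conjc Y * conjc x * (2 * Y)); first by ring.
  rewrite Q; transitivity (conjc Y * (x * conjc x) * (1 + Y ^+ 2)); first by ring.
  by rewrite xc; ring.
have Y0 : Y != 0.
  apply/eqP => Y0; move: Q; rewrite Y0 mulr0 expr0n addr0 mulr1 => x0.
  by move: x1; rewrite -x0 cabs0 => /eqP; rewrite eq_sym oner_eq0.
have := sqr_cabs x; rewrite x1 expr1n => Ex.
have r0 : 0 < cabs Y ^+ 2 by rewrite exprn_gt0 // lt_neqAle cabs_ge0 eq_sym cabs_eq0 Y0.
have := sqr_cabs Y; rewrite -toC_sqr_cabs in E.
move: E Ex r0; have : cabs Y ^+ 2 <= 1 by rewrite exprn_ile1 ?cabs_ge0.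
move: (cabs Y ^+ 2) => r; case: (Y) => a b; case: (x) => c s.
rewrite /= => r1 [] E1 E2 Ex r0 Er.
have F1 : 2 * r * c = a * (1 + r) by move: E1; lra.
have F2 : 2 * r * s = b * (1 - r) by move: E2; lra.
have G : ((1 - r) ^+ 2) ^+ 2 = (4 * r * `|s|) ^+ 2.
  have r2 : r ^+ 1 != 0 by rewrite expr1 gt_eqF.
  have -> : (4 * r * `|s|) ^+ 2 = 16 * r ^+ 2 * s ^+ 2.
    by rewrite -(real_normK (num_real s)); ring.
  apply: (mulfI r2); rewrite expr1.
  have K1 : r * ((1 - r) * (1 + r)) ^+ 2 =
     (2 * r * c) ^+ 2 * (1 - r) ^+ 2 + (2 * r * s) ^+ 2 * (1 + r) ^+ 2.
    by rewrite F1 F2 Er; ring.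
  have K2 : c ^+ 2 = 1 - s ^+ 2 by rewrite Ex; ring.
  transitivity (r * ((1 - r) * (1 + r)) ^+ 2 - 4 * r ^+ 2 * (1 - r) ^+ 2).
    by ring.
  rewrite K1; transitivity (4 * r ^+ 2 * c ^+ 2 * (1 - r) ^+ 2 +
    4 * r ^+ 2 * s ^+ 2 * (1 + r) ^+ 2 - 4 * r ^+ 2 * (1 - r) ^+ 2); first by ring.
  by rewrite K2; ring.
have {G} G : (1 - r) ^+ 2 = 4 * r * `|s|.
  apply/eqP; rewrite -(eqrXn2 (n := 2)) ?G ?sqr_ge0 //.
  by rewrite !mulr_ge0 // ltW.
have s0 := normr_ge0 s; have s1 : `|s| <= 1.
  by rewrite -(ler_sqr s0) ?nnegrE // expr1n real_normK ?num_real // Ex lerDr sqr_ge0.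
(* For r >= 1 / 4 the factor 4 r is at least 1; otherwise (1 - r)^2 >= 9 / 16 already. *)
have [r4|r4] := lerP (1 / 4) r.
  rewrite G; nra.
nra.
Qed.

(** At this x the distance of y(1, x) to 1 has order 1 / k, the scale on which [zgap] resolves |1 -
    y|. *)
Definition damping k : R := k%:R ^+ 2 / (k%:R ^+ 2 + 1).

(* With Y the value at the damped point, (1 - Y)^2 = 2 Y (r^-1 - 1) = 2 Y / k^2. *)
Lemma yN_damped N z k (r := damping k) : (0 < k)%N -> cabs z <= 1 ->
  cabs (1 - yN N z (toC r)) <= cabs (1 - yL z 1) + 2 / k%:R + 4 * (1 - smass N).
Proof.
have arith (a1 a2 a3 a4 a5 e q s : R) : a1 <= a4 + a5 -> a4 <= a2 + a3 ->
    a3 <= 2 * (1 - s) -> a5 <= s - q -> 1 - q <= e + 2 * (1 - s) -> s <= 1 ->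
    a1 <= a2 + e + 4 * (1 - s) by lra.
move=> k0 z1.
have k1 : 0 < k%:R :> R by rewrite ltr0n.
have k2 : 0 < k%:R ^+ 2 :> R by rewrite exprn_gt0.
have r0 : 0 < r by rewrite divr_gt0 // addr_gt0.
have r1 : r <= 1 by rewrite ler_pdivrMr ?addr_gt0 // mul1r lerDl.
have x1 : cabs (toC r) <= 1 by rewrite cabs_real ger0_norm // ltW.
have Q := yL_quad x1; have y1 := yL_le1 o1 x1.
have yl := yLP N o1 x1.
rewrite cabs1 in y1; set Y := yL 1 (toC r) in Q y1 yl.
have E : (1 - Y) ^+ 2 = 2 * Y * toC (r^-1 - 1).
  rewrite rmorphB fmorphV rmorph1.
  have rC : toC r != 0 by rewrite (fmorph_eq0 toC) gt_eqF.
  apply: (mulfI rC); transitivity (toC r * (1 + Y ^+ 2) - toC r * 2 * Y); first by ring.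
  by rewrite -Q; field.
have hY : cabs (1 - Y) <= 2 / k%:R.
  rewrite -ler_sqr ?nnegrE ?cabs_ge0 ?divr_ge0 // -cabsX E !cabsM cabs2 cabs_real.
  have -> : r^-1 - 1 = (k%:R ^+ 2)^-1 by rewrite /r /damping; field; rewrite ?gt_eqF // addr_gt0.
  have i0 : 0 <= (k%:R ^+ 2)^-1 :> R by rewrite invr_ge0 ltW.
  by rewrite ger0_norm // expr_div_n ler_wpM2r // -natrX; move: y1 (cabs_ge0 Y); lra.
(* Coefficient by coefficient, damping costs at z at most what it costs at 1. *)
have d1 : cabs (yN N z 1 - yN N z (toC r)) <= smass N - Re (yN N 1 (toC r)).
  rewrite /yN /smass -sumrB Re_sum -sumrB; apply: le_trans (cabs_sum _ _ _) _.
  apply: ler_sum => n _.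
  have -> : (passC n).[z] * 1 ^+ n - (passC n).[z] * toC r ^+ n =
     (passC n).[z] * toC (1 - r ^+ n).
    by rewrite rmorphB rmorph1 rmorphXn expr1n mulr1 mulrBr mulr1.
  have -> : Re ((passC n).[1] * toC r ^+ n) = mass n * r ^+ n.
    by rewrite passC1 // -rmorphXn -rmorphM.
  rewrite cabsM cabs_real ger0_norm ?subr_ge0 ?exprn_ile1 ?(ltW r0) //.
  have -> : mass n - mass n * r ^+ n = mass n * (1 - r ^+ n) by rewrite mulrBr mulr1.
  rewrite ler_wpM2r ?subr_ge0 ?exprn_ile1 ?(ltW r0) //.
  exact: passC_cabs.
have d2 : 1 - Re (yN N 1 (toC r)) <= 2 / k%:R + 2 * (1 - smass N).
  have := Re_le_cabs (1 - yN N 1 (toC r)).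
  have -> : Re (1 - yN N 1 (toC r)) = 1 - Re (yN N 1 (toC r)) by case: (yN _ _ _).
  have := ler_norm (1 - Re (yN N 1 (toC r))).
  have := cabsD (1 - Y) (Y - yN N 1 (toC r)).
  by rewrite addrA subrK; move: hY yl; lra.
have d3 := yLP N z1 o1.
have tri (a b c : C) : cabs (a - c) <= cabs (a - b) + cabs (b - c).
  have -> : a - c = (a - b) + (b - c) by ring.
  exact: cabsD.
have t1 := tri 1 (yL z 1) (yN N z 1).
have t2 := tri 1 (yN N z 1) (yN N z (toC r)).
have s1 := smass_le1 N.
exact: (arith _ _ _ _ _ _ _ _ t2 t1 d3 d1 d2 s1).
Qed.

(** * The circle of z and the Stolz angle *)

Lemma cabs_subX (z z' : C) a : cabs z <= 1 -> cabs z' <= 1 ->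
  cabs (z ^+ a - z' ^+ a) <= a%:R * cabs (z - z').
Proof.
move=> z1 z1'; elim: a => [|a IH]; first by rewrite subrr cabs0 mul0r.
have -> : z ^+ a.+1 - z' ^+ a.+1 = z ^+ a * (z - z') + (z ^+ a - z' ^+ a) * z'.
  by rewrite !exprSr; ring.
apply: le_trans (cabsD _ _) _; rewrite !cabsM mulrSr mulrDl mul1r addrC.
apply: lerD; last by rewrite ler_piMl ?cabs_ge0 // cabsX exprn_ile1 ?cabs_ge0.
by apply: le_trans IH; rewrite ler_piMr ?cabs_ge0.
Qed.

Lemma yN_lipschitz N z z' : cabs z <= 1 -> cabs z' <= 1 ->
  cabs (yN N z 1 - yN N z' 1) <= N.+1%:R * cabs (z - z').
Proof.
move=> z1 z1'; rewrite !yN_pairs // -sumrB; apply: le_trans (cabs_sum _ _ _) _.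
apply: (@le_trans _ _ (smass N * (N.+1%:R * cabs (z - z')))); last first.
  by rewrite ler_piMl ?mulr_ge0 ?cabs_ge0 // smass_le1.
rewrite smass_pairs // mulr_suml; apply: ler_sum => -[n a] _ /=.
have w0 : 0 <= Re (passC n)`_a.
  have := (nonneg_passC n).2 a; rewrite lecE /= => /andP[_]; exact.
rewrite !expr1n !mulr1 -mulrBr cabsM cabs_real ger0_norm // ler_wpM2l //.
apply: le_trans (cabs_subX a z1 z1') _; rewrite ler_wpM2r ?cabs_ge0 //.
by rewrite ler_nat ltnW.
Qed.

(** Parametrizes the circle z + conj z = 2 z conj z without 0: its points are those whose inverse
    has real part 1. *)
Definition circ (om : R) : C := (Complex 1 om)^-1.

Lemma circ_neq0 om : Complex 1 om != 0 :> C.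
Proof. by rewrite eq_complex /= oner_eq0. Qed.

Lemma cabs_circ om : cabs (circ om) ^+ 2 = (1 + om ^+ 2)^-1.
Proof. by rewrite /circ cabsV exprVn sqr_cabs /= expr1n. Qed.

Lemma cabs_circ_le1 om : cabs (circ om) <= 1.
Proof.
rewrite -(ler_sqr (x := cabs _)) ?nnegrE ?cabs_ge0 // expr1n cabs_circ.
by rewrite invf_le1 ?lerDl ?sqr_ge0 // ltr_pwDl ?sqr_ge0.
Qed.

Lemma circ_dist s t : cabs (circ s - circ t) <= `|s - t|.
Proof.
have -> : circ s - circ t = circ s * circ t * (Complex 1 t - Complex 1 s).
  by rewrite /circ; field; rewrite !circ_neq0.
rewrite !cabsM; have -> : cabs (Complex 1 t - Complex 1 s : C) = `|s - t|.
  have -> : Complex 1 t - Complex 1 s = Complex 0 (t - s) :> C.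
    by apply/eqP; rewrite eq_complex /= subrr !eqxx.
  apply/eqP; rewrite -(eqrXn2 (n := 2)) ?cabs_ge0 // sqr_cabs /=.
  by rewrite expr0n add0r real_normK ?num_real // -sqrrN opprB.
by rewrite ler_piMl // mulr_ile1 ?cabs_ge0 ?cabs_circ_le1.
Qed.

(** The polynomials [yN] are Lipschitz in z and converge uniformly. *)
Lemma yL_circ_cont s e : 0 < e -> exists2 dl, 0 < dl &
  forall t, `|s - t| < dl -> cabs (yL (circ s) 1 - yL (circ t) 1) < e.
Proof.
move=> e0.
have [N hN] := smass_lim (divr_gt0 e0 (ltr0n R 8)).
have N1 : 0 < N.+1%:R :> R by rewrite ltr0n.
exists (e / 2 / N.+1%:R); first by rewrite !divr_gt0.
move=> t; rewrite ltr_pdivlMr // mulrC => st.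
have h1 := yLP N (cabs_circ_le1 s) o1.
have h2 := yLP N (cabs_circ_le1 t) o1.
have h3 := yN_lipschitz N (cabs_circ_le1 s) (cabs_circ_le1 t).
have h4 := ler_wpM2l (ltW N1) (circ_dist s t).
have h5 := hN N (leqnn _).
have h6 := cabsD (yL (circ s) 1 - yN N (circ s) 1) (yN N (circ s) 1 - yL (circ t) 1).
have h7 := cabsD (yN N (circ s) 1 - yN N (circ t) 1) (yN N (circ t) 1 - yL (circ t) 1).
rewrite (cabsB (yN N (circ t) 1)) in h7; rewrite !addrA !subrK in h6 h7.
lra.
Qed.

(* As z^-1 = 1 + i om, this is the real part of [yL_circle]. *)
Lemma circ_eq om (y := yL (circ om) 1) :
  (1 - Re y) ^+ 2 = (1 - 2 * p) * Im y ^+ 2 - 2 * Im y * om.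
Proof.
have z0 : circ om != 0 by rewrite invr_eq0 circ_neq0.
have zc : (circ om)^-1 = Complex 1 om by rewrite invrK.
have zcc : (conjc (circ om))^-1 = Complex 1 (- om).
  by rewrite -(fmorphV conjc) zc.
have zz : circ om + conjc (circ om) = 2 * circ om * conjc (circ om).
  have zc0 : conjc (circ om) != 0 by rewrite conjc_eq0.
  have e2 : (circ om)^-1 + (conjc (circ om))^-1 = 2.
    by rewrite zc zcc -[2]/(1 + 1); apply/eqP; rewrite eq_complex /= subrr addr0 !eqxx.
  by rewrite -e2; field; rewrite zc0 z0.
have := yL_circle z0 (cabs_circ_le1 om) zz.
rewrite /= -/y zc zcc; case: y => a b E.
have : Re (Complex a b * Complex 1 om + conjc (Complex a b) * Complex 1 (- om)) =
   Re (1 + (1 - toC p) / 2 * (Complex a b ^+ 2 + conjc (Complex a b) ^+ 2)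
      + toC p * (conjc (Complex a b) * Complex a b)) by rewrite E.
have -> : (1 - toC p) / 2 = toC ((1 - p) / 2).
  by rewrite rmorphM rmorphB rmorph1 fmorphV rmorph_nat.
rewrite !expr2 !ReD !Re_toCM !ReD. rewrite !ReM /=; lra.
Qed.

Let q := 1 - 2 * p.
Let q0 : 0 < q. Proof. by rewrite /q; move: hp1; lra. Qed.
Let q1 : q < 1. Proof. by rewrite /q; move: hp0; lra. Qed.

Lemma Im_le1 om : Im (yL (circ om) 1) <= 1.
Proof.
apply: le_trans (ler_norm _) _; apply: le_trans (Im_le_cabs _) _.
exact: le_trans (yL_le1 (cabs_circ_le1 om) o1) (cabs_circ_le1 om).
Qed.

(* By [circ_eq] the difference [b - om / q] never vanishes for [om > 0]; hence its
   sign is constant, and it is negative at [om = 1]. *)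
Lemma circ_Im om : 0 < om -> Im (yL (circ om) 1) <= 0.
Proof.
move=> om0; rewrite leNgt; apply/negP => b0.
pose f t : R := t / q - Im (yL (circ t) 1).
have E t := circ_eq t.
have bq : 2 * om <= q * Im (yL (circ om) 1).
  rewrite -(ler_pM2l b0); have := sqr_ge0 (1 - Re (yL (circ om) 1)).
  by rewrite E -/q; lra.
have om1 : om <= 1.
  have := Im_le1 om; move: bq b0 q1 q0; nra.
have fo : f om <= 0.
  rewrite /f subr_le0 ler_pdivrMr // mulrC; move: bq om0; lra.
have f1 : 0 <= f 1.
  rewrite /f subr_ge0; apply: le_trans (Im_le1 1) _.
  by rewrite ler_pdivlMr // mul1r ltW.
have fc : continuous f.
  move=> t; apply: cvgB; first exact: (cvgM cvg_id (cvg_cst _)).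
  apply/cvgrPdist_lt => e e0; have [dl dl0 hdl] := yL_circ_cont t e0.
  near=> s; have := hdl s; have -> : Im (yL (circ t) 1) - Im (yL (circ s) 1) =
     Im (yL (circ t) 1 - yL (circ s) 1) by rewrite ImD ImN.
  move=> h; apply: le_lt_trans (Im_le_cabs _) (h _).
  by near: s; apply: cvgr_dist_lt.
have [|t /itvP tI ft] := @IVT R f om 1 0 om1 (continuous_subspaceT fc).
  by rewrite ge_min fo /= le_max f1 orbT.
have t0 : 0 < t by apply: lt_le_trans om0 _; rewrite tI.
have bt : Im (yL (circ t) 1) = t / q by move: ft; rewrite /f => /eqP; rewrite subr_eq0 => /eqP.
have := sqr_ge0 (1 - Re (yL (circ t) 1)); rewrite E -/q bt.
have -> : q * (t / q) ^+ 2 - 2 * (t / q) * t = - (t ^+ 2 / q) by field; rewrite gt_eqF.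
by rewrite oppr_ge0 leNgt divr_gt0 // exprn_gt0.
Unshelve. all: by end_near.
Qed.

Lemma circN om : circ (- om) = conjc (circ om).
Proof. by rewrite /circ (fmorphV conjc). Qed.

(** For om > 0 the last term of [circ_eq] is nonnegative by [circ_Im]; negative om follow by
    conjugation. *)
Lemma circ_sector om (y := yL (circ om) 1) : q * Im y ^+ 2 <= (1 - Re y) ^+ 2.
Proof.
have pos t : 0 < t ->
    q * Im (yL (circ t) 1) ^+ 2 <= (1 - Re (yL (circ t) 1)) ^+ 2.
  by move=> t0; rewrite circ_eq -/q; have := circ_Im t0; move: t0; nra.
have [t0|t0|t0] := ltrgtP om 0; [|exact: pos|].
  have t1 : 0 < - om by rewrite oppr_gt0.
  have := pos _ t1; rewrite circN yL_conj ?cabs_circ_le1 // /y.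
  by case: (yL _ _) => a b /=; rewrite sqrrN.
have -> : y = 1.
  have c0 : circ om = 1 by rewrite /circ t0 invr1.
  by rewrite /y c0 yL11.
by rewrite subrr expr0n mulr0.
Qed.

(** Near z = 1 the value y is close to 1 and lies in the sector; elsewhere |y| <= |z| stays away
    from 1. *)
Lemma Stolz_bound : exists2 kappa, 0 < kappa & forall z : C,
  z + conjc z = 2 * z * conjc z -> cabs z <= 1 ->
  kappa * cabs (1 - yL z 1) <= 1 - cabs (yL z 1) ^+ 2.
Proof.
have qp : 0 < 1 + q by rewrite addr_gt0.
have iqp : 0 < 1 + q^-1 by rewrite addr_gt0 // invr_gt0.
(* When 1 - Re y <= q / (1 + q), the sector gives |y|^2 <= Re y. *)
have qd : 0 < q / (1 + q) by rewrite divr_gt0.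
have [dl dl0 hdl] := yL_circ_cont 0 qd.
(* Half the least value of 1 - |z|^2 for |om| >= dl, as |1 - y| can be as large as 2. *)
pose m := dl ^+ 2 / (1 + dl ^+ 2) / 2.
have d2 : 0 < dl ^+ 2 by rewrite exprn_gt0.
have m0 : 0 < m by rewrite !divr_gt0 // addr_gt0.
have m1 : 0 < (1 + q^-1)^-1 by rewrite invr_gt0.
exists (Num.min (1 / 2) (Num.min m (1 + q^-1)^-1)).
  by rewrite !lt_min m0 m1 divr_gt0.
move=> z zz z1; set k := Num.min _ _.
have k1 : k <= 1 / 2 by rewrite ge_min lexx.
have k2 : k <= m by rewrite !ge_min lexx orbT.
have k3 : k <= (1 + q^-1)^-1 by rewrite !ge_min lexx !orbT.
have [z0|z0] := eqVneq z 0.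
  have : cabs (yL z 1) <= 0 by apply: le_trans (yL_le1 z1 o1) _; rewrite z0 cabs0.
  move=> h; have -> : yL z 1 = 0.
    by apply/eqP; rewrite -cabs_eq0 eq_le h cabs_ge0.
  by rewrite subr0 cabs1 cabs0 expr0n /=; move: k1; lra.
have [om ->] : exists om, z = circ om.
  exists (Im z^-1); have zc0 : conjc z != 0 by rewrite conjc_eq0.
  have e2 : z^-1 + conjc z^-1 = 2.
    rewrite (fmorphV conjc); apply: (mulfI z0); apply: (mulfI zc0).
    transitivity (z + conjc z); first by field; rewrite zc0 z0.
    by rewrite zz; ring.
  rewrite /circ; apply: invr_inj; rewrite invrK; move: e2; case: (z^-1) => a b [] e2 _.
  by congr Complex; move: e2; lra.
have Y1 := le_trans (yL_le1 (cabs_circ_le1 om) o1) (lexx _).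
have Sec := circ_sector om; have := cabs_circ om.
have := hdl om; have -> : yL (circ 0) 1 = 1 by rewrite /circ invr1 yL11.
rewrite sub0r normrN; move: Y1 Sec; set y := yL _ 1 => Y1 Sec small Ec.
have t2 : cabs (1 - y) <= 2.
  apply: le_trans (cabsD _ _) _; rewrite cabs1 cabsN.
  by have := le_trans Y1 (cabs_circ_le1 om); lra.
have [lom|lom] := ltrP `|om| dl; last first.
  have : cabs y ^+ 2 <= cabs (circ om) ^+ 2 by rewrite ler_sqr ?nnegrE ?cabs_ge0.
  have : m * 2 <= 1 - (1 + om ^+ 2)^-1.
    have o2 : dl ^+ 2 <= om ^+ 2.
      by rewrite -(real_normK (num_real om)) ler_sqr // nnegrE // ltW.
    have hdp : 0 < 1 + dl ^+ 2 by rewrite addr_gt0.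
    have -> : m * 2 = 1 - (1 + dl ^+ 2)^-1 by rewrite /m; field; rewrite gt_eqF.
    rewrite lerB // lef_pV2 ?posrE ?lerD2l //.
    by apply: lt_le_trans hdp _; rewrite lerD2l.
  rewrite Ec; have := cabs_ge0 (1 - y); move: k2 m0 t2; nra.
have {small lom} small := small lom.
have Re1 : Re (1 - y) = 1 - Re y by rewrite ReD ReN.
have S2 : cabs (1 - y) <= (1 - Re y) * (1 + q^-1) /\ (1 - Re y) <= 1 - cabs y ^+ 2.
  have : `|1 - Re y| < q / (1 + q).
    by apply: le_lt_trans small; rewrite -Re1 Re_le_cabs.
  have := cabs_le_ReIm (1 - y); have := Re_le_cabs y.
  rewrite Re1.
  have -> : `|Im (1 - y)| = `|Im y| by case: (y) => a b /=; rewrite sub0r normrN.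
  have c1 := le_trans Y1 (cabs_circ_le1 om).
  rewrite sqr_cabs; move: Sec; move: (cabs (1 - y)) (cabs y) c1 => A B c1.
  case: (y) => a b /= Sec B1 A1 A2.
  have a1 : 0 <= 1 - a by have := ler_norm a; move: c1 B1; lra.
  have bq : q * `|b| <= 1 - a.
    rewrite -ler_sqr ?nnegrE ?mulr_ge0 ?(ltW q0) // exprMn real_normK ?num_real //.
    apply: le_trans Sec; rewrite ler_wpM2r ?sqr_ge0 //.
    by rewrite expr2 ler_piMl // ltW.
  move: A1 A2; rewrite ger0_norm // => A1; rewrite ltr_pdivlMr // => A2.
  split.
    apply: le_trans A1 _; rewrite mulrDr mulr1 lerD2l ler_pdivlMr // mulrC.
    exact: bq.
  have : q * (a ^+ 2 + b ^+ 2) <= q * a.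
    move: Sec A2 a1 q0; nra.
  by rewrite ler_pM2l //; lra.
case: S2 => S2 S3; apply: le_trans S3.
have c0 := cabs_ge0 (1 - y).
apply: le_trans (ler_wpM2r c0 k3) _.
by rewrite mulrC ler_pdivrMr.
Qed.

(** * Means over roots of unity of odd order *)

Lemma sum_double (h : nat -> R) M :
  \sum_(l < M.*2.+1) h l = \sum_(l < M.+1) h l.*2 + \sum_(l < M) h l.*2.+1.
Proof.
elim: M => [|M IH]; first by rewrite !big_ord1 big_ord0 addr0.
rewrite doubleS 2!big_ord_recr /= IH.
rewrite [in RHS]big_ord_recr [X in _ = _ + X]big_ord_recr /= doubleS.
by ring.
Qed.

(* Squaring permutes the roots of unity of odd order. *)
Lemma ravg_double L (h : nat -> R) : odd L -> (forall m, h (m + L)%N = h m) ->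
  ravg L (fun l => h l.*2) = ravg L h.
Proof.
move=> oL hL; rewrite /ravg; congr (_ * _).
have [M LM] : exists M, L = M.*2.+1.
  by exists L./2; rewrite -[LHS]odd_double_half oL.
rewrite LM in hL *; rewrite [RHS]sum_double.
have E : M.*2.+1 = (M.+1 + M)%N by lia.
rewrite [in LHS]E big_split_ord /=; congr (_ + _); apply: eq_bigr => i _.
have -> : (M.+1 + i).*2 = (i.*2.+1 + M.*2.+1)%N by lia.
by rewrite hL.
Qed.

(** Telescoping: (1 + e l)^-2 is at most the decrease of 1 / (e (1 + e m)) from m = l - 1 to m =
    l. *)
Lemma sum_inv_sq (e : R) n : 0 < e ->
  \sum_(l < n.+1) ((1 + e * l%:R) ^+ 2)^-1 <= 1 + e^-1.
Proof.
move=> e0; have pos m : 0 < 1 + e * m%:R :> R.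
  by rewrite ltr_pwDl // mulr_ge0 // ltW.
suff H : \sum_(l < n.+1) ((1 + e * l%:R) ^+ 2)^-1 <=
    1 + e^-1 - (e * (1 + e * n%:R))^-1.
  by apply: le_trans H _; rewrite gerBl invr_ge0 mulr_ge0 ?ltW.
elim: n => [|n IH].
  by rewrite big_ord1 mulr0 addr0 expr1n invr1 mulr1 addrK.
rewrite big_ord_recr /=; apply: le_trans (lerD IH (lexx _)) _.
have -> : 1 + e^-1 - (e * (1 + e * n%:R))^-1 = 1 + e^-1 - (e * (1 + e * n.+1%:R))^-1
   - ((1 + e * n%:R) * (1 + e * n.+1%:R))^-1.
  have q3 := pos n; have q4 := pos n.+1; move: q3 q4; rewrite -natr1 => q3 q4.
  by field; rewrite !gt_eqF.
rewrite -addrA gerDl addrC subr_le0 lef_pV2 ?posrE ?mulr_gt0 ?exprn_gt0 ?pos //.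
by rewrite expr2 ler_wpM2r ?(ltW (pos _)) // lerD2l ler_wpM2l ?(ltW e0) // ler_nat.
Qed.

(** On [0, 1] the mean value theorem gives slope cos 1; beyond, sin x >= sin 1 >= cos 1 is enough
    because x < 2. *)
Lemma sin_ge_linear (x : R) : 0 <= x -> x <= pi / 2 -> cos 1 / 2 * x <= sin x.
Proof.
move=> x0 x2; have c1 := cos1_gt0 R.
have pi2 : (2 : R) <= pi := pi_ge2 R.
have pi4 : (pi : R) < 4 by have := pihalf_lt2 R; lra.
have base (y : R) : 0 <= y -> y <= 1 -> cos 1 * y <= sin y.
  move=> y0 y1; have dsin (t : R) : t \in `]0, y[ -> is_derive t 1 sin (cos t).
    by move=> _; exact: is_derive_sin.
  have [t tI E] := MVT_segment y0 dsin (continuous_subspaceT (@continuous_sin R)).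
  have -> : sin y = cos t * y by move: E; rewrite sin0 !subr0.
  have /itvP tJ := tI; rewrite ler_wpM2r //.
  have [->//|t1] := eqVneq t 1.
  have t0 : 0 <= t by rewrite tJ.
  have ty : t <= y by rewrite tJ.
  have lt1 : t < 1 by rewrite lt_neqAle t1 (le_trans ty y1).
  have i1 : (1 : R) \in `[0, pi] by rewrite in_itv /=; apply/andP; split; lra.
  have it : t \in `[0, pi] by rewrite in_itv /=; apply/andP; split; lra.
  by apply: ltW; rewrite ltr_cos.
have [x1|x1] := lerP x 1.
  by apply: le_trans (base x x0 x1); rewrite ler_wpM2r //; lra.
have s1 : sin 1 <= sin x.
  by apply: ltW; rewrite ltr_sin // in_itv /=; apply/andP; split; lra.
have := base 1 ler01 (lexx _); rewrite mulr1 => b1.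
by apply: le_trans (le_trans b1 s1); nra.
Qed.

Lemma abs_sin_ge L l : (l <= L)%N -> (0 < L)%N ->
  cos 1 / 2 * (minn l (L - l))%:R / L%:R <= `|sin (pi * (l%:R / L%:R))| :> R.
Proof.
have H m : (m.*2 <= L)%N -> (0 < L)%N ->
    cos 1 / 2 * m%:R / L%:R <= sin (pi * (m%:R / L%:R)) :> R.
  move=> mL L0; have L1 : 0 < L%:R :> R by rewrite ltr0n.
  have c1 := cos1_gt0 R.
  have pi2 : (2 : R) <= pi := pi_ge2 R.
  have t0 : 0 <= m%:R / L%:R :> R by rewrite divr_ge0.
  apply: le_trans (sin_ge_linear _ _).
  - by rewrite -mulrA ler_wpM2l ?divr_ge0 ?(ltW c1) // ler_peMl //; lra.
  - by rewrite mulr_ge0 // pi_ge0.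
  - rewrite ler_wpM2l ?pi_ge0 // ler_pdivrMr // mulrC ler_pdivlMr // -natrM ler_nat.
    by rewrite muln2.
move=> lL L0; have L1 : L%:R != 0 :> R by rewrite pnatr_eq0 -lt0n.
apply: le_trans (ler_norm _).
have [l2|l2] := leqP l (L - l).
  by apply: H => //; rewrite -addnn; lia.
have -> : sin (pi * (l%:R / L%:R)) = sin (pi * ((L - l)%:R / L%:R)) :> R.
  rewrite natrB // mulrBl divff // mulrBr mulr1 sinB sinpi cospi mul0r sub0r.
  by rewrite mulN1r opprK.
by apply: H => //; rewrite -addnn; lia.
Qed.

(** The minimum of l and L - l is one of the two, so each term is at most the sum of the two
    candidates, and [sum_inv_sq] applies twice. *)
Lemma ravg_sin L (A : R) : (0 < L)%N -> 0 < A ->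
  ravg L (fun l => ((1 + A * `|sin (pi * (l%:R / L%:R))|) ^+ 2)^-1) <=
  2 / L%:R + 4 / (cos 1 * A).
Proof.
move=> L0 A0; have L1 : 0 < L%:R :> R by rewrite ltr0n.
have c1 := cos1_gt0 R.
pose e : R := A * (cos 1 / 2) / L%:R.
have e0 : 0 < e by rewrite divr_gt0 // mulr_gt0 // divr_gt0.
have pos m : 0 < 1 + e * m%:R :> R by rewrite ltr_pwDl // mulr_ge0 // ltW.
rewrite /ravg; apply: (@le_trans _ _ (L%:R^-1 * (2 * (1 + e^-1)))); last first.
  by apply: le_of_eq; rewrite /e; field; rewrite !gt_eqF.
rewrite ler_wpM2l ?invr_ge0 //.
apply: (@le_trans _ _ (\sum_(l < L) (((1 + e * l%:R) ^+ 2)^-1 +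
    ((1 + e * (L - l)%:R) ^+ 2)^-1))).
  apply: ler_sum => l _.
  have h := abs_sin_ge (ltnW (ltn_ord l)) L0.
  have : 1 + e * (minn l (L - l))%:R <= 1 + A * `|sin (pi * (l%:R / L%:R))|.
    rewrite lerD2l; apply: le_trans (ler_wpM2l (ltW A0) h).
    by apply: le_of_eq; rewrite /e; ring.
  move: (`|sin _|) => s hs.
  apply: (@le_trans _ _ ((1 + e * (minn l (L - l))%:R) ^+ 2)^-1).
    rewrite lef_pV2 ?posrE ?exprn_gt0 ?pos ?(lt_le_trans (pos _) hs) //.
    by rewrite ler_sqr ?nnegrE ?(ltW (pos _)) ?(ltW (lt_le_trans (pos _) hs)).
  have i0 m : 0 <= ((1 + e * m%:R) ^+ 2)^-1 by rewrite invr_ge0 sqr_ge0.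
  by case: (leqP l (L - l)) => _; rewrite ?lerDl ?lerDr.
rewrite big_split /= mulr2n mulrDl mul1r; apply: lerD.
  apply: le_trans (sum_inv_sq L e0).
  by rewrite [leRHS]big_ord_recr lerDl invr_ge0 sqr_ge0.
rewrite (reindex_inj rev_ord_inj) /=.
have E : \sum_(i < L) ((1 + e * (L - (L - i.+1))%:R) ^+ 2)^-1 =
   \sum_(i < L) ((1 + e * i.+1%:R) ^+ 2)^-1.
  by apply: eq_bigr => i _; rewrite subKn.
rewrite E; apply: le_trans (sum_inv_sq L e0).
by rewrite [leRHS]big_ord_recl lerDr invr_ge0 sqr_ge0.
Qed.

(** Trades the exponential for a power, so that both means become means of inverse squares. *)
Lemma expRN_le (s : R) n : 0 <= s -> (0 < n)%N -> expR (- s) <= ((1 + s / n%:R) ^+ n)^-1.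
Proof.
move=> s0 n0; have n1 : n%:R != 0 :> R by rewrite pnatr_eq0 -lt0n.
have h0 : 0 < 1 + s / n%:R by rewrite ltr_pwDl // divr_ge0.
rewrite expRN lef_pV2 ?posrE ?expR_gt0 ?exprn_gt0 //.
have -> : s = n%:R * (s / n%:R) by rewrite mulrC divfK.
rewrite expRM_natl [X in 1 + X / _]mulrC mulfK // lerXn2r ?nnegrE ?expR_ge0 ?(ltW h0) //.
exact: expR_ge1Dx.
Qed.

Lemma zrootE L j : zroot R L j = zroot R L 1 ^+ j.
Proof. by rewrite -[LHS]expr1 zrootX expr1. Qed.

Lemma zroot_periodic L m : (0 < L)%N -> zroot R L (m + L) = zroot R L m.
Proof. by move=> L0; rewrite zrootE exprD zroot_order // mulr1 -zrootE. Qed.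

Lemma zroot_sqr L j : zroot R L j ^+ 2 = zroot R L j.*2.
Proof. by rewrite zrootE -exprM muln2 -zrootE. Qed.

Lemma zeta_avg : exists2 A, 0 < A & forall k L, (0 < k)%N -> odd L -> (k ^ 2 <= L)%N ->
  ravg L (fun l => expR (- (k%:R / 8 * (1 - cabs (yL 1 (zroot R L l ^+ 2)) ^+ 2)))) <=
  A / k%:R ^+ 2.
Proof.
have c1 := cos1_gt0 R.
exists (2 + 4 / (cos 1 * (3 / 128) ^+ 2)).
  by rewrite addr_gt0 ?divr_gt0 ?mulr_gt0 ?exprn_gt0 ?divr_gt0 ?ltr0n.
move=> k L k0 oL kL; have L0 : (0 < L)%N by case: L oL {kL}.
have k1 : 0 < k%:R :> R by rewrite ltr0n.
have k2 : 0 < k%:R ^+ 2 :> R by rewrite exprn_gt0.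
have L1 : 0 < L%:R :> R by rewrite ltr0n.
(* With D = 1 - |y|^2 and s = k D / 8, (s / 4)^2 = k^2 D^2 / 32^2, and [yL_gap] gives D^2 >= (3 /
   4)^2 |Im x|; 3 / 128 is 3 / 4 over 32. *)
pose a : R := (3 / 128) ^+ 2 * k%:R ^+ 2.
have a0 : 0 < a by rewrite mulr_gt0 ?exprn_gt0 ?divr_gt0 ?ltr0n.
pose h m := ((1 + a * `|Im (zroot R L m)|) ^+ 2)^-1.
pose g m := ((1 + a * `|sin (pi * (m%:R / L%:R))|) ^+ 2)^-1.
apply: (@le_trans _ _ (ravg L (fun l => h l.*2))).
  apply: ler_ravg => l lL; rewrite zroot_sqr.
  have := yL_gap (cabs_zroot R L l.*2).
  have x1 : cabs (zroot R L l.*2) <= 1 by rewrite cabs_zroot.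
  have := yL_le1 o1 x1; rewrite cabs1 => y1.
  have D0 : 0 <= 1 - cabs (yL 1 (zroot R L l.*2)) ^+ 2.
    by rewrite subr_ge0 exprn_ile1 ?cabs_ge0.
  move: D0; move: (1 - _) => D D0; rewrite /h; move: (Im _) => t tD.
  have s0 : 0 <= k%:R / 8 * D by rewrite mulr_ge0 // divr_ge0 // ltW.
  apply: le_trans (expRN_le s0 (isT : (0 < 4)%N)) _.
  have at0 : 0 <= a * `|t| by rewrite mulr_ge0 // ltW.
  rewrite lef_pV2 ?posrE ?exprn_gt0 ?ltr_pwDl ?divr_ge0 //.
  have -> (x : R) : x ^+ 4 = (x ^+ 2) ^+ 2 by rewrite -exprM.
  rewrite ler_sqr ?nnegrE ?sqr_ge0 //; last first.
    by rewrite addr_ge0.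
  have := ler_wpM2l (ltW k2) tD; rewrite /a => tD'.
  have := mulr_ge0 (ltW k1) D0; rewrite sqrrD expr1n -addrA lerD2l => kD.
  have -> : (k%:R / 8 * D / 4%:R) ^+ 2 = k%:R ^+ 2 * D ^+ 2 / 32 ^+ 2 by field.
  lra.
rewrite ravg_double //; last by move=> m; rewrite /h zroot_periodic.
(* As |sin| has period pi, [g] has period L although its angles are half those of [h]; this permits
   a second use of [ravg_double]. *)
have gP m : g (m + L)%N = g m.
  rewrite /g; congr ((1 + a * _) ^+ 2)^-1.
  have -> : (m + L)%:R / L%:R = m%:R / L%:R + 1 :> R by rewrite natrD mulrDl divff // gt_eqF.
  by rewrite mulrDr mulr1 sinDpi normrN.
have -> : ravg L h = ravg L (fun l => g l.*2).
  rewrite /ravg; congr (_ * _); apply: eq_bigr => l _.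
  rewrite /h /g /zroot /=; congr ((1 + a * `|sin _|) ^+ 2)^-1.
  by rewrite -muln2 natrM; ring.
rewrite ravg_double //; apply: le_trans (ravg_sin L0 a0) _.
rewrite [leRHS]mulrDl; apply: lerD.
  by rewrite ler_wpM2l // lef_pV2 ?posrE // -natrX ler_nat.
by apply: le_of_eq; rewrite /a; field; rewrite !gt_eqF.
Qed.

Lemma zhalf_double L j : half1 (zroot R L j ^+ 2) = zhalf R L j.*2.
Proof. by rewrite zroot_sqr. Qed.

Definition zgap k L j : R := ((1 + k%:R * cabs (1 - yL (zhalf R L j) 1)) ^+ 2)^-1.

Lemma z_avg : exists2 A, 0 < A & forall k L, odd L ->
  ravg L (fun j => expR (- (k%:R / 8 * (1 - cabs (yL (zhalf R L j.*2) 1) ^+ 2)))) <=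
  A * ravg L (zgap k L).
Proof.
have [kap kap0 hkap] := Stolz_bound.
(* The exponent 2 of [expRN_le] turns k / 8 into k / 16, and m serves both summands of 1 + k |1 -
   y|. *)
pose m := Num.min 1 (kap / 16).
have m0 : 0 < m by rewrite lt_min ltr01 divr_gt0.
have m1 : m <= 1 by rewrite ge_min lexx.
have m2 : m <= kap / 16 by rewrite ge_min lexx orbT.
exists ((m ^+ 2)^-1); first by rewrite invr_gt0 exprn_gt0.
move=> k L oL; have L0 : (0 < L)%N by case: L oL.
have -> : (m ^+ 2)^-1 * ravg L (zgap k L) =
    ravg L (fun j => (m ^+ 2)^-1 * zgap k L j).
  by rewrite /ravg -mulr_sumr mulrCA.
have zP i : zhalf R L (i + L) = zhalf R L i.
  by rewrite /zhalf zroot_periodic.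
pose f j := expR (- (k%:R / 8 * (1 - cabs (yL (zhalf R L j) 1) ^+ 2))).
have fP i : f (i + L)%N = f i by rewrite /f zP.
rewrite -/f (ravg_double oL fP).
apply: ler_ravg => j jL; rewrite /f.
have zz : zhalf R L j + conjc (zhalf R L j) = 2 * zhalf R L j * conjc (zhalf R L j).
  by apply: zhalf_circle; exact: zroot_conj.
have := hkap _ zz (cabs_zhalf L j).
have k0 : 0 <= k%:R :> R by [].
rewrite /zgap; move: (cabs_ge0 (1 - yL (zhalf R L j) 1)).
move: (cabs (1 - yL _ 1)) (1 - cabs (yL _ 1) ^+ 2) => u D u0 uD.
have D0 : 0 <= D by apply: le_trans uD; rewrite mulr_ge0 // ltW.
have s0 : 0 <= k%:R / 8 * D by rewrite mulr_ge0 // divr_ge0.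
apply: le_trans (expRN_le s0 (isT : (0 < 2)%N)) _.
have ku : 0 <= k%:R * u by rewrite mulr_ge0.
have mku : 0 <= m * (1 + k%:R * u) by rewrite mulr_ge0 ?(ltW m0) // addr_ge0.
have kup : 0 < 1 + k%:R * u by rewrite ltr_pwDl.
rewrite -invfM -exprMn lef_pV2 ?posrE ?exprn_gt0 ?ltr_pwDl ?divr_ge0 //; last first.
  by rewrite mulr_gt0.
rewrite ler_sqr ?nnegrE ?addr_ge0 ?divr_ge0 //.
have e1 := ler_wpM2l k0 uD; have e2 := ler_wpM2r ku m2.
have -> : k%:R / 8 * D / 2%:R = k%:R * D / 16 by field.
lra.
Qed.

(** The truncation error 1 - s is amplified by the k-th power; k (1 - s) <= 1 keeps its cost to a
    factor e. *)
Lemma pow_le_expR (u v c1 c2 a b s : R) k h c : (k <= h)%N -> (k <= c)%N ->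
  0 <= u -> u <= 1 -> 0 <= v -> v <= 1 -> u * v <= 1 - ((1 - c1) + (1 - c2)) / 8 ->
  c1 <= a + 4 * (1 - s) -> c2 <= b + 4 * (1 - s) -> k%:R * (1 - s) <= 1 ->
  u ^+ h * v ^+ c <=
  expR 1 * (expR (- (k%:R / 8 * (1 - a))) * expR (- (k%:R / 8 * (1 - b)))).
Proof.
move=> kh kc u0 u1 v0 v1 uv s1 s2 kN; apply: (@le_trans _ _ ((u * v) ^+ k)).
  by rewrite exprMn ler_pM ?exprn_ge0 // ler_wiXn2l.
have uv' : u * v <= expR ((1 - s) - ((1 - a) + (1 - b)) / 8).
  apply: le_trans (expR_ge1Dx _); apply: le_trans uv _; lra.
apply: (@le_trans _ _ (expR ((1 - s) - ((1 - a) + (1 - b)) / 8) ^+ k)).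
  by rewrite lerXn2r ?nnegrE ?mulr_ge0 ?expR_ge0.
rewrite -expRM_natl -!expRD ler_expR; lra.
Qed.

Lemma sqr_le_add (u v s : R) : 0 <= u -> u <= 1 -> 0 <= v -> v <= 1 ->
  u - v <= 2 * (1 - s) -> s <= 1 -> u ^+ 2 <= v ^+ 2 + 4 * (1 - s).
Proof.
move=> u0 u1 v0 v1 uv s1.
have -> : u ^+ 2 = v ^+ 2 + (u - v) * (u + v) by ring.
rewrite lerD2l; apply: le_trans (ler_wpM2r (addr_ge0 u0 v0) uv) _.
have -> : 4 * (1 - s) = 2 * (1 - s) * 2 by ring.
by apply: ler_wpM2l; lra.
Qed.

Lemma stackW_avg : exists2 A, 0 < A & forall k n h c N L,
  (0 < k)%N -> (k <= h)%N -> (k <= c)%N -> (n <= N)%N -> (N < L)%N -> odd L ->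
  k%:R * (1 - smass N) <= 1 ->
  stackW p n h c <= A / k%:R ^+ 2 * ravg L (zgap k L).
Proof.
have [A A0 hA] := zeta_avg; have [B B0 hB] := z_avg.
have E0 := expR_gt0 (1 : R).
exists (4 * expR 1 * A * B); first by rewrite !mulr_gt0.
move=> k n h c N L k0 kh kc nN NL oL kN.
have [L0 hL0] := stackW_le h c nN NL.
pose L' := (L0 + k ^ 2).*2.+1.
have oL' : odd L' by rewrite /L' /= odd_double.
have L0' : (L0 <= L')%N by rewrite /L' -addnn; lia.
have kL' : (k ^ 2 <= L')%N by rewrite /L' -addnn; lia.
apply: le_trans (hL0 _ L0') _.
have kk : 0 <= k%:R :> R by [].
pose F l := expR (- (k%:R / 8 * (1 - cabs (yL 1 (zroot R L' l ^+ 2)) ^+ 2))).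
pose G j := expR (- (k%:R / 8 * (1 - cabs (yL (zhalf R L j.*2) 1) ^+ 2))).
apply: (@le_trans _ _ (4 * ravg L (fun j => ravg L' (fun l => expR 1 * (G j * F l))))).
  rewrite ler_wpM2l //; apply: ler_ravg => j jL; apply: ler_ravg => l lL.
  set u := cabs _; set v := cabs _.
  have x1 : cabs (zroot R L' l) <= 1 by rewrite cabs_zroot.
  have z1 := cabs_zhalf L j.
  have u1 : u <= 1 by exact: yN_le1.
  have v1 : v <= 1 by apply: yN_le1; rewrite ?cabs_conj.
  have u0 : 0 <= u := cabs_ge0 _; have v0 : 0 <= v := cabs_ge0 _.
  have uv : u * v <= 1 - ((1 - cabs (yN N (zhalf R L j.*2) 1) ^+ 2)
       + (1 - cabs (yN N 1 (zroot R L' l ^+ 2)) ^+ 2)) / 8.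
    rewrite -zhalf_double.
    have := swap_bound N (cabs_zroot R L j) (cabs_zroot R L' l).
    by rewrite -half1_conj.
  have sqN (z x : C) : cabs z <= 1 -> cabs x <= 1 ->
      cabs (yN N z x) ^+ 2 <= cabs (yL z x) ^+ 2 + 4 * (1 - smass N).
    move=> zz xx; have a1 := yLP N zz xx.
    have a2 := yN_le1 N zz xx.
    have a3 := le_trans (yL_le1 zz xx) zz.
    have a4 := le_trans (cabs_dist (yN N z x) (yL z x)) (lexx _); rewrite cabsB in a4.
    have a5 := smass_le1 N.
    by apply: sqr_le_add (le_trans a4 a1) a5; rewrite ?cabs_ge0.
  have s1 := sqN _ _ (cabs_zhalf L j.*2) o1.
  have x2 : cabs (zroot R L' l ^+ 2) <= 1 by rewrite cabsX cabs_zroot expr1n.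
  have s2 := sqN _ _ o1 x2.
  exact: (pow_le_expR kh kc u0 u1 v0 v1 uv s1 s2 kN).
have -> : ravg L (fun j => ravg L' (fun l => expR 1 * (G j * F l))) =
    expR 1 * (ravg L G * ravg L' F).
  rewrite /ravg; under eq_bigr => j _ do rewrite -!mulr_sumr.
  rewrite (eq_bigr (fun j : 'I_L => G j * (expR 1 * (L'%:R^-1 * \sum_(l < L') F l)))).
    by rewrite -mulr_suml; ring.
  by move=> j _; ring.
have pos m (f : nat -> R) : 0 <= ravg m (fun j => expR (f j)).
  by rewrite mulr_ge0 ?invr_ge0 // sumr_ge0 // => j _; exact: expR_ge0.
have a1 := hA _ _ k0 oL' kL'; have b1 := hB k L oL.
have : ravg L G * ravg L' F <= B * ravg L (zgap k L) * (A / k%:R ^+ 2).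
  exact: ler_pM (pos _ _) (pos _ _) b1 a1.
move=> H; have e4 : 0 <= 4 * expR 1 :> R by rewrite mulr_ge0 // ltW.
rewrite [leLHS]mulrA; apply: le_trans (ler_wpM2l e4 H) _.
by apply: le_of_eq; ring.
Qed.

(** * Comparison with the words without orders *)

(** The renewal series 1 / (1 - y); the sum is cut at n because h passages have length at least
    h. *)
Definition visit : fps {poly CC} := fun n => (\sum_(h < n.+1) passC ^+ h) n.

Lemma visit_wide m n : (n <= m)%N -> (\sum_(h < m.+1) passC ^+ h) n = visit n.
Proof.
move=> nm; rewrite /visit !fps_sumE.
rewrite [RHS](big_ord_widen m.+1 (fun h => (passC ^+ h) n)) // [RHS]big_mkcond /=.
apply: eq_bigr => h _; case: ifPn => //; rewrite ltnS -ltnNge => nh.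
by rewrite fps_exp_val // passC0.
Qed.

Lemma visit_renewal n :
  visit n = (n == 0%N)%:R + \sum_(i < n.+1) passC i * visit (n - i)%N.
Proof.
have -> : \sum_(i < n.+1) passC i * visit (n - i)%N =
    (passC * \sum_(h < n.+1) passC ^+ h) n.
  by rewrite fpsME; apply: eq_bigr => i _; rewrite visit_wide // leq_subr.
rewrite -(visit_wide (leqnSn n)) big_ord_recl fpsDE expr0 fps1E; congr (_ + _).
by congr (_ n); rewrite mulr_sumr; apply: eq_bigr => i _; rewrite lift0 exprS.
Qed.

Lemma nonneg_visit : nonneg_fps visit.
Proof.
move=> n; rewrite /visit.
have : nonneg_fps (\sum_(h < n.+1) passC ^+ h); last by apply.
by apply: nonneg_fps_sum => h; apply: nonneg_fpsX; exact: nonneg_passC.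
Qed.

Definition visit1 n : R := Re (visit n).[1].

Lemma visit1E n : (visit n).[1] = toC (visit1 n).
Proof. exact: (nonneg_poly_horner1 (nonneg_visit n).2).1. Qed.

(** A renewal probability: the recursion averages earlier values with weights of total mass at most
    1. *)
Lemma visit1_le1 n : visit1 n <= 1.
Proof.
have E m : visit1 m = (m == 0%N)%:R + \sum_(i < m.+1) mass i * visit1 (m - i)%N.
  apply: complexI; rewrite -visit1E visit_renewal hornerD horner_sum.
  have -> : ((m == 0%N)%:R : {poly C}).[1] = (m == 0%N)%:R by rewrite -polyC_natr hornerC.
  rewrite (rmorphD toC) (rmorph_nat toC) (rmorph_sum toC); congr (_ + _); apply: eq_bigr => i _.
  by rewrite hornerM passC1 // visit1E (rmorphM toC).
have m0 : mass 0 = 0 by rewrite /mass passC0 horner0.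
elim/ltn_ind: n => -[_|n IH]; rewrite E big_ord_recl m0 mul0r add0r.
  by rewrite big_ord0 addr0.
rewrite add0r; apply: le_trans (smass_le1 n.+1).
rewrite /smass [leRHS]big_ord_recl m0 add0r; apply: ler_sum => i _.
rewrite ler_piMr ?mass_ge0 //; apply: IH; rewrite lift0 subSS.
by rewrite ltnS leq_subr.
Qed.

(** This is P(I > n), see [P_order_time]: n letters leave at most n burgers of each type. *)
Definition burgerW n : R := \sum_(h < n.+1) \sum_(c < n.+1) stackW p n h c.

Lemma pair_visit_le n : Re (pair visit visit n) <= burgerW n.
Proof.
have -> : pair visit visit n =
    pair (\sum_(h < n.+1) passC ^+ h) (\sum_(h < n.+1) passC ^+ h) n.
  apply: eq_bigr => i _; congr (Kp _ _); apply/esym; apply: visit_wide.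
    by rewrite -ltnS.
  exact: leq_subr.
rewrite pair_sumr fps_sumE.
suff H (c : 'I_n.+1) : Re (pair (passC ^+ c) (\sum_(h < n.+1) passC ^+ h) n) <=
    \sum_(h < n.+1) stackW p n h c.
  rewrite /burgerW [leRHS]exchange_big Re_sum; apply: ler_sum => c _.
  by apply: le_trans (H c); rewrite pairC.
rewrite pair_sumr fps_sumE Re_sum; apply: ler_sum => h _.
have := pair_stay_ge (toC_p0 p0) (toC_p1 p1) (fun l m => debtC_ge0 p0 p1 l m) c h n.
rewrite -stackC_pair lecE => /andP[_]; rewrite /= stackWC; exact.
Qed.

Definition visitN N (z : C) (r : R) : C :=
  \sum_(n < N.+1) (visit n).[z] * toC r ^+ n.

(** Parseval: the mean square over z is the pairing of the truncated series with itself, a sum over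
    a square of indices contained in the triangle of side 2 N. *)
Lemma visitN_avg N L r : 0 <= r -> (N < L)%N ->
  ravg L (fun j => cabs (visitN N (zhalf R L j) r) ^+ 2) <=
  \sum_(n < (N + N).+1) r ^+ n * burgerW n.
Proof.
move=> r0 NL; pose B i k : R := r ^+ (i + k) * Re (Kp (visit i) (visit k)).
have K0 i k : 0 <= Kp (visit i) (visit k).
  by apply: Kp_ge0; [exact: (nonneg_visit i).2|exact: (nonneg_visit k).2].
have B0 i k : 0 <= B i k.
  by rewrite mulr_ge0 ?exprn_ge0 //; have := K0 i k; rewrite lecE => /andP[].
have -> : ravg L (fun j => cabs (visitN N (zhalf R L j) r) ^+ 2) =
    \sum_(i < N.+1) \sum_(k < N.+1) B i k.
  apply: complexI.
  have -> : toC (ravg L (fun j => cabs (visitN N (zhalf R L j) r) ^+ 2)) =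
      avg L (fun j => \sum_(i < N.+1) \sum_(k < N.+1) toC (r ^+ (i + k)) *
         ((visit i).[zhalf R L j] * (visit k).[conjc (zhalf R L j)])).
    rewrite /ravg /avg (rmorphM toC) (rmorph_sum toC) (fmorphV toC) (rmorph_nat toC).
    congr (_ * _); apply: eq_bigr => j _; apply: etrans (toC_sqr_cabs _) _.
    have -> : conjc (visitN N (zhalf R L j) r) =
        \sum_(k < N.+1) (visit k).[conjc (zhalf R L j)] * toC r ^+ k.
      rewrite /visitN (rmorph_sum conjc); apply: eq_bigr => k _.
      apply: etrans (conjcM _ _) _; congr (_ * _).
        by rewrite conj_horner_nonneg //; exact: (nonneg_visit k).2.
      have -> : toC r ^+ k = toC (r ^+ k) by rewrite rmorphXn.
      by apply/eqP; rewrite eq_complex /= oppr0 !eqxx.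
    rewrite /visitN mulr_suml; apply: eq_bigr => i _; rewrite mulr_sumr.
    by apply: eq_bigr => k _; rewrite (rmorphXn toC) exprD; ring.
  rewrite avg_sum (rmorph_sum toC); apply: eq_bigr => i _.
  rewrite avg_sum (rmorph_sum toC); apply: eq_bigr => k _.
  rewrite avgZ -avg_Kp; last first.
  - by rewrite (leq_trans (nonneg_visit k).1) // (leq_trans (ltn_ord k)).
  - by rewrite (leq_trans (nonneg_visit i).1) // (leq_trans (ltn_ord i)).
  rewrite /B (rmorphM toC); congr (_ * _).
  by apply/esym/RRe_real; rewrite ger0_real // K0.
apply: le_trans (square_le_triangle N B0) _; apply: ler_sum => n _.
have -> : \sum_(i < n.+1) B i (n - i)%N = r ^+ n * Re (pair visit visit n).
  rewrite /pair Re_sum mulr_sumr; apply: eq_bigr => i _.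
  by rewrite /B subnKC // -ltnS.
by rewrite ler_wpM2l ?exprn_ge0 // pair_visit_le.
Qed.

(** The defect from 1 / (1 - y) is the corner i + k > N, where the damping is at most r^N. *)
Lemma visitN_inv N z r : cabs z <= 1 -> 0 <= r -> r <= 1 ->
  cabs ((1 - yN N z (toC r)) * visitN N z r - 1) <= N.+1%:R * r ^+ N.
Proof.
move=> z1 r0 r1.
pose a i : C := (passC i).[z] * toC r ^+ i.
pose b i : C := (visit i).[z] * toC r ^+ i.
have hr : visitN N z r = 1 + \sum_(n < N.+1) \sum_(i < n.+1) a i * b (n - i)%N.
  have -> : (1 : C) = \sum_(n < N.+1) (val n == 0%N)%:R.
    by rewrite big_ord_recl big1 ?addr0 // => i _; rewrite lift0.
  rewrite -big_split; apply: eq_bigr => n _.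
  rewrite visit_renewal hornerD horner_sum mulrDl -[RHS]/(_ + _).
  have -> : ((val n == 0%N)%:R : {poly C}).[z] = (val n == 0%N)%:R.
    by rewrite -polyC_natr hornerC.
  congr (_ + _); first by case: n => -[|m] nN; rewrite ?mul0r // expr0 mulr1.
  rewrite mulr_suml; apply: eq_bigr => i _; rewrite hornerM /a /b.
  have -> : toC r ^+ n = toC r ^+ i * toC r ^+ (n - i) by rewrite -exprD subnKC // -ltnS.
  by ring.
have E : (1 - yN N z (toC r)) * visitN N z r - 1 =
    - \sum_(i < N.+1) \sum_(k < N.+1 | (N < i + k)%N) a i * b k.
  rewrite mulrBl mul1r {1}hr.
  have -> : yN N z (toC r) * visitN N z r = \sum_(i < N.+1) \sum_(k < N.+1) a i * b k.
    by rewrite /yN mulr_suml; apply: eq_bigr => i _; rewrite /visitN mulr_sumr.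
  rewrite (square_sum (fun i k => a i * b k)).
  by move: (\sum_(n < N.+1) _) (\sum_(i < N.+1) _) => s t; ring.
rewrite E cabsN; apply: le_trans (cabs_sum _ _ _) _.
apply: (@le_trans _ _ (\sum_(i < N.+1) mass i * (N.+1%:R * r ^+ N))); last first.
  rewrite -mulr_suml ler_piMl ?smass_le1 // mulr_ge0 ?exprn_ge0 //.
apply: ler_sum => i _; apply: le_trans (cabs_sum _ _ _) _.
apply: (@le_trans _ _ (\sum_(k < N.+1) mass i * r ^+ N)); last first.
  by rewrite sumr_const card_ord -[leLHS]mulr_natl; rewrite mulrCA.
rewrite big_mkcond; apply: ler_sum => k _; case: ifPn => ik; last first.
  by rewrite mulr_ge0 ?exprn_ge0 // mass_ge0.
have -> : a i * b k = (passC i).[z] * (visit k).[z] * toC (r ^+ (i + k)).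
  by rewrite /a /b (rmorphXn toC) exprD; ring.
rewrite !cabsM cabs_real ger0_norm ?exprn_ge0 //.
apply: ler_pM; rewrite ?mulr_ge0 ?cabs_ge0 ?exprn_ge0 //; last first.
  by rewrite ler_wiXn2l // ltnW.
have h1 := passC_cabs i z1.
have h2 := nonneg_poly_cabs (nonneg_visit k).2 z1.
have h3 := visit1_le1 k; rewrite -[mass i]mulr1.
by rewrite ler_pM ?cabs_ge0 //; apply: le_trans h2 h3.
Qed.

Lemma damping_ge0 k : 0 <= damping k.
Proof. by rewrite divr_ge0 ?addr_ge0 ?exprn_ge0. Qed.

Lemma damping_le1 k : damping k <= 1.
Proof. by rewrite ler_pdivrMr ?mul1r ?lerDl // ltr_pwDr // exprn_ge0. Qed.

Lemma bernoulli (e : R) n : 0 <= e -> 1 + n%:R * e <= (1 + e) ^+ n.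
Proof.
move=> e0; elim: n => [|n IH]; first by rewrite mul0r addr0.
rewrite exprS; apply: le_trans (ler_wpM2l _ IH); last by rewrite addr_ge0.
rewrite -natr1; have : 0 <= n%:R * e ^+ 2 by rewrite mulr_ge0 ?sqr_ge0.
by lra.
Qed.

(** With e = k^-2, Bernoulli's inequality squared gives (1 + e)^(2 M) >= (M e)^2 >= 6 M >= 2 (2 M +
    1). *)
Lemma damping_pow k M : (0 < k)%N -> (6 * k ^ 4 <= M)%N ->
  (M + M).+1%:R * damping k ^+ (M + M) <= 1 / 2.
Proof.
move=> k0 kM; have k1 : 0 < k%:R :> R by rewrite ltr0n.
pose e : R := (k%:R ^+ 2)^-1; have e0 : 0 < e by rewrite invr_gt0 exprn_gt0.
have p0' : 0 < 1 + e by rewrite addr_gt0.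
have -> : damping k = (1 + e)^-1.
  by rewrite /damping /e; field; rewrite !gt_eqF // addr_gt0 // exprn_gt0.
have M0 : 0 < M%:R :> R.
  by rewrite ltr0n (leq_trans _ kM) // muln_gt0 expn_gt0 k0.
have M1 : 1 <= M%:R :> R by rewrite ler1n -(ltr0n R).
rewrite exprVn ler_pdivrMr ?exprn_gt0 // exprD.
have b1 := bernoulli M (ltW e0).
have Me : 0 <= M%:R * e by rewrite mulr_ge0 // ltW.
have b2 : (M%:R * e) * (M%:R * e) <= (1 + e) ^+ M * (1 + e) ^+ M.
  by rewrite ler_pM //; apply: le_trans b1; rewrite lerDr.
have kM' : 6 <= M%:R * (e * e).
  have -> : e * e = (k%:R ^+ 4)^-1 by rewrite /e -invfM -exprD.
  by rewrite ler_pdivlMr ?exprn_gt0 // -natrX -natrM ler_nat.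
have b3 := ler_wpM2l (ltW M0) kM'.
have -> : (M + M).+1%:R = 2 * M%:R + 1 :> R by rewrite -natr1 natrD; ring.
move: b2 b3 M1; move: ((1 + e) ^+ M) => w; move: (M%:R) (e) => m d.
by lra.
Qed.

(** As 1 - s <= 1 / K, a is at most (6 / K) (1 + K u); inserting this in 1 / 2 <= a v and squaring
    gives 144 = 12^2. *)
Lemma inv_sqr_le (K a v u s : R) : 0 < K -> a <= u + 2 / K + 4 * (1 - s) ->
  1 / 2 <= a * v -> 1 - s <= K^-1 -> 0 <= v -> 0 <= u ->
  ((1 + K * u) ^+ 2)^-1 <= 144 / K ^+ 2 * v ^+ 2.
Proof.
move=> K0 au av sK v0 u0.
have Ku : 0 < 1 + K * u by rewrite ltr_pwDl // mulr_ge0 // ltW.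
have a1 : a <= 6 / K * (1 + K * u).
  have -> : 6 / K * (1 + K * u) = 6 / K + 6 * u by field; rewrite gt_eqF.
  lra.
have v1 : (1 + K * u)^-1 <= 12 / K * v.
  rewrite -(ler_pM2l Ku) mulfV ?gt_eqF //.
  have := ler_wpM2r v0 a1.
  have -> : (1 + K * u) * (12 / K * v) = 2 * (6 / K * (1 + K * u) * v) by ring.
  lra.
have -> : 144 / K ^+ 2 * v ^+ 2 = (12 / K * v) ^+ 2 by field; rewrite gt_eqF.
by rewrite -exprVn lerXn2r ?nnegrE ?invr_ge0 ?(ltW Ku) // mulr_ge0 // divr_ge0 // ltW.
Qed.

(** Pointwise in z, (1 + k |1 - y|)^-1 is O(|V| / k) for the damped renewal series V, whose mean
    square is bounded by the words without orders. *)
Lemma zgap_avg k : (0 < k)%N -> exists M0, forall M, (M0 <= M)%N ->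
  let N := (M + M)%N in let L := (N + N).+1 in
  k%:R * (1 - smass N) <= 1 /\ ravg L (zgap k L) <=
    144 / k%:R ^+ 2 * \sum_(n < (N + N).+1) damping k ^+ n * burgerW n.
Proof.
move=> k0; have k1 : 0 < k%:R :> R by rewrite ltr0n.
have ik : 0 < k%:R^-1 :> R by rewrite invr_gt0.
have [M0 hM0] := smass_lim ik.
exists (maxn M0 (6 * k ^ 4)) => M; rewrite geq_max => /andP[M0M kM] N L.
have MN : (M0 <= N)%N by rewrite (leq_trans M0M) // leq_addr.
have sN := ltW (hM0 _ MN); split.
  by have := ler_wpM2l (ltW k1) sN; rewrite mulfV // gt_eqF.
have NL : (N < L)%N by rewrite ltnS leq_addr.
apply: le_trans (ler_wpM2l _ (visitN_avg (damping_ge0 k) NL)); last first.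
  by rewrite divr_ge0 // exprn_ge0.
rewrite /ravg mulrCA ler_wpM2l ?invr_ge0 // mulr_sumr; apply: ler_sum => j _.
have z1 := cabs_zhalf L j; set z := zhalf R L j in z1 *.
have h1 := visitN_inv N z1 (damping_ge0 k) (damping_le1 k).
have h2 := damping_pow k0 kM.
have h3 := yN_damped N k0 z1.
have h4 : 1 / 2 <= cabs (1 - yN N z (toC (damping k))) * cabs (visitN N z (damping k)).
  rewrite -cabsM; have := cabs_dist 1 (1 - (1 - yN N z (toC (damping k))) * visitN N z (damping k)).
  have -> : 1 - (1 - (1 - yN N z (toC (damping k))) * visitN N z (damping k)) =
     (1 - yN N z (toC (damping k))) * visitN N z (damping k) by ring.
  by rewrite cabs1 cabsB; move: (le_trans h1 h2); lra.
rewrite /zgap -/z.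
exact: (inv_sqr_le k1 h3 h4 sN (cabs_ge0 _) (cabs_ge0 _)).
Qed.

End Estimates.

(** * Regular variation *)

Section Tauberian.
Variable R : realType.

Lemma powR2_gt_half (mu : R) : mu < 1 -> 1 / 2 < 2 `^ (- mu).
Proof.
move=> mu1; have -> : 1 / 2 = 2 `^ (- 1) :> R by rewrite powRN powRr1 // div1r.
have l2 : 0 < ln 2 :> R by rewrite ln_gt0 // ltr1n.
by rewrite /powR !gt_eqF ?ltr0n // ltr_expR ltr_pM2r ?ltrN2.
Qed.

Lemma mu_exp_lt1 (p : R) : mu_exp p < 1.
Proof.
rewrite /mu_exp; set x := _ / p; have a := atan_ltpi2 x; have q := pi_gt0 R.
have d : 0 < 2 * (pi - atan x) by lra.
rewrite ltr_pdivrMr // mul1r; lra.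
Qed.

(** The ratio b (2 n) / b n tends to 2^-mu, which exceeds 1 / 2 as mu < 1; theta is the midpoint. *)
Lemma slowly_varying_doubling (psi : R -> R) (b : nat -> R) (mu : R) :
  (forall t, 0 <= t -> 0 < psi t) -> slowly_varying psi -> mu < 1 ->
  (forall n, (0 < n)%N -> b n = psi n%:R * n%:R `^ (- mu)) ->
  exists theta, 1 / 2 < theta /\
    exists n0, forall n, (n0 <= n)%N -> theta * b n <= b (n + n)%N.
Proof.
move=> psi0 sv mu1 bE; set w : R := 2 `^ (- mu).
have w2 : 1 / 2 < w by exact: powR2_gt_half.
pose theta := (1 / 2 + w) / 2; exists theta; split; first by rewrite /theta; lra.
have tw : theta / w < 1 by rewrite ltr_pdivrMr ?mul1r /theta; lra.
have e0 : 0 < 1 - theta / w by rewrite subr_gt0.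
have /cvgrPdist_lt /(_ _ e0) [T [_ hT]] := sv 2 (ltr0n R 2).
exists (Num.truncn (Num.max T 0)).+2 => n nT.
have n1 : 0 < n%:R :> R by rewrite ltr0n; case: n nT.
have Tn : T < n%:R.
  apply: (@le_lt_trans _ _ (Num.max T 0)); first by rewrite le_max lexx.
  apply: (lt_le_trans (truncnS_gt _)); rewrite ler_nat; exact: ltnW.
have := hT _ Tn; rewrite /= ltr_norml => /andP[_].
rewrite ltrBlDl -ltrBlDr opprB addrCA subrr addr0 => h.
rewrite !bE; [|lia|lia].
have -> : (n + n)%:R = 2 * n%:R :> R by rewrite natrD; ring.
have P0 : 0 < psi n%:R by apply: psi0.
rewrite ltr_pdivlMr // in h.
rewrite powRM // -/w.
have -> : theta * (psi n%:R * n%:R `^ (- mu)) = theta / w * psi n%:R * (w * n%:R `^ (- mu)).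
  by field; rewrite gt_eqF //; lra.
by rewrite ler_wpM2r ?(ltW h) // mulr_ge0 ?powR_ge0.
Qed.

Lemma le_of_step (b : nat -> R) : (forall n, b n.+1 <= b n) ->
  forall m n, (m <= n)%N -> b n <= b m.
Proof.
move=> bS m n mn; rewrite -(subnK mn); elim: (n - m)%N => [|j IH] //.
by rewrite addSn; apply: le_trans (bS _) IH.
Qed.

(** Induction from N to n, half of N rounded up: the terms from n to N are at most b n <= b N /
    theta, and theta > 1 / 2 leaves room for them. *)
Lemma sum_le_last (b : nat -> R) (theta : R) :
  (forall n, b n.+1 <= b n) -> (forall n, 0 < b n) -> 1 / 2 < theta ->
  (exists n0, forall n, (n0 <= n)%N -> theta * b n <= b (n + n)%N) ->
  exists2 C, 0 < C & forall N, (0 < N)%N -> \sum_(m < N) b m <= C * N%:R * b N.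
Proof.
move=> bS b0 th [n0 hn0].
have bd := le_of_step bS.
pose s := theta - 1 / 2; have s0 : 0 < s by rewrite subr_gt0.
pose n1 := maxn n0.*2 (Num.truncn (s^-1)).+1.
have S0 n : 0 <= \sum_(m < n) b m by apply: sumr_ge0 => m _; exact: ltW.
(* The second summand serves the base range N <= n1, the first one the induction. *)
pose C := s^-1 + (\sum_(m < n1) b m) / b n1.
have C1 : s^-1 <= C by rewrite lerDl divr_ge0 // ltW.
have C2 : (\sum_(m < n1) b m) / b n1 <= C by rewrite lerDr invr_ge0 ltW.
have C0 : 0 < C by apply: lt_le_trans C1; rewrite invr_gt0.
exists C => //; elim/ltn_ind => N IH N0.
have N1 : 1 <= N%:R :> R by rewrite ler1n.
have [small|big] := leqP N n1.
  apply: (@le_trans _ _ (\sum_(m < n1) b m)).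
    rewrite (big_ord_widen n1 b small) [leLHS]big_mkcond; apply: ler_sum => m _.
    by case: ifP => // _; exact: ltW.
  have := C2; rewrite ler_pdivrMr // => /le_trans; apply.
  by rewrite -mulrA ler_wpM2l ?(ltW C0) // (le_trans (bd _ _ small)) // ler_peMl ?(ltW (b0 _)).
have sN : 1 <= s * N%:R.
  rewrite -(ler_pM2l (_ : 0 < s^-1)) ?invr_gt0 // mulr1 mulKf ?gt_eqF //.
  apply: ltW; apply: lt_le_trans (truncnS_gt _) _; rewrite ler_nat.
  exact: leq_trans (leq_maxr _ _) (ltnW big).
pose n := uphalf N.
have nE : (odd N + N = n + n)%N by have := odd_double_half N; rewrite /n uphalf_half -addnn; lia.
have oN : (odd N <= 1)%N := leq_b1 _.
have nN : (n <= N)%N by lia.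
have big0 : (n0.*2 < N)%N := leq_ltn_trans (leq_maxl _ _) big.
have big1 : (1 < N)%N by apply: leq_ltn_trans big; rewrite /n1 leq_max orbT.
clearbody n1 n.
have nn : (n < N)%N by lia.
have n_pos : (0 < n)%N by lia.
have n2 : (N <= n + n <= N.+1)%N by lia.
have n0n : (n0 <= n)%N by lia.
have hb : theta * b n <= b N.
  by apply: le_trans (hn0 _ n0n) _; apply: bd; case/andP: n2.
have h1 := IH n nn n_pos.
have h2 : \sum_(m < N) b m <= \sum_(m < n) b m + (N%:R - n%:R) * b n.
  rewrite -(subnKC nN) big_split_ord /= lerD2l natrD addrC addKr.
  apply: (@le_trans _ _ (\sum_(i < N - n) b n)).
    by apply: ler_sum => i _; apply: bd; rewrite leq_addr.
  by rewrite sumr_const card_ord mulr_natl.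
apply: le_trans h2 _; apply: le_trans (lerD h1 (lexx _)) _.
have m2 : n%:R * 2 <= N%:R + 1 :> R.
  by rewrite natr1 -natrM ler_nat; case/andP: n2 => _; rewrite muln2 -addnn.
have m3 : N%:R <= n%:R * 2 :> R.
  by rewrite -natrM ler_nat; case/andP: n2; rewrite muln2 -addnn.
have CN : 1 <= s * C by rewrite mulrC -ler_pdivrMr // mul1r.
(* Half of the surplus C s N pays for the rounding, C / 2, and the other half for the new terms, at
   most N / 2. *)
have key : C * n%:R + (N%:R - n%:R) <= C * N%:R * theta.
  have -> : theta = s + 1 / 2 by rewrite /s; ring.
  have e1 := ler_wpM2l (ltW C0) m2; have e2 := ler_wpM2l (ltW C0) sN.
  have e3 := ler_wpM2r (ltW (lt_le_trans ltr01 N1)) CN.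
  lra.
apply: (@le_trans _ _ (C * N%:R * theta * b n)).
  by rewrite -mulrDl ler_wpM2r // ltW.
by rewrite -mulrA ler_wpM2l // mulr_ge0 // ltW.
Qed.

(** Below k^2 drop the damping; from there on bound b by its value at k^2 and use that 1 / (1 - r) =
    k^2 + 1. *)
Lemma damped_sum_le (b : nat -> R) k N : (0 < k)%N ->
  (forall n, b n.+1 <= b n) -> (forall n, 0 <= b n) ->
  \sum_(m < N) damping R k ^+ m * b m <=
  \sum_(m < k ^ 2) b m + (k%:R ^+ 2 + 1) * b (k ^ 2)%N.
Proof.
move=> k0 bS b0; have k1 : 0 < k%:R :> R by rewrite ltr0n.
have bd := le_of_step bS.
set r := damping R k; have r0 : 0 <= r := damping_ge0 R k.
have r1 : r <= 1 := damping_le1 R k.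
have kk : 0 < k%:R ^+ 2 + 1 :> R by rewrite ltr_pwDr // exprn_ge0.
have rE : (1 - r) * (k%:R ^+ 2 + 1) = 1 by rewrite /r /damping; field; rewrite gt_eqF.
apply: (@le_trans _ _ (\sum_(m < N) ((m < k ^ 2)%:R * b m + r ^+ m * b (k ^ 2)%N))).
  apply: ler_sum => m _; case: ltnP => mk.
    by rewrite mul1r ler_wpDr ?mulr_ge0 ?exprn_ge0 // ler_piMl ?exprn_ile1.
  by rewrite mul0r add0r ler_wpM2l ?exprn_ge0 // bd.
rewrite big_split /= lerD //.
  have [Nk|Nk] := leqP N (k ^ 2).
    rewrite [leRHS](bigID (fun m : 'I_(k ^ 2) => (m < N)%N)) /=.
    rewrite -(big_ord_widen _ b Nk) ler_wpDr ?sumr_ge0 //; apply: ler_sum => m _.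
    by rewrite ler_piMl // lern1 leq_b1.
  rewrite (big_ord_widen _ b (ltnW Nk)) [leRHS]big_mkcond; apply: ler_sum => m _.
  by case: ifP; rewrite ?mul1r ?mul0r.
rewrite -mulr_suml ler_wpM2r // -(ler_pM2l (_ : 0 < 1 - r)); last first.
  by rewrite -(ltr_pM2r kk) mul0r rE.
have -> : (1 - r) * \sum_(i < N) r ^+ i = 1 - r ^+ N.
  by rewrite -opprB mulNr -subrX1 opprB.
by rewrite rE gerBl exprn_ge0.
Qed.

End Tauberian.

(** * The bound for words *)

Section StackBound.
Variables (R : realType) (p : R).
Hypotheses (hp0 : 0 < p) (hp1 : p < 1 / 2).

(** One factor k^-2 is the mean over x, the other comes from [zgap_avg]. The cut-off depends on n,
    but A does not. *)
Lemma stackW_damped : exists2 A, 0 < A & forall k n h c,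
  (0 < k)%N -> (k <= h)%N -> (k <= c)%N -> exists N,
  stackW p n h c <= A / k%:R ^+ 4 * \sum_(m < N) damping R k ^+ m * burgerW p m.
Proof.
have [A A0 hA] := stackW_avg hp0 hp1.
exists (144 * A); first by rewrite mulr_gt0.
move=> k n h c k0 kh kc; have [M0 hM0] := zgap_avg hp0 hp1 k0.
pose M := maxn M0 n; have [|s1 s2] := hM0 M; first by rewrite leq_maxl.
exists (M + M + (M + M)).+1.
have nM : (n <= M + M)%N by rewrite (leq_trans (leq_maxr M0 n)) // leq_addr.
have ML : (M + M < (M + M + (M + M)).+1)%N by rewrite ltnS leq_addr.
have oL : odd (M + M + (M + M)).+1 by rewrite /= !addnn odd_double.
have k1 : 0 < k%:R :> R by rewrite ltr0n.
apply: le_trans (hA k n h c _ _ k0 kh kc nM ML oL s1) _.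
have e0 : 0 <= A / k%:R ^+ 2 by rewrite divr_ge0 ?exprn_ge0 // ltW.
apply: le_trans (ler_wpM2l e0 s2) _; set S := \sum_(m < _) _.
by apply: le_of_eq; field; rewrite gt_eqF.
Qed.

End StackBound.

(** * From words to events *)

Lemma hasN_order r : ~~ has is_order r = all is_burger r.
Proof. by rewrite -all_predC. Qed.

Lemma burgers_prefix x y : all is_burger (reduce (x ++ y)) -> all is_burger (reduce x).
Proof.
have [ o [b [rE oO bB]]] := reduce_reduced x.
rewrite reduce_catl rE -catA reduce_orders_cat // !all_cat bB.
by case: o oO {rE} => //= u o /andP[]; rewrite /is_burger => ->.
Qed.

Lemma stack_exhaust (R : realType) n x : size x = n ->
  \sum_(h < n.+1) \sum_(c < n.+1) (is_stack h c (reduce x))%:R =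
  (all is_burger (reduce x))%:R :> R.
Proof.
move=> xn; set r := reduce x.
have cn a : (count a r < n.+1)%N.
  by rewrite ltnS (leq_trans (count_size _ _)) // -xn size_reduce.
case: (boolP (all is_burger r)) => rB; last first.
  by rewrite big1 // => h _; rewrite big1 // => c _; rewrite /is_stack (negbTE rB).
rewrite (bigD1 (Ordinal (cn (pred1 B_H)))) //= [X in _ + X]big1 => [|h hn].
  rewrite addr0 (bigD1 (Ordinal (cn (pred1 B_C)))) //= [X in _ + X]big1 => [|c cn'].
    by rewrite addr0 /is_stack rB !eqxx.
  rewrite /is_stack [_ == val c](_ : _ = false) ?andbF //.
  by apply: contraNF cn' => /eqP e; apply/eqP/val_inj; rewrite /= e.
rewrite big1 // => c _; rewrite /is_stack [_ == val h](_ : _ = false) ?andbF //.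
by apply: contraNF hn => /eqP e; apply/eqP/val_inj; rewrite /= e.
Qed.

Lemma burgerWE (R : realType) (p : R) n :
  burgerW p n = Ew p n (fun x => (all is_burger (reduce x))%:R).
Proof.
rewrite -(eq_Ew p (stack_exhaust R (n := n))) Ew_sum; apply: eq_bigr => h _.
by rewrite Ew_sum.
Qed.

Section Bridge.
Variables (R : realType) (p : R) (d : measure_display) (T : measurableType d).
Variables (P : probability T R) (X : int -> {RV P >-> Theta}).
Hypothesis iidX : iid_letters X p.

Lemma lettersE n w : letters X 1 n%:Z w = [seq X (1 + k%:Z) w | k <- iota 0 n].
Proof.
rewrite /letters; congr (map _ (iota 0 _)); case: n => [|n] //.
by rewrite -[1 <= _]/true; congr _.+1; lia.
Qed.

Lemma letters_prefix i n w : (i <= n)%N ->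
  exists y, letters X 1 n%:Z w = letters X 1 i%:Z w ++ y.
Proof.
move=> /subnKC <-; rewrite !lettersE iotaD map_cat; eexists; reflexivity.
Qed.

Lemma measurable_pattern (s : seq int) (A : int -> set Theta) :
  measurable [set w | forall i, i \in s -> A i (X i w)].
Proof.
elim: s => [|i s IH].
  by rewrite [X in measurable X](_ : _ = setT) //; apply/seteqP; split.
rewrite [X in measurable X](_ : _ = (X i @^-1` A i) `&`
    [set w | forall i, i \in s -> A i (X i w)]).
  by apply: measurableI => //; exact: measurable_funPTI.
apply/seteqP; split => w /=.
  by move=> h; split => [|j js]; apply: h; rewrite inE ?eqxx // js orbT.
by move=> [h1 h2] j; rewrite inE => /orP[/eqP->|/h2].
Qed.

Lemma word_pattern x : [set w | letters X 1 (size x)%:Z w = x] =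
  [set w | forall i, i \in [seq 1 + k%:Z | k <- iota 0 (size x)] ->
     X i w = nth B_H x (absz (i - 1)%R)].
Proof.
apply/seteqP; split => w /=.
  move=> e i /mapP[k]; rewrite mem_iota add0n => /= kx ->.
  have -> : absz (1 + k%:Z - 1)%R = k by lia.
  by rewrite -[in RHS]e lettersE (nth_map 0%N) ?size_iota // nth_iota.
move=> h; rewrite lettersE; apply: (@eq_from_nth _ B_H); rewrite size_map size_iota //.
move=> k kx; rewrite (nth_map 0%N) ?size_iota // nth_iota // add0n.
rewrite h; last by apply: map_f; rewrite mem_iota.
by congr nth; lia.
Qed.

Lemma P_word x :
  P [set w | letters X 1 (size x)%:Z w = x] = (\prod_(t <- x) Theta_weight p t)%:E.
Proof.
case: iidX => indep marg; rewrite word_pattern.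
rewrite (indep _ (fun i => [set nth B_H x (absz (i - 1)%R)])); last first.
  by rewrite map_inj_uniq ?iota_uniq // => i j /addrI [].
rewrite big_map [in RHS](big_nth B_H) /index_iota subn0.
elim: (iota 0 (size x)) => [|k s IH]; first by rewrite !big_nil.
rewrite !big_cons IH marg -EFinM.
by have -> : absz (1 + k%:Z - 1)%R = k by lia.
Qed.

Lemma measurable_word x : measurable [set w | letters X 1 (size x)%:Z w = x].
Proof. by rewrite word_pattern; apply: (measurable_pattern _ (fun i => [set nth B_H x (absz (i - 1)%R)])). Qed.

Lemma P_words n (s : seq (seq Theta)) : uniq s -> all (fun x => size x == n) s ->
  measurable [set w | letters X 1 n%:Z w \in s] /\
  P [set w | letters X 1 n%:Z w \in s] =
  (\sum_(x <- s) \prod_(t <- x) Theta_weight p t)%:E.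
Proof.
elim: s => [|x s IH] /=.
  move=> _ _; rewrite big_nil [[set w | _]](_ : _ = set0) ?measure0 //.
  by apply/seteqP; split.
move=> /andP[xs us] /andP[/eqP xn sn]; have [mS PS] := IH us sn; subst n.
have -> : [set w | letters X 1 (size x)%:Z w \in x :: s] =
    [set w | letters X 1 (size x)%:Z w = x] `|`
    [set w | letters X 1 (size x)%:Z w \in s].
  apply/seteqP; split => w /=; rewrite inE.
    by move=> /orP[/eqP|]; [left|right].
  by move=> [->|->]; rewrite ?eqxx ?orbT.
have mx := measurable_word x; split; first exact: measurableU.
rewrite big_cons EFinD -PS -P_word; apply: measureU => //.
by apply/seteqP; split => w //= [-> sx]; rewrite sx in xs.
Qed.

Lemma P_letters n (Q : pred (seq Theta)) :
  measurable [set w | Q (letters X 1 n%:Z w)] /\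
  P [set w | Q (letters X 1 n%:Z w)] = (Ew p n (fun x => (Q x)%:R))%:E.
Proof.
have -> : [set w | Q (letters X 1 n%:Z w)] =
    [set w | letters X 1 n%:Z w \in [seq x <- words n | Q x]].
  apply/seteqP; split => w /=; rewrite mem_filter words_size.
    by move=> ->; rewrite lettersE size_map size_iota eqxx.
  by case/andP.
have [||m ->] := @P_words n [seq x <- words n | Q x].
- by rewrite filter_uniq // words_uniq.
- by apply/allP => x; rewrite mem_filter words_size => /andP[].
split => //; congr EFin; rewrite big_filter big_mkcond /Ew.
by apply: eq_bigr => x _; case: (Q x); rewrite ?mulr1 ?mulr0.
Qed.

Lemma P_event_E n h c : P (event_E X n h c) = (stackW p n h c)%:E.
Proof.
have -> : event_E X n h c =
    [set w | is_stack h c (reduce (letters X 1 n%:Z w))].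
  apply/seteqP; split => w; rewrite /event_E /= /is_stack -hasN_order.
    by case=> -> -> ->; rewrite !eqxx.
  by case/and3P => ? /eqP ? /eqP ?.
exact: (P_letters n (fun x => is_stack h c (reduce x))).2.
Qed.

(** An order that is left stays in all longer words, so I exceeds n exactly when none is left at
    time n. *)
Lemma order_time_gt n : [set w | (n%:R%:E < order_time X w)%E] =
  [set w | all is_burger (reduce (letters X 1 n%:Z w))].
Proof.
apply/seteqP; split => w /=.
  move=> nI; rewrite -hasN_order; apply/negP => ho.
  case: n nI ho => [|n] nI; first by rewrite lettersE.
  move=> ho; move: nI; rewrite ltNge => /negP; apply.
  by apply: ereal_inf_lbound => /=; exists n.+1.
move=> bn; apply: (@lt_le_trans _ _ (n.+1%:R%:E)); first by rewrite lte_fin ltr_nat.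
apply: le_ereal_inf_tmp => _ /= [i [i0 io] <-]; rewrite lee_fin ler_nat ltnNge.
apply/negP => ni; move: io; rewrite /Xred; apply/negP; rewrite hasN_order.
by have [y E] := letters_prefix w ni; rewrite E in bn; exact: burgers_prefix bn.
Qed.

Lemma P_order_time n : P [set w | (n%:R%:E < order_time X w)%E] = (burgerW p n)%:E.
Proof.
by rewrite order_time_gt (P_letters n (fun x => all is_burger (reduce x))).2 burgerWE.
Qed.

Lemma burgerW_nonincreasing n : burgerW p n.+1 <= burgerW p n.
Proof.
rewrite -lee_fin -!P_order_time; apply: le_measure; rewrite ?inE.
- by rewrite order_time_gt; exact: (P_letters n.+1 (fun x => all is_burger (reduce x))).1.
- by rewrite order_time_gt; exact: (P_letters n (fun x => all is_burger (reduce x))).1.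
by move=> w /=; apply: le_lt_trans; rewrite lee_fin ler_nat.
Qed.

End Bridge.

Theorem proposition3p6 (R : realType) (p : R) (hp0 : 0 < p) (hp1 : p < 1 / 2) :
  exists2 K : R, 0 < K &
    forall (d : measure_display) (T : measurableType d) (P : probability T R)
      (X : int -> {RV P >-> Theta}) (psi0 : R -> R),
      iid_letters X p ->
      (forall t : R, 0 <= t -> 0 < psi0 t) ->
      slowly_varying psi0 ->
      (forall n : nat, (0 < n)%N ->
        P [set w | (n%:R%:E < order_time X w)%E] =
        (psi0 n%:R * n%:R `^ (- mu_exp p))%:E) ->
      forall n h c : nat, (0 < n)%N -> (0 < h)%N -> (0 < c)%N ->
        (P (event_E X n h c) <=
         (K * psi0 ((minn h c)%:R ^+ 2)
            * (minn h c)%:R `^ (- 2 - 2 * mu_exp p))%:E)%E.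
Proof.
have [A A0 hA] := stackW_damped hp0 hp1.
(* The constant may not depend on the probability space, but whether the
   following holds depends on p only. *)
pose regular := exists2 C : R, 0 < C & forall k N, (0 < k)%N ->
  \sum_(m < N) damping R k ^+ m * burgerW p m <= C * k%:R ^+ 2 * burgerW p (k ^ 2)%N.
have [ [C C0 hC]|irregular] := pselect regular; last first.
  (* Any model satisfying the hypotheses would make p regular, so in this case every constant will
     do. *)
  exists 1 => // d T P X psi0 iidX psi_gt0 sv hI; exfalso; apply: irregular.
  have bE n : (0 < n)%N -> burgerW p n = psi0 n%:R * n%:R `^ (- mu_exp p).
    by move=> n0; apply: EFin_inj; rewrite -(P_order_time iidX) hI.
  have bS := burgerW_nonincreasing iidX.
  have bS0 n : 0 < burgerW p n.+1.
    by rewrite bE // mulr_gt0 ?psi_gt0 // powR_gt0 // ltr0n.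
  (* The hypothesis on I starts at n = 1; monotonicity covers 0. *)
  have b0 n : 0 < burgerW p n by exact: lt_le_trans (bS0 n) (bS n).
  have [theta [th doubling]] := slowly_varying_doubling psi_gt0 sv (mu_exp_lt1 p) bE.
  have [C C0 hC] := sum_le_last bS b0 th doubling.
  (* The 2 absorbs k^2 + 1 <= 2 k^2 from [damped_sum_le]. *)
  exists (C + 2) => [|k N k0]; first by rewrite addr_gt0.
  apply: le_trans (damped_sum_le N k0 bS (fun n => ltW (b0 n))) _.
  have k2 : (0 < k ^ 2)%N by rewrite expn_gt0 k0.
  apply: le_trans (lerD (hC _ k2) (lexx _)) _; rewrite natrX.
  have k1 : 1 <= k%:R ^+ 2 :> R by rewrite -natrX ler1n.
  by rewrite -mulrDl ler_wpM2r ?(ltW (b0 _)) //; lra.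
exists (A * C) => [|d T P X psi0 iidX psi_gt0 sv hI n h c n0 h0 c0].
  exact: mulr_gt0.
rewrite (P_event_E iidX) lee_fin; set k := minn h c.
have k0 : (0 < k)%N by rewrite leq_min h0.
have k2 : (0 < k ^ 2)%N by rewrite expn_gt0 k0.
have k1 : 0 < k%:R :> R by rewrite ltr0n.
have [N hN] := hA k n h c k0 (geq_minl _ _) (geq_minr _ _).
apply: le_trans hN _.
have A4 : 0 <= A / k%:R ^+ 4 by rewrite divr_ge0 ?exprn_ge0 // ltW.
apply: le_trans (ler_wpM2l A4 (hC k N k0)) _.
have -> : burgerW p (k ^ 2)%N = psi0 (k%:R ^+ 2) * k%:R `^ (- (2 * mu_exp p)).
  apply: EFin_inj; rewrite -(P_order_time iidX) hI // natrX; congr (_ * _)%:E.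
  by rewrite -[in RHS]mulrN [RHS]powRrM powR_mulrn // ltW.
have -> : k%:R `^ (- 2 - 2 * mu_exp p) = (k%:R ^+ 2)^-1 * k%:R `^ (- (2 * mu_exp p)).
  rewrite powRD; last by apply/implyP => _; rewrite gt_eqF.
  by congr (_ * _); rewrite powRN powR_mulrn // ltW.
apply: le_of_eq.
by move: (psi0 _) (_ `^ _) => u v; field; rewrite gt_eqF.
Qed.
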